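(* Let $0<\lambda\le\Lambda_{N,s}$, let $g\ge 0$ in $\Omega\times(0,T)$, and let $u_0\in L^1(\Omega)$ with $u_0\ge 0$, $u_0\not\equiv 0$. Assume that $\tilde u$ is a positive weak supersolution to the problem $$ u_t+(-\Delta)^su=\lambda\frac{u}{|x|^{2s}}+g(x,t)\ \text{ in }\Omega\times(0,T),\qquad u=0\ \text{ in }(\mathbb{R}^N\setminus\Omega)\times[0,T),\qquad u(x,0)=u_0(x)\ \text{ in }\Omega . $$ Then $g$ and $u_0$ must satisfy $$ \int_{t_1}^{t_2}\int_{B_r(0)}|x|^{-\gamma}g\,dx\,dt<+\infty,\qquad \int_{B_r(0)}|x|^{-\gamma}u_0\,dx<+\infty $$ for any cylinder $B_r(0)\times(t_1,t_2)\subset\subset\Omega\times(0,T)$.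
   Context: Throughout, $0<s<1$, $N>2s$, $\Omega\subset\mathbb{R}^N$ is a bounded $C^{1,1}$ domain with $0\in\Omega$, and $0<T<\infty$. The fractional Laplacian is $(-\Delta)^su(x)=a_{N,s}\,\mathrm{P.V.}\int_{\mathbb{R}^N}\frac{u(x)-u(y)}{|x-y|^{N+2s}}dy$ with $a_{N,s}=2^{2s}\pi^{-N/2}\frac{\Gamma(\frac{N+2s}{2})}{|\Gamma(-s)|}$, so that $(-\Delta)^su=\mathcal{F}^{-1}(|\xi|^{2s}\mathcal{F}u)$ on the Schwartz class. The fractional Hardy constant is $\Lambda_{N,s}=2^{2s}\frac{\Gamma^2(\frac{N+2s}{4})}{\Gamma^2(\frac{N-2s}{4})}$. For $0<\lambda\le\Lambda_{N,s}$, $\alpha\in[0,\frac{N-2s}{2})$ is determined by $$\lambda=\frac{2^{2s}\,\Gamma(\frac{N+2s+2\alpha}{4})\Gamma(\frac{N+2s-2\alpha}{4})}{\Gamma(\frac{N-2s+2\alpha}{4})\Gamma(\frac{N-2s-2\alpha}{4})},\qquad\text{and}\qquad \gamma=\frac{N-2s}{2}-\alpha .$$ Test class: $\mathcal{T}$ is the set of $\phi:\mathbb{R}^N\times[0,T]\to\mathbb{R}$ such that $-\phi_t+(-\Delta)^s\phi=\varphi$ in $\Omega\times(0,T)$ for some bounded $\varphi$ on $\Omega\times(0,T)$ that is Hölder continuous in space and time ($\varphi\in L^\infty\cap\mathcal{C}^{\alpha',\beta'}(\Omega\times(0,T))$ for some exponents), with $\phi=0$ in $(\mathbb{R}^N\setminus\Omega)\times(0,T]$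 and $\phi(x,T)=0$ in $\Omega$; such $\phi$ is the bounded finite-energy solution, and it satisfies the equation pointwise (strong solution). Weak supersolution of $u_t+(-\Delta)^su=F(x,t,u)$ with zero exterior datum and initial datum $u_0\in L^1(\Omega)$: $u\in\mathcal{C}([0,T);L^1(\Omega))$ with $F(x,t,u)\in L^1(\Omega\times[0,T))$, $u\ge0$ in $(\mathbb{R}^N\setminus\Omega)\times[0,T)$, $u(x,0)\ge u_0(x)$ in $\Omega$, and for all nonnegative $\phi\in\mathcal{T}$ $$\int_0^T\!\!\int_\Omega-\phi_tu\,dx\,dt+\int_0^T\!\!\int_{\mathbb{R}^N}u(-\Delta)^s\phi\,dx\,dt\ge\int_0^T\!\!\int_\Omega F\phi\,dx\,dt+\int_\Omega u_0(x)\phi(x,0)\,dx .$$ Here $F=\lambda\frac{u}{|x|^{2s}}+g$. ''Positive'' means $u>0$ in $\Omega\times(0,T)$. *)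

(* Defs.v *)
From HB Require Import structures.
From mathcomp Require Import all_boot all_order all_algebra.
From mathcomp Require Import all_classical all_reals all_analysis.
Set Implicit Arguments.
Unset Strict Implicit.
Unset Printing Implicit Defensive.
Import Order.TTheory GRing.Theory Num.Theory.
Import numFieldNormedType.Exports.
Local Open Scope classical_set_scope.
Local Open Scope ring_scope.

Definition measure_rV_display : measure_display.
Proof. exact: default_measure_display. Qed.

Section rV_measurable.
Context {R : realType} {n : nat}.

Definition rV_coord (i : 'I_n) (x : 'rV[R]_n) : measurableTypeR R := x ord0 i.

Let rV_set0 : g_sigma_preimage rV_coord set0.
Proof. exact: sigma_algebra0. Qed.

Let rV_setC A : g_sigma_preimage rV_coord A -> g_sigma_preimage rV_coord (~` A).
Proof. exact: sigma_algebraC. Qed.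

Let rV_bigcup (F : (set 'rV[R]_n)^nat) :
  (forall i, g_sigma_preimage rV_coord (F i)) ->
  g_sigma_preimage rV_coord (\bigcup_i F i).
Proof. exact: sigma_algebra_bigcup. Qed.

HB.instance Definition _ := @isMeasurable.Build measure_rV_display
  'rV[R]_n (g_sigma_preimage rV_coord) rV_set0 rV_setC rV_bigcup.

Lemma measurable_rV_coord (i : 'I_n) : measurable_fun setT (rV_coord i).
Proof.
move=> _ Y mY; rewrite setTI; apply: sub_sigma_algebra => /=.
rewrite -bigcup_seq/=; exists i => /=; first by rewrite mem_index_enum.
by exists Y => //; rewrite setTI.
Qed.

Lemma measurable_fun_rVP d (T : measurableType d) (f : T -> 'rV[R]_n) :
  measurable_fun setT f <->
  forall i, measurable_fun setT (fun x => rV_coord i (f x)).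
Proof.
split=> [mf i|mf].
  exact: (measurableT_comp (measurable_rV_coord i) mf).
apply: (@measurability _ _ _ _ setT f
  (\big[setU/set0]_(i < n) preimage_set_system setT (rV_coord i) measurable)) => //.
move=> _ [B + <-]; rewrite -bigcup_seq => -[i _] [C mC <-].
rewrite setTI; have := mf i measurableT C mC.
by rewrite !setTI.
Qed.

End rV_measurable.

(* The canonical [SigmaFiniteMeasure] instance of a product is shadowed in the
   library by the one for subprobabilities. *)
Lemma product_sigma_finite d1 d2 (T1 : measurableType d1)
    (T2 : measurableType d2) (R : realType)
    (m1 : {sigma_finite_measure set T1 -> \bar R})
    (m2 : {sigma_finite_measure set T2 -> \bar R}) :
  sigma_finite setT (m1 \x m2)%E.
Proof.
have /sigma_finiteP[F [TF ndF Foo]] := sigma_finiteT m1.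
have /sigma_finiteP[G [TG ndG Goo]] := sigma_finiteT m2.
exists (fun n => F n `*` G n).
  rewrite -setXTT TF TG predeqE => -[x y]; split.
    move=> [/= [n _ Fnx] [k _ Gky]]; exists (maxn n k) => //; split.
    - by move: x Fnx; exact/subsetPset/ndF/leq_maxl.
    - by move: y Gky; exact/subsetPset/ndG/leq_maxr.
  by move=> [n _ []/= ? ?]; split; exists n.
move=> k; have [? ?] := Foo k; have [? ?] := Goo k.
split; first exact: measurableX.
by rewrite product_measure1E// lte_mul_pinfty// ge0_fin_numE.
Qed.

Section lebesgue_rV.
Context (R : realType).
Local Notation mu := (@lebesgue_measure R).

Definition rV_cons n (z : measurableTypeR R * 'rV[R]_n) : 'rV[R]_n.+1 :=
  \row_i (if unlift ord0 i is Some j then z.2 ord0 j else z.1).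

Definition rV_split n (x : 'rV[R]_n.+1) : measurableTypeR R * 'rV[R]_n :=
  (x ord0 ord0, \row_j x ord0 (lift ord0 j)).

Lemma rV_consK n : cancel (@rV_cons n) (@rV_split n).
Proof.
case=> a x; rewrite /rV_split /rV_cons !mxE unlift_none /=; congr pair.
by apply/rowP => j; rewrite !mxE liftK.
Qed.

Lemma rV_splitK n : cancel (@rV_split n) (@rV_cons n).
Proof.
move=> x; apply/rowP => i; rewrite !mxE; case: unliftP => [j ->|->] //=.
by rewrite mxE.
Qed.

Lemma measurable_rV_cons n : measurable_fun setT (@rV_cons n).
Proof.
apply/measurable_fun_rVP => i; rewrite /rV_coord /rV_cons.
case: (unliftP ord0 i) => [j ->|->].
- rewrite (_ : (fun _ => _) = rV_coord j \o snd).
    exact: (measurableT_comp (measurable_rV_coord j) measurable_snd).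
  by apply/funext => z; rewrite mxE liftK.
- rewrite (_ : (fun _ => _) = fst); first exact: measurable_fst.
  by apply/funext => z; rewrite mxE unlift_none.
Qed.

Lemma measurable_rV_split n : measurable_fun setT (@rV_split n).
Proof.
apply/measurable_fun_pairP; split.
  exact: (measurable_rV_coord ord0).
apply/measurable_fun_rVP => j; rewrite /rV_coord /=.
rewrite (_ : (fun _ => _) = rV_coord (lift ord0 j)).
  exact: measurable_rV_coord.
by apply/funext => x /=; rewrite mxE.
Qed.

Section step.
Context n (m : {sigma_finite_measure set 'rV[R]_n -> \bar R}).

Definition leb_step : set 'rV[R]_n.+1 -> \bar R :=
  pushforward (mu \x m)%E (@rV_cons n).

Let leb_step0 : leb_step set0 = 0%E.
Proof. by rewrite /leb_step /pushforward preimage_set0 measure0. Qed.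

Let leb_step_ge0 A : (0 <= leb_step A)%E.
Proof. by rewrite /leb_step /pushforward measure_ge0. Qed.

Let leb_step_sigma_additive : semi_sigma_additive leb_step.
Proof.
move=> F mF tF mUF; rewrite /leb_step /pushforward preimage_bigcup.
apply: measure_semi_sigma_additive.
- by move=> k; rewrite -[X in measurable X]setTI; exact: measurable_rV_cons.
- apply/trivIsetP => /= i j _ _ ij; rewrite -preimage_setI.
  by move/trivIsetP : tF => /(_ _ _ _ _ ij) ->//; rewrite preimage_set0.
- rewrite -preimage_bigcup -[X in measurable X]setTI.
  exact: measurable_rV_cons.
Qed.

HB.instance Definition _ := isMeasure.Build _ _ _ leb_step
  leb_step0 leb_step_ge0 leb_step_sigma_additive.

Let leb_step_sigma_finite : sigma_finite setT leb_step.
Proof.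
have [F TF Foo] := product_sigma_finite mu m.
exists (fun i => @rV_split n @^-1` F i).
  by rewrite -preimage_bigcup -TF preimage_setT.
move=> i; have [mF Fi] := Foo i; split.
  by rewrite -[X in measurable X]setTI; exact: measurable_rV_split.
rewrite /leb_step /pushforward -comp_preimage.
rewrite (_ : _ \o _ = id) ?preimage_id//.
by apply/funext => z; exact: rV_consK.
Qed.

HB.instance Definition _ :=
  Measure_isSigmaFinite.Build _ _ _ leb_step leb_step_sigma_finite.
End step.

Fixpoint leb n : {sigma_finite_measure set 'rV[R]_n -> \bar R} :=
  if n is n'.+1 then leb_step (leb n') else \d_(0 : 'rV[R]_0).

Definition rV_box n (a b : 'rV[R]_n) : set 'rV[R]_n :=
  [set x | forall i, x ord0 i \in `[a ord0 i, b ord0 i]].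

Lemma rV_boxE n (a b : 'rV[R]_n) :
  rV_box a b = \bigcap_(j in [set: 'I_n])
    (rV_coord j @^-1` [set` `[a ord0 j, b ord0 j]]).
Proof. by apply/seteqP; split => x /= + j; move=> /(_ j) //; apply. Qed.

Lemma measurable_rV_box n (a b : 'rV[R]_n) : measurable (rV_box a b).
Proof.
rewrite rV_boxE; apply: fin_bigcap_measurable; first exact: finite_finset.
move=> j _; rewrite -[X in measurable X]setTI.
by apply: measurable_rV_coord => //; exact: measurable_itv.
Qed.

Lemma leb_box n (a b : 'rV[R]_n) : (forall i, a ord0 i <= b ord0 i) ->
  leb n (rV_box a b) = (\prod_(i < n) (b ord0 i - a ord0 i))%:E.
Proof.
elim: n a b => [|n IH] a b ab.
  by rewrite big_ord0 /= diracE mem_set//; case.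
rewrite big_ord_recl.
transitivity ((mu \x leb n)%E
    ([set` `[a ord0 ord0, b ord0 ord0]] `*` rV_box (rV_split a).2 (rV_split b).2)).
  congr ((mu \x leb n)%E _); apply/seteqP; split => [[c x] h|[c x] [h1 h2] i].
  - split => [|j].
      by have := h ord0; rewrite /rV_cons mxE unlift_none.
    by have := h (lift ord0 j); rewrite /rV_cons !mxE liftK.
  - rewrite /rV_cons mxE; case: unliftP => [j ->|->] //=.
    by have := h2 j; rewrite !mxE.
rewrite product_measure1E//=; last exact: measurable_rV_box.
rewrite IH; last by move=> j; rewrite !mxE.
rewrite lebesgue_measure_itv/= lte_fin.
under [in LHS]eq_bigr do rewrite !mxE.
case: ltP => [_|h]; first by rewrite -EFinB -EFinM.
have -> : b ord0 ord0 = a ord0 ord0 by apply/eqP; rewrite eq_le h ab.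
by rewrite subrr !mul0r mul0e.
Qed.

End lebesgue_rV.

Lemma open_rV_measurable (R : realType) n (A : set 'rV[R]_n) :
  open A -> measurable A.
Proof.
move=> oA.
pose I (p : 'rV[rat]_n * 'rV[rat]_n) i : interval R :=
  `](ratr (p.1 ord0 i)), (ratr (p.2 ord0 i))[.
pose B p : set 'rV[R]_n := [set x | forall i, x ord0 i \in I p i].
have mB p : measurable (B p).
  rewrite (_ : B p = \bigcap_(j in [set: 'I_n]) (rV_coord j @^-1` [set` I p j])).
    apply: fin_bigcap_measurable; first exact: finite_finset.
    move=> j _; rewrite -[X in measurable X]setTI.
    by apply: measurable_rV_coord => //; exact: measurable_itv.
  by apply/seteqP; split => x /= + j; move=> /(_ j) //; apply.
rewrite (_ : A = \bigcup_p if `[< B p `<=` A >] then B p else set0); last first.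
  apply/seteqP; split => [x Ax|x [p _]]; last by case: asboolP => // + ?; apply.
  have /nbhs_ballP[e /= e0 xeA] : nbhs x A by move: oA; rewrite openE => /(_ _ Ax).
  have Ha i : exists q : rat, ratr q \in `](x ord0 i - e), (x ord0 i)[.
    by apply: rat_in_itvoo; rewrite ltrBlDr ltrDl.
  have Hb i : exists q : rat, ratr q \in `](x ord0 i), (x ord0 i + e)[.
    by apply: rat_in_itvoo; rewrite ltrDl.
  have [a ha] := choice Ha; have [b hb] := choice Hb.
  exists (\row_i a i, \row_i b i) => //; case: asboolP => [_|[]].
    move=> i; rewrite /I /= !mxE in_itv /=.
    by have /itvP -> := ha i; have /itvP -> := hb i.
  move=> y yB; apply: xeA; split => [//|i j]; rewrite ord1.
  have := yB j; rewrite /I /= !mxE in_itv /= => /andP[h1 h2].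
  have := ha j; have := hb j; rewrite !in_itv /= => /andP[_ h3] /andP[h4 _].
  rewrite /ball /= ltr_distlC; apply/andP; split.
  - exact: lt_trans h1.
  - exact: lt_trans h3.
apply: countable_bigcupT_measurable; first exact: countableP.
by move=> p; case: asboolP.
Qed.

Section euclidean.
Context {R : realType} {n : nat}.

(* The library norm of ['rV_n] is the sup norm. *)
Definition enorm (x : 'rV[R]_n) : R := Num.sqrt (\sum_i x ord0 i ^+ 2).

Definition eball (x : 'rV[R]_n) (r : R) : set 'rV[R]_n :=
  [set y | enorm (y - x) < r].

End euclidean.

Section C11.
Context {R : realType}.

Definition C11 n (f : 'rV[R]_n -> R) : Prop :=
  (forall x, differentiable f x) /\
  exists L : R, forall (i : 'I_n) (x y : 'rV[R]_n),
    `|'D_(delta_mx ord0 i) f x - 'D_(delta_mx ord0 i) f y| <= L * enorm (x - y).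

(* Locally, after an orthogonal change of coordinates [Q], the domain is the
   strict epigraph of a C^{1,1} function of the coordinates other than [i]. *)
Definition C11_boundary n (Omega : set 'rV[R]_n) : Prop :=
  forall p : 'rV[R]_n, closure Omega p -> ~ Omega p ->
    exists (r : R) (Q : 'M[R]_n) (i : 'I_n) (psi : 'rV[R]_n.-1 -> R),
      [/\ 0 < r, Q *m Q^T = 1%:M, C11 psi &
          Omega `&` eball p r =
          [set x | psi (col' i (x *m Q)) < (x *m Q) ord0 i] `&` eball p r].

Definition bounded_C11_domain n (Omega : set 'rV[R]_n) : Prop :=
  [/\ open Omega, connected Omega, bounded_set Omega & C11_boundary Omega].

End C11.

Definition compactly_contained (X : topologicalType) (A B : set X) : Prop :=
  compact (closure A) /\ closure A `<=` B.

Section constants.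
Context {R : realType}.
Local Notation mu := (@lebesgue_measure R).

Definition Gamma_integral (x : R) : R :=
  \int[mu]_(t in `]0, +oo[) (t `^ (x - 1) * expR (- t)).

(* Extension to negative non-integer arguments by
   Gamma x = Gamma (x + k) / (x (x + 1) ... (x + k - 1)). *)
Definition Gamma (x : R) : R :=
  let k := if 0 < x then 0%N else (Num.truncn (- x)).+1 in
  Gamma_integral (x + k%:R) / \prod_(j < k) (x + j%:R).

Definition fraclap_const (N : nat) (s : R) : R :=
  2 `^ (2 * s) * pi `^ (- (N%:R / 2)) *
  (Gamma ((N%:R + 2 * s) / 2) / `|Gamma (- s)|).

Definition hardy_const (N : nat) (s : R) : R :=
  2 `^ (2 * s) * (Gamma ((N%:R + 2 * s) / 4) ^+ 2
                  / Gamma ((N%:R - 2 * s) / 4) ^+ 2).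

Definition lambda_of_alpha (N : nat) (s alpha : R) : R :=
  2 `^ (2 * s) *
  (Gamma ((N%:R + 2 * s + 2 * alpha) / 4)
   * Gamma ((N%:R + 2 * s - 2 * alpha) / 4))
  / (Gamma ((N%:R - 2 * s + 2 * alpha) / 4)
     * Gamma ((N%:R - 2 * s - 2 * alpha) / 4)).

End constants.

Section fractional.
Context {R : realType} {N : nat}.
Implicit Types (s : R) (v w : 'rV[R]_N -> R) (x : 'rV[R]_N).
Local Notation mu := (@lebesgue_measure R).
Local Notation lebN := (leb R N).

Definition fraclap_trunc s v x (eps : R) : R :=
  \int[lebN]_(y in [set y | eps < enorm (x - y)])
    ((v x - v y) / enorm (x - y) `^ (N%:R + 2 * s)).

(* Meaningful where the principal value exists, see [has_fraclap]. *)
Definition fraclap s v x : R :=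
  fraclap_const N s * lim (fraclap_trunc s v x eps @[eps --> 0^'+]).

Definition has_fraclap s v x : Prop :=
  cvg (fraclap_trunc s v x eps @[eps --> 0^'+]).

Definition Hs_normsq s v : \bar R :=
  (\int[lebN]_x (v x ^+ 2)%:E
   + \int[lebN \x lebN]_z
       ((v z.1 - v z.2) ^+ 2 / enorm (z.1 - z.2) `^ (N%:R + 2 * s))%:E)%E.

(* H_0^s(Omega). *)
Definition H0s (Omega : set 'rV[R]_N) s v : Prop :=
  [/\ measurable_fun setT v, (Hs_normsq s v < +oo)%E &
      {ae lebN, forall x, ~ Omega x -> v x = 0}].

Definition fraclap_form s v w : R :=
  fraclap_const N s / 2 *
  \int[(lebN \x lebN)%E]_z
    ((v z.1 - v z.2) * (w z.1 - w z.2)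
     / enorm (z.1 - z.2) `^ (N%:R + 2 * s)).

(* [u] belongs to C(I; L^p(Omega)). *)
Definition C_Lp (I : set R) (Omega : set 'rV[R]_N) (p : \bar R)
    (u : 'rV[R]_N -> R -> R) : Prop :=
  (forall t, I t -> measurable_fun Omega (u^~ t) /\
     ('N[lebN]_p[EFin \o ((u^~ t) \_ Omega)] < +oo)%E) /\
  (forall t0, I t0 ->
     'N[lebN]_p[EFin \o ((fun x => u x t - u x t0)%R \_ Omega)]%E
       @[t --> within I (nbhs t0)] --> 0%E).

Definition bounded_Hoelder (Omega : set 'rV[R]_N) (T : R)
    (f : 'rV[R]_N -> R -> R) : Prop :=
  (exists M : R, forall x t, Omega x -> 0 < t < T -> `|f x t| <= M) /\
  (exists a b C : R, [/\ 0 < a < 1, 0 < b < 1 &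
     forall x y t r, Omega x -> Omega y -> 0 < t < T -> 0 < r < T ->
       `|f x t - f y r| <= C * (enorm (x - y) `^ a + `|t - r| `^ b)]).

(* Finite energy solution of - phi_t + (-Delta)^s phi = f in Omega x (0,T),
   phi = 0 outside Omega and phi(., T) = 0, the equation being tested against
   H_0^s(Omega) and integrated over (t, T). *)
Definition finite_energy_solution (Omega : set 'rV[R]_N) s (T : R)
    (f phi : 'rV[R]_N -> R -> R) : Prop :=
  [/\ measurable_fun (setT `*` `[0, T]) (fun z => phi z.1 z.2),
      C_Lp `[0, T] Omega 2%:E phi,
      {ae mu, forall t, 0 < t < T -> H0s Omega s (phi^~ t)},
      (\int[mu]_(t in `]0%R, T[) Hs_normsq s (phi^~ t) < +oo)%E &
      forall t, 0 <= t <= T -> forall v, H0s Omega s v ->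
        \int[lebN]_(x in Omega) (phi x t * v x)
        + \int[mu]_(r in `]t, T[) fraclap_form s (phi^~ r) v
        = \int[mu]_(r in `]t, T[) \int[lebN]_(x in Omega) (f x r * v x)].

Definition test_class (Omega : set 'rV[R]_N) s (T : R)
    (phi : 'rV[R]_N -> R -> R) : Prop :=
  exists f : 'rV[R]_N -> R -> R,
    [/\ bounded_Hoelder Omega T f,
        forall x t, Omega x -> 0 < t < T ->
          [/\ derivable (phi x) t 1, has_fraclap s (phi^~ t) x &
              - derive1 (phi x) t + fraclap s (phi^~ t) x = f x t],
        forall x t, ~ Omega x -> 0 < t <= T -> phi x t = 0,
        forall x, Omega x -> phi x T = 0 &
        finite_energy_solution Omega s T f phi /\
        exists M : R, forall x t, 0 <= t <= T -> `|phi x t| <= M].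

(* Weak supersolution of u_t + (-Delta)^s u = F(x, t, u) in Omega x (0,T) with
   zero exterior datum and initial datum u0.  The two integrals on the left are
   extended reals, and their sum is -oo as soon as one of them is. *)
Definition weak_supersolution (Omega : set 'rV[R]_N) s (T : R)
    (F : 'rV[R]_N -> R -> R -> R) (u0 : 'rV[R]_N -> R)
    (u : 'rV[R]_N -> R -> R) : Prop :=
  measurable_fun (setT `*` `[0, T[) (fun z => u z.1 z.2) /\
  [/\ C_Lp `[0, T[ Omega 1%:E u,
      (lebN \x mu)%E.-integrable (Omega `*` `[0, T[)
        (fun z => (F z.1 z.2 (u z.1 z.2))%:E),
      {ae (lebN \x mu)%E, forall z, ~ Omega z.1 -> 0 <= z.2 < T -> 0 <= u z.1 z.2},
      {ae lebN, forall x, Omega x -> u0 x <= u x 0} &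
      forall phi, test_class Omega s T phi ->
        (forall x t, 0 <= t <= T -> 0 <= phi x t) ->
        (\int[lebN \x mu]_(z in Omega `*` `]0%R, T[)
            (- derive1 (phi z.1) z.2 * u z.1 z.2)%:E
         + \int[lebN \x mu]_(z in setT `*` `]0%R, T[)
            (u z.1 z.2 * fraclap s (phi^~ z.2) z.1)%:E
         >= \int[lebN \x mu]_(z in Omega `*` `]0%R, T[)
              (F z.1 z.2 (u z.1 z.2) * phi z.1 z.2)%:E
            + \int[lebN]_(x in Omega) (u0 x * phi x 0)%:E)%E].

End fractional.

(* Main.v *)
Require Import Defs.
From HB Require Import structures.
From mathcomp Require Import all_boot all_order all_algebra.
From mathcomp Require Import all_classical all_reals all_analysis.
From mathcomp Require Import measurable_realfun ring lra.

(** Why the theorem holds.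

    Write c_a = [power_eigen s N a], so that (-Delta)^s |x|^-a = c_a |x|^(-a-2s)
    away from the origin for 0 < a < N - 2s, and lambda = c_gamma.  The map
    a |-> c_a is strictly increasing on (0, (N-2s)/2] ([power_eigen_lt]), so a
    power |x|^-a with a < gamma is a strict subsolution of the Hardy operator:
    c_a < lambda.  The proof tests the supersolution inequality against
    truncated versions of such powers and lets a tend to gamma.

    The powers are not admissible: they are singular, and do not vanish outside
    Omega.  They are replaced by
      psi = H(w - k),   w = |x|^-a - delta |x|^-gamma,   k = rho^-gamma,
    ([trunc_power]) where H is a convex C^{1,1} ramp that vanishes on the
    negative half-line and has slope between 0 and 1 ([ramp]).  The term with
    delta kills psi near the origin and the constant k kills it outside the
    ball of radius rho, so that psi is bounded, Lipschitz and has bounded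
    second differences ([trunc_power_bump]).  For such a function
    (T - t)^(m+1) psi(x) belongs to the test class ([test_class_bump]): the principal value converges to the absolutely
    convergent second-difference integral, which is bounded and Hoelder
    continuous in x.

    Convexity of H gives psi(x) - psi(y) <= H'(w(x) - k) (w(x) - w(y)), hence
      (-Delta)^s psi <= H'(w - k) (c_a |x|^(-a-2s) - delta lambda |x|^(-gamma-2s))
    ([fraclap_le_power]).  The fractional Laplacian of the powers enters only
    through Gaussians: the kernel |z|^-(N+2s) is a superposition of Gaussians,
    each Gaussian average of a power converges absolutely ([heat_avg_lty]), and
    integrating the defects of these averages over the Gaussian parameter
    produces c_a ([heat_deficit_integral]).

    Inserting this in the supersolution inequality gives [energy_inequality]:
    the terms with g and with u_0, plus (lambda - c_a) times the integral of
    u (T-t)^(m+1) H'(w - k) |x|^(-a-2s), are bounded by the term coming from the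
    time derivative plus a multiple of the integral of u |x|^-2s, which is
    finite because F(x,t,u) is integrable.  It is used twice.  With a fixed
    a < gamma, gamma <= a + 2s and m large, the time derivative is absorbed by
    the gain term, and delta -> 0 shows that u (T-t)^(m+1) |x|^-gamma is
    integrable ([int_critical]).  With m one larger, this bounds the
    right-hand side uniformly as a -> gamma and delta -> 0, and Fatou's lemma
    bounds the integrals of g and u_0 against H(|x|^-gamma - k)
    ([ramp_bounds]), which differs from |x|^-gamma by a bounded function. *)

Set Implicit Arguments.
Unset Strict Implicit.
Unset Printing Implicit Defensive.
Import Order.TTheory GRing.Theory Num.Theory.
Import numFieldNormedType.Exports.
Local Open Scope classical_set_scope.
Local Open Scope ring_scope.

(** * Iterated integrals on product sets, and invariances of the Lebesgue measure *)

Section ext_integral.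
Context d1 d2 (T1 : measurableType d1) (T2 : measurableType d2) (R : realType).
Variables (m1 : {sigma_finite_measure set T1 -> \bar R}).
Variables (m2 : {sigma_finite_measure set T2 -> \bar R}).
Implicit Types (A : set T1) (B : set T2) (f : T1 * T2 -> \bar R).
Local Open Scope ereal_scope.

(** Extending by zero outside [A `*` B] reduces Fubini and Tonelli on a product
    set to their global forms. *)
Lemma integral_setX_patch A B f :
  \int[m1]_(x in A) \int[m2]_(y in B) f (x, y) =
  \int[m1]_x \int[m2]_y (f \_ (A `*` B)) (x, y).
Proof.
rewrite integral_mkcond; apply: eq_integral => x _.
rewrite patchE; case: ifPn => xA.
  rewrite integral_mkcond; apply: eq_integral => y _.
  by rewrite !patchE in_setX xA.
apply/esym; apply: integral0_eq => y _.
by rewrite patchE in_setX (negbTE xA).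
Qed.

Lemma integral_setX_patch2 A B f :
  \int[m2]_(y in B) \int[m1]_(x in A) f (x, y) =
  \int[m2]_y \int[m1]_x (f \_ (A `*` B)) (x, y).
Proof.
rewrite integral_mkcond; apply: eq_integral => x _.
rewrite patchE; case: ifPn => xA.
  rewrite integral_mkcond; apply: eq_integral => y _.
  by rewrite !patchE in_setX xA andbT.
apply/esym; apply: integral0_eq => y _.
by rewrite patchE in_setX (negbTE xA) andbF.
Qed.

Lemma tonelli A B f : measurable A -> measurable B ->
  measurable_fun (A `*` B) f ->
  (forall x y, A x -> B y -> 0 <= f (x, y)) ->
  \int[m1]_(x in A) \int[m2]_(y in B) f (x, y) =
  \int[m2]_(y in B) \int[m1]_(x in A) f (x, y).
Proof.
move=> mA mB mf f0; rewrite integral_setX_patch integral_setX_patch2.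
apply: (fubini_tonelli (f \_ (A `*` B))).
  by apply/(measurable_restrictT f (measurableX mA mB)).
by move=> [x y]; apply: erestrict_ge0 => -[a b] [/= ? ?]; exact: f0.
Qed.

Lemma measurable_tonelli A B f : measurable A -> measurable B ->
  measurable_fun (A `*` B) f ->
  (forall x y, A x -> B y -> 0 <= f (x, y)) ->
  measurable_fun A (fun x => \int[m2]_(y in B) f (x, y)).
Proof.
move=> mA mB mf f0.
have h : measurable_fun setT (fubini_F m2 (f \_ (A `*` B))).
  apply: measurable_fun_fubini_tonelli_F.
    by apply/(measurable_restrictT f (measurableX mA mB)).
  by move=> [x y]; apply: erestrict_ge0 => -[a b] [/= ? ?]; exact: f0.
apply: eq_measurable_fun (measurable_funTS h) => x; rewrite inE => xA.
rewrite /fubini_F [RHS]integral_mkcond; apply: eq_integral => y _.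
by rewrite !patchE in_setX mem_set.
Qed.

Lemma measurable_tonelli2 A B f : measurable A -> measurable B ->
  measurable_fun (A `*` B) f ->
  (forall x y, A x -> B y -> 0 <= f (x, y)) ->
  measurable_fun B (fun y => \int[m1]_(x in A) f (x, y)).
Proof.
move=> mA mB mf f0.
have h : measurable_fun setT (fubini_G m1 (f \_ (A `*` B))).
  apply: measurable_fun_fubini_tonelli_G.
    by apply/(measurable_restrictT f (measurableX mA mB)).
  by move=> [x y]; apply: erestrict_ge0 => -[a b] [/= ? ?]; exact: f0.
apply: eq_measurable_fun (measurable_funTS h) => y; rewrite inE => yB.
rewrite /fubini_G [RHS]integral_mkcond; apply: eq_integral => x _.
by rewrite !patchE in_setX (mem_set yB) andbT.
Qed.

End ext_integral.

Section one_dim.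
Context {R : realType}.
Local Notation mu := (@lebesgue_measure R).
Implicit Types (f : R -> \bar R) (c h : R).

Lemma lebesgue_measure_shift h (A : set (measurableTypeR R)) : measurable A ->
  pushforward mu (fun x : measurableTypeR R => (x + h)%R : measurableTypeR R) A = mu A.
Proof.
move=> mA.
have mh : measurable_fun setT (fun x : measurableTypeR R => (x + h)%R : measurableTypeR R).
  exact: measurable_funD.
pose phi : {mfun _ >-> _} := HB.pack (fun x : measurableTypeR R => (x + h)%R : measurableTypeR R)
  (isMeasurableFun.Build _ _ _ _ _ mh).
apply/esym/(@lebesgue_measure_unique _ (pushforward mu phi)) => //= _ [[a b]] _ <-.
rewrite /pushforward.
have -> : (fun x : measurableTypeR R => x + h) @^-1` `]a, b] = `]a - h, b - h]%classic.
  by apply/seteqP; split => x /=; rewrite !in_itv/= ltrBlDr lerBrDr.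
rewrite !lebesgue_measure_itv/= !lte_fin ltrD2r.
by case: ifP => // _; rewrite -!EFinB; congr EFin; lra.
Qed.

Lemma ge0_integral_shift h f : measurable_fun setT f -> (forall x, (0 <= f x)%E) ->
  (\int[mu]_x f (x + h)%R = \int[mu]_x f x)%E.
Proof.
move=> mf f0.
have mh : measurable_fun setT (fun x : measurableTypeR R => (x + h)%R : measurableTypeR R).
  exact: measurable_funD.
transitivity (\int[pushforward mu (fun x : measurableTypeR R => (x + h)%R : measurableTypeR R)]_x f x)%E.
  by rewrite ge0_integral_pushforward.
by apply: eq_measure_integral => A mA _; exact: lebesgue_measure_shift.
Qed.

Lemma ge0_integral_opp f : measurable_fun setT f -> (forall x, (0 <= f x)%E) ->
  (\int[mu]_x f (- x)%R = \int[mu]_x f x)%E.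
Proof.
move=> mf f0.
have mh : measurable_fun setT (-%R : measurableTypeR R -> measurableTypeR R).
  exact: oppr_measurable.
transitivity (\int[pushforward mu (-%R : measurableTypeR R -> measurableTypeR R)]_x f x)%E.
  by rewrite ge0_integral_pushforward.
by apply: eq_measure_integral => A mA _; exact: lebesgue_measureN.
Qed.

Lemma lebesgue_measure_scale c (A : set (measurableTypeR R)) : 0 < c -> measurable A ->
  (c%:E * pushforward mu (fun x : measurableTypeR R => (c * x)%R : measurableTypeR R) A = mu A)%E.
Proof.
move=> c0 mA.
have cn : 0 <= c by exact: ltW.
have mh : measurable_fun setT (fun x : measurableTypeR R => (c * x)%R : measurableTypeR R).
  exact: measurable_funM.
pose phi : {mfun _ >-> _} := HB.pack (fun x : measurableTypeR R => (c * x)%R : measurableTypeR R)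
  (isMeasurableFun.Build _ _ _ _ _ mh).
apply/esym; rewrite (@lebesgue_measure_unique _ (mscale (NngNum cn) (pushforward mu phi))) //.
move=> _ [[a b]] _ <-.
transitivity (c%:E * mu `](a / c)%R, (b / c)%R]%classic)%E; last first.
  rewrite [RHS](_ : _ = c%:E * mu (phi @^-1` `]a, b]%classic))%E//.
  congr (_ * mu _)%E.
  apply/seteqP; split => x /=; rewrite !in_itv/= ltr_pdivrMr// ler_pdivlMr//;
   by rewrite mulrC.
rewrite !lebesgue_measure_itv/= !lte_fin ltr_pM2r ?invr_gt0//.
case: ifP => _; last by rewrite mule0.
by rewrite -!EFinB -EFinM; congr EFin; field; rewrite gt_eqF.
Qed.

Lemma ge0_integral_scale c f : 0 < c -> measurable_fun setT f -> (forall x, (0 <= f x)%E) ->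
  (c%:E * \int[mu]_x f (c * x)%R = \int[mu]_x f x)%E.
Proof.
move=> c0 mf f0.
have cn : 0 <= c by exact: ltW.
have mh : measurable_fun setT (fun x : measurableTypeR R => (c * x)%R : measurableTypeR R).
  exact: measurable_funM.
pose phi : {mfun _ >-> _} := HB.pack (fun x : measurableTypeR R => (c * x)%R : measurableTypeR R)
  (isMeasurableFun.Build _ _ _ _ _ mh).
pose m : {measure set (measurableTypeR R) -> \bar R} := mscale (NngNum cn) (pushforward mu phi).
transitivity (\int[m mh]_x f x)%E.
  rewrite /m ge0_integral_mscale//=; congr (_ * _)%E.
  by rewrite ge0_integral_pushforward.
by apply: eq_measure_integral => A mA _; exact: lebesgue_measure_scale.
Qed.

Lemma ge0_integral0y_scale c f : 0 < c -> measurable_fun setT f ->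
  (forall x, 0 < x -> (0 <= f x)%E) ->
  (\int[mu]_(x in `]0%R, +oo[) f (c * x)%R = c^-1%:E * \int[mu]_(x in `]0%R, +oo[) f x)%E.
Proof.
move=> c0 mf f0.
have mD : measurable (`]0, +oo[ : set R) by exact: measurable_itv.
rewrite [X in (_ * X)%E]integral_mkcond.
have := @ge0_integral_scale c (f \_ `]0, +oo[) c0.
move=> /(_ _ _)<-; last 2 first.
- by apply: (measurable_restrictT f mD).1; apply: (measurable_funTS mf).
- by move=> x; apply: erestrict_ge0 => y /=; rewrite in_itv/= andbT; exact: f0.
rewrite muleA -EFinM mulVf ?gt_eqF// mul1e integral_mkcond; apply: eq_integral => x _.
by rewrite !patchE !mem_setE !in_itv /= !andbT pmulr_rgt0.
Qed.
End one_dim.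

(** * Powers on the half-line *)

Section powers.
Context {R : realType}.
Local Notation mu := (@lebesgue_measure R).
Implicit Types p s x : R.

Lemma is_derive_powR p x : 0 < x ->
  is_derive x 1 (fun y : R => y `^ p) (p * x `^ (p - 1)).
Proof.
move=> x0; apply: DeriveDef.
  by apply: derivable_powR; rewrite in_itv/= x0.
by rewrite -derive1E powR_derive1// in_itv/= x0.
Qed.

Lemma continuous_powR p x : 0 < x -> {for x, continuous (fun y : R => y `^ p)}.
Proof.
move=> x0; apply: differentiable_continuous; apply/derivable1_diffP.
by apply: derivable_powR; rewrite in_itv/= x0.
Qed.

Lemma cvgr_powRN s : 0 < s -> x `^ (- s) @[x --> +oo] --> (0 : R).
Proof.
move=> s0; apply/cvgr0Pnorm_lt => e e0.
near=> x.
have x0 : 0 < x by near: x; exact: nbhs_pinfty_gt.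
rewrite ger0_norm ?powR_ge0// powRN -ltf_pV2 ?posrE ?invr_gt0 ?powR_gt0//.
rewrite invrK.
have : e^-1 `^ (s^-1) < x by near: x; exact: nbhs_pinfty_gt.
move=> /(gt0_ltr_powR s0).
rewrite !nnegrE powR_ge0 ltW// => /(_ isT isT).
by rewrite -powRrM mulVf ?gt_eqF// powRr1// invr_ge0 ltW.
Unshelve. all: by end_near. Qed.

Lemma integral_powR_itv p (a b : R) : p != 0 -> 0 < a -> a < b ->
  (\int[mu]_(x in `[a, b]) (x `^ (p - 1))%:E = ((b `^ p - a `^ p) / p)%:E)%E.
Proof.
move=> p0 a0 ab.
have pos x : a <= x -> 0 < x by exact: lt_le_trans.
rewrite (@continuous_FTC2 _ _ (fun x => p^-1 * x `^ p)) //.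
- by rewrite -EFinB -mulrBr mulrC.
- apply: continuous_in_subspaceT => x; rewrite inE/= in_itv/= => /andP[/pos x0 _].
  exact: continuous_powR.
- have h x : 0 < x -> is_derive x 1 (fun x => p^-1 * x `^ p) (p^-1 * (p * x `^ (p - 1))).
    by move=> x0; apply: (is_deriveZ _ (is_derive_powR p x0)).
  have hc x : 0 < x -> {for x, continuous (fun x => p^-1 * x `^ p)}.
    move=> x0; apply: differentiable_continuous; apply/derivable1_diffP.
    by have [] := h _ x0.
  split.
  + by move=> x; rewrite in_itv/= => /andP[/ltW/pos x0 _]; have [] := h _ x0.
  + by apply: cvg_at_right_filter; exact: hc.
  + by apply: cvg_at_left_filter; apply: hc; exact: lt_trans ab.
- move=> x; rewrite in_itv/= => /andP[/ltW/pos x0 _].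
  have h : is_derive x 1 (fun x => p^-1 * x `^ p) (p^-1 * (p * x `^ (p - 1))).
    by apply: (is_deriveZ _ (is_derive_powR p x0)).
  by rewrite derive1E derive_val mulKf.
Qed.

Lemma integral_powR_tail s v : 0 < s -> 0 < v ->
  (\int[mu]_(x in `]v, +oo[) (x `^ (- s - 1))%:E = (v `^ (- s) / s)%:E)%E.
Proof.
move=> s0 v0.
have h x : 0 < x -> is_derive x 1 (fun x => (- s)^-1 * x `^ (- s)) ((- s)^-1 * (- s * x `^ (- s - 1))).
  by move=> x0; apply: (is_deriveZ _ (is_derive_powR (- s) x0)).
have hc x : 0 < x -> {for x, continuous (fun x => (- s)^-1 * x `^ (- s))}.
  move=> x0; apply: differentiable_continuous; apply/derivable1_diffP.
  by have [] := h _ x0.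
rewrite integral_itv_obnd_cbnd; last first.
  by apply/measurable_EFinP; apply: measurable_funTS; exact: measurable_powR.
rewrite (@ge0_continuous_FTC2y _ _ (fun x => (- s)^-1 * x `^ (- s)) v 0).
- by rewrite -EFinB sub0r invrN mulNr opprK mulrC.
- by move=> x _; exact: powR_ge0.
- apply: continuous_in_subspaceT => x; rewrite inE/= in_itv/= andbT => vx.
  by apply: continuous_powR; exact: lt_le_trans vx.
- rewrite -(mulr0 (- s)^-1); apply: cvgM; first exact: cvg_cst.
  exact: cvgr_powRN.
- by move=> x vx; have [] := h x (lt_trans v0 vx).
- by apply: cvg_at_right_filter; exact: hc.
- move=> x; rewrite in_itv/= andbT => vx.
  have x0 := lt_trans v0 vx; have := h _ x0 => hx.
  by rewrite derive1E derive_val mulKf// oppr_eq0 gt_eqF.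
Qed.

(** The interval ]0, 1] is exhausted from above by the segments [[1/(n+1), 1]],
    on which the primitive is bounded. *)
Lemma integral_powR01_lty p : 0 < p ->
  (\int[mu]_(x in `]0%R, 1%R]) (x `^ (p - 1))%:E < +oo)%E.
Proof.
move=> p0.
pose F n := `[(n.+2%:R^-1 : R), 1]%classic.
have F01 : `]0, 1]%classic = \bigcup_n F n.
  apply/seteqP; split=> [x|x [n _]]; rewrite /F/= !in_itv/=.
    move=> /andP[x0 x1]; have [n nx] := @ltr_add_invr R 0 x x0.
    exists n => //=; rewrite in_itv/= x1 andbT.
    rewrite add0r in nx; apply: le_trans (ltW nx).
    by rewrite lef_pV2 ?posrE// ler_nat.
  by move=> /andP[nx ->]; rewrite andbT; apply: lt_le_trans nx; rewrite invr_gt0.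
have mf : measurable_fun setT (fun x : R => (x `^ (p - 1))%:E).
  by apply/measurable_EFinP; exact: measurable_powR.
have := @ge0_nondecreasing_set_cvg_integral _ (measurableTypeR R) R F (fun x => (x `^ (p - 1))%:E) mu.
rewrite -F01 => /(_ _ _ _ _)/cvg_lim <- //.
- apply: (@le_lt_trans _ _ (p^-1)%:E); last exact: ltry.
  apply: lime_le.
    apply: ereal_nondecreasing_is_cvgn; apply: ge0_nondecreasing_set_nondecreasing_integral.
    + apply/nondecreasing_seqP => n; apply/subsetPset => x; rewrite /F/= !in_itv/=.
      move=> /andP[nx ->]; rewrite andbT; apply: le_trans nx.
      by rewrite lef_pV2 ?posrE// ler_nat.
    + by move=> n; exact: measurable_itv.
    + by move=> n; exact: measurable_funTS.
    + by move=> n x _; rewrite lee_fin powR_ge0.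
  apply: nearW => n.
  rewrite integral_powR_itv ?gt_eqF//; last first.
    by rewrite invf_lt1// ltr1n.
  rewrite lee_fin powR1 ler_pdivrMr// mulVf ?gt_eqF// gerBl powR_ge0.
- apply/nondecreasing_seqP => n; apply/subsetPset => x; rewrite /F/= !in_itv/=.
  move=> /andP[nx ->]; rewrite andbT; apply: le_trans nx.
  by rewrite lef_pV2 ?posrE// ler_nat.
- by move=> n; exact: measurable_itv.
- by move=> n; exact: measurable_funTS.
- by move=> n x _; rewrite lee_fin powR_ge0.
Qed.
End powers.

(** * Measurability of explicit functions, and the Gamma integral *)

#[export] Hint Extern 0 (is_true (0 <= _ `^ _)) => solve [exact: powR_ge0] : core.
#[export] Hint Extern 0 (is_true (0 <= expR _)) => solve [exact: expR_ge0] : core.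

Section measurable_lambda.
Context d (T : measurableType d) (R : realType) (D : set T).
Implicit Types f g : T -> R.
Lemma measM f g : measurable_fun D f -> measurable_fun D g ->
  measurable_fun D (fun x => f x * g x).
Proof. exact: measurable_funM. Qed.
Lemma measD f g : measurable_fun D f -> measurable_fun D g ->
  measurable_fun D (fun x => f x + g x).
Proof. exact: measurable_funD. Qed.
Lemma measB f g : measurable_fun D f -> measurable_fun D g ->
  measurable_fun D (fun x => f x - g x).
Proof. exact: measurable_funB. Qed.
Lemma measN f : measurable_fun D f -> measurable_fun D (fun x => - f x).
Proof. by move=> mf; apply: measurableT_comp mf; exact: oppr_measurable. Qed.
Lemma measnorm f : measurable_fun D f -> measurable_fun D (fun x => `|f x|).
Proof. by move=> mf; apply: measurableT_comp mf; exact: normr_measurable. Qed.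
Lemma measX f n : measurable_fun D f -> measurable_fun D (fun x => f x ^+ n).
Proof. by move=> mf; exact: measurable_funX. Qed.
Lemma measpow f p : measurable_fun D f -> measurable_fun D (fun x => f x `^ p).
Proof. by move=> mf; apply: (measurableT_comp (measurable_powR p) mf). Qed.
Lemma measexp f : measurable_fun D f -> measurable_fun D (fun x => expR (f x)).
Proof. by move=> mf; apply: (measurableT_comp (@measurable_expR R) mf). Qed.
Lemma measEFin f : measurable_fun D f -> measurable_fun D (fun x => (f x)%:E).
Proof. by move=> mf; apply/measurable_EFinP. Qed.
End measurable_lambda.

Ltac mfun := lazymatch goal with
  | |- measurable_fun _ (fun _ => ?c) => exact: measurable_cst
  | |- measurable_fun _ (fun x => (@?f x)%:E) => apply: measEFin; mfun
  | |- measurable_fun _ (fun x => @?f x * @?g x) => apply: measM; mfun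
  | |- measurable_fun ?D (GRing.mul ?c) =>
      apply: (@measM _ _ _ D (fun=> c) id); mfun
  | |- measurable_fun ?D (GRing.add ?c) =>
      apply: (@measD _ _ _ D (fun=> c) id); mfun
  | |- measurable_fun _ (fun x => - @?f x) => apply: measN; mfun
  | |- measurable_fun _ (fun x => @?f x + @?g x) => apply: measD; mfun
  | |- measurable_fun _ (fun x => @?f x `^ ?p) => apply: measpow; mfun
  | |- measurable_fun _ (fun x => expR (@?f x)) => apply: measexp; mfun
  | |- measurable_fun _ (fun x => @?f x ^+ ?p) => apply: measX; mfun
  | |- measurable_fun _ (fun x => `|@?f x|) => apply: measnorm; mfun
  | |- _ => first
    [ assumption | exact: measurable_id
    | exact: (measurable_funTS measurable_fst) | exact: (measurable_funTS measurable_snd)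
    | apply: measurable_funTS; assumption | idtac ]
  end.

Lemma gt0_powRD (R : realType) (x p q : R) : 0 < x ->
  x `^ (p + q) = x `^ p * x `^ q.
Proof. by move=> x0; rewrite powRD// (gt_eqF x0) implybT. Qed.

Section ge0_real.
Context d (T : measurableType d) (R : realType) (m : {measure set T -> \bar R}).
Lemma ge0_integralZl_real (D : set T) (k : R) (f : T -> R) : measurable D ->
  measurable_fun D f -> (forall x, D x -> 0 <= f x) -> 0 <= k ->
  (\int[m]_(x in D) (k * f x)%:E = k%:E * \int[m]_(x in D) (f x)%:E)%E.
Proof.
move=> mD mf f0 k0; under eq_integral do rewrite EFinM.
by apply: ge0_integralZl_EFin => //; exact/measurable_EFinP.
Qed.
End ge0_real.

Section gamma.
Context {R : realType}.
Local Notation mu := (@lebesgue_measure R).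
Implicit Types p q s b : R.

(** With n above |q|, t^n <= n^n (1 + t/n)^n <= n^n exp t. *)
Lemma powR_le_expR q : exists2 C : R, 0 < C & forall t, 1 <= t -> t `^ q <= C * expR t.
Proof.
pose n := (Num.truncn `|q|).+1.
have qn : q <= n%:R.
  by apply: (le_trans (ler_norm q)); apply: ltW; rewrite /n; exact: truncnS_gt.
have n0 : 0 < n%:R :> R by rewrite ltr0n.
exists (n%:R ^+ n); first exact: exprn_gt0.
move=> t t1.
have t0 : 0 < t by exact: lt_le_trans t1.
apply: (@le_trans _ _ (t `^ n%:R)); first exact: ler_powR.
rewrite powR_mulrn; last exact: ltW.
have -> : t ^+ n = n%:R ^+ n * (t / n%:R) ^+ n.
  by rewrite -exprMn mulrC divfK// gt_eqF.
rewrite ler_pM2l ?exprn_gt0//.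
have -> : expR t = expR (t / n%:R) ^+ n.
  by rewrite -expRM_natr divfK// gt_eqF.
rewrite lerXn2r ?nnegrE ?expR_ge0//; first by rewrite divr_ge0// ltW.
by apply: le_trans (expR_ge1Dx _); rewrite lerDr.
Qed.

Definition gamma_fun p (t : R) : R := t `^ (p - 1) * expR (- t).

Lemma measurable_gamma_fun p D : measurable_fun D (gamma_fun p).
Proof. by apply: measurable_funTS; rewrite /gamma_fun; mfun. Qed.

Lemma gamma_fun_ge0 p t : 0 <= gamma_fun p t.
Proof. by rewrite mulr_ge0 ?powR_ge0 ?expR_ge0. Qed.

Lemma integral_gamma_lty p : 0 < p ->
  (\int[mu]_(t in `]0%R, +oo[) (gamma_fun p t)%:E < +oo)%E.
Proof.
move=> p0.
have -> : `]0%R, +oo[%classic = `]0%R, 1] `|` `]1%R, +oo[ :> set R.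
  apply/seteqP; split=> x /=; rewrite !in_itv/= ?andbT.
    by move=> x0; case: (leP x 1) => x1; [left; rewrite x0|right].
  by case=> [/andP[//]|]; apply: lt_trans.
rewrite ge0_integral_setU//=; last 3 first.
- by apply: measEFin; exact: measurable_gamma_fun.
- by move=> x _; rewrite lee_fin gamma_fun_ge0.
- rewrite disj_set2E; apply/eqP/seteqP; split => // x [] /=; rewrite !in_itv/= andbT.
  by move=> /andP[_ x1] /(le_lt_trans x1); rewrite ltxx.
apply: lte_add_pinfty.
  apply: le_lt_trans (integral_powR01_lty p0).
  apply: ge0_le_integral => //.
  - by move=> x _; rewrite lee_fin gamma_fun_ge0.
  - by apply: measEFin; exact: measurable_gamma_fun.
  - by mfun.
  - move=> x /=; rewrite in_itv/= => /andP[x0 _]; rewrite lee_fin.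
    by rewrite ler_piMr ?powR_ge0// -expR0 ler_expR oppr_le0 ltW.
have [C C0 CP] := powR_le_expR (p + 1).
apply: (@le_lt_trans _ _ (\int[mu]_(t in `]1%R, +oo[) (C * (t `^ (- 1 - 1)))%:E)%E).
  apply: ge0_le_integral => //.
  - by move=> x _; rewrite lee_fin gamma_fun_ge0.
  - by apply: measEFin; exact: measurable_gamma_fun.
  - by mfun.
  - move=> x /=; rewrite in_itv/= andbT => x1; rewrite lee_fin.
    have x0 : 0 < x by exact: lt_trans x1.
    have -> : x `^ (-1 - 1) = x `^ (p - 1) / x `^ (p + 1).
      rewrite -powRN -gt0_powRD//.
      by congr powR; ring.
    rewrite /gamma_fun mulrCA ler_pM2l ?powR_gt0// expRN.
    rewrite ler_pdivlMr ?powR_gt0// mulrC ler_pdivrMr ?expR_gt0//.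
    exact/CP/ltW.
rewrite ge0_integralZl_real//; last 2 first.
- by mfun.
- exact: ltW.
rewrite integral_powR_tail// -EFinM; exact: ltry.
Qed.

Lemma integral_gammaE p : 0 < p ->
  (\int[mu]_(t in `]0%R, +oo[) (t `^ (p - 1) * expR (- t))%:E = (Gamma_integral p)%:E)%E.
Proof.
move=> p0; rewrite /Gamma_integral /Rintegral fineK//.
rewrite ge0_fin_numE; first exact: integral_gamma_lty.
by apply: integral_ge0 => x _; rewrite lee_fin gamma_fun_ge0.
Qed.

Lemma Gamma_integral_gt0 p : 0 < p -> 0 < Gamma_integral p.
Proof.
move=> p0; rewrite -lte_fin -integral_gammaE//.
have h t : t \in `[1, 2] -> expR (- 2) * (t `^ (p - 1)) <= gamma_fun p t.
  rewrite in_itv/= => /andP[t1 t2]; rewrite mulrC ler_wpM2l ?powR_ge0//.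
  by rewrite ler_expR lerN2.
apply: (@lt_le_trans _ _ (\int[mu]_(t in `[1%R, 2%R]) (gamma_fun p t)%:E)%E); last first.
  apply: ge0_subset_integral => //.
  - by apply: measEFin; exact: measurable_gamma_fun.
  - by move=> x _; rewrite lee_fin gamma_fun_ge0.
  - by move=> x /=; rewrite !in_itv/= andbT => /andP[x1 _]; exact: lt_le_trans x1.
apply: (@lt_le_trans _ _ (\int[mu]_(t in `[1%R, 2%R]) (expR (-2) * (t `^ (p - 1)))%:E)%E); last first.
  apply: ge0_le_integral => //.
  - by move=> x _; rewrite lee_fin mulr_ge0 ?expR_ge0 ?powR_ge0.
  - by mfun.
  - by apply: measEFin; exact: measurable_gamma_fun.
rewrite ge0_integralZl_real ?expR_ge0//; last by mfun.
rewrite integral_powR_itv ?gt_eqF// ?ltr1n// -EFinM lte_fin.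
rewrite mulr_gt0 ?expR_gt0// divr_gt0// subr_gt0.
by apply: gt0_ltr_powR => //; rewrite ?nnegrE// ltr1n.
Qed.

(** The substitution t -> q t; read from right to left it writes the power q^-p
    as a superposition of exponentials in q, which is how all the powers below
    become Gaussians. *)
Lemma integral_gamma_scale p q : 0 < p -> 0 < q ->
  (\int[mu]_(t in `]0%R, +oo[) (t `^ (p - 1) * expR (- (q * t)))%:E =
   (Gamma_integral p * q `^ (- p))%:E)%E.
Proof.
move=> p0 q0.
transitivity (\int[mu]_(t in `]0%R, +oo[) ((q `^ (1 - p)) * gamma_fun p (q * t))%:E)%E.
  apply: eq_integral => t; rewrite inE/= in_itv/= andbT => t0; congr EFin.
  rewrite /gamma_fun powRM ?ltW// !mulrA -gt0_powRD//.
  by rewrite (_ : 1 - p + (p - 1) = 0) ?powRr0 ?mul1r//; ring.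
rewrite ge0_integralZl_real ?powR_ge0//; last 2 first.
- apply: measurableT_comp; first exact: measurable_gamma_fun.
  by mfun.
- by move=> x _; exact: gamma_fun_ge0.
rewrite (@ge0_integral0y_scale _ _ (fun t => (gamma_fun p t)%:E))//; last 2 first.
- by apply: measEFin; exact: measurable_gamma_fun.
- by move=> x _; rewrite lee_fin gamma_fun_ge0.
rewrite integral_gammaE// -!EFinM; congr EFin.
rewrite mulrA mulrC; congr (_ * _).
rewrite -powR_inv1 ?ltW// -gt0_powRD//.
by congr powR; ring.
Qed.

End gamma.

Opaque Gamma_integral.

(** * Integrals of Frullani and Beta type *)

Section frullani.
Context {R : realType}.
Local Notation mu := (@lebesgue_measure R).
Implicit Types p q s b x y : R.

Lemma measurable_ltr_prod (D : set (measurableTypeR R * measurableTypeR R)) :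
  measurable_fun D (fun z => \1_[set z : measurableTypeR R * measurableTypeR R | (z.2 < z.1)%R] z : R).
Proof.
apply: measurable_funTS; apply: measurable_indic.
have := @measurable_fun_ltr _ (measurableTypeR R * measurableTypeR R)%type R setT snd fst measurable_snd measurable_fst.
move=> /(_ measurableT [set true]); rewrite setTI => /(_ _).
by apply.
Qed.

Lemma integral_expRN_itv x : 0 < x ->
  (\int[mu]_(v in `]0%R, x[) (expR (- v))%:E = (1 - expR (- x))%:E)%E.
Proof.
move=> x0.
have hN y : is_derive y 1 (fun x => expR (- x)) (expR (- y) * (-1)).
  exact: (@is_derive1_comp _ expR -%R y _ _ (is_derive_expR (- y)) (is_deriveNid y 1)).
have h y : is_derive y 1 (fun x => - expR (- x)) (expR (- y)).
  have -> : expR (- y) = - (expR (- y) * (-1)) by rewrite mulrN1 opprK.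
  exact: (is_deriveN (hN y)).
have hc y : {for y, continuous (fun x => - expR (- x))}.
  by apply: differentiable_continuous; apply/derivable1_diffP; have [] := h y.
rewrite -(@integral_itv_bndoo _ 0 x (fun v => (expR (- v))%:E) true false); last first.
  by apply: measEFin; apply: measurable_funTS; mfun.
rewrite (@continuous_FTC2 _ _ (fun x => - expR (- x)))//.
- by rewrite oppr0 expR0 -EFinB opprK addrC.
- apply: continuous_subspaceT => y; apply: differentiable_continuous.
  by apply/derivable1_diffP; have [] := hN y.
- split.
  + by move=> y _; have [] := h y.
  + by apply: cvg_at_right_filter; exact: hc.
  + by apply: cvg_at_left_filter; exact: hc.
- by move=> y _; rewrite derive1E derive_val.
Qed.

(** Write 1 - exp(-x) as the integral of exp(-v) over 0 < v < x and exchange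
    the two integrals. *)
Lemma integral_frullani s : 0 < s < 1 ->
  (\int[mu]_(x in `]0%R, +oo[) (x `^ (- s - 1) * (1 - expR (- x)))%:E =
   (Gamma_integral (1 - s) / s)%:E)%E.
Proof.
move=> /andP[s0 s1].
pose f (z : measurableTypeR R * measurableTypeR R) : \bar R :=
  (z.1 `^ (- s - 1) * expR (- z.2) * \1_[set z : measurableTypeR R * measurableTypeR R | (z.2 < z.1)%R] z)%:E.
transitivity (\int[mu]_(x in `]0%R, +oo[) \int[mu]_(v in `]0%R, +oo[) f (x, v))%E.
  apply: eq_integral => x; rewrite inE/= in_itv/= andbT => x0.
  rewrite EFinM -integral_expRN_itv// -ge0_integralZl_real//; last by mfun.
  rewrite integral_mkcond [RHS]integral_mkcond; apply: eq_integral => v _.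
  rewrite !patchE !mem_setE !in_itv/= andbT /f/= indicE.
  case: (0 < v) => //=; case: ifPn => vx.
    by rewrite mem_set// mulr1.
  by rewrite memNset ?mulr0//; exact/negP.
rewrite tonelli//; last 2 first.
- apply: measEFin; apply: measM; last exact: measurable_ltr_prod.
  by mfun.
- by move=> x y _ _; rewrite lee_fin !mulr_ge0.
transitivity (\int[mu]_(v in `]0%R, +oo[) (s^-1 * (v `^ (1 - s - 1) * expR (- v)))%:E)%E.
  apply: eq_integral => v; rewrite inE/= in_itv/= andbT => v0.
  transitivity (\int[mu]_(x in `]v, +oo[) (expR (- v) * x `^ (- s - 1))%:E)%E.
    rewrite integral_mkcond [RHS]integral_mkcond; apply: eq_integral => x _.
    rewrite !patchE !mem_setE !in_itv/= !andbT /f/= indicE.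
    case: (ltP v x) => vx.
      by rewrite (lt_trans v0 vx) mem_set// mulr1 mulrC.
    case: ifP => // _; rewrite memNset ?mulr0//=.
    by apply/negP; rewrite -leNgt.
  rewrite ge0_integralZl_real//; last by mfun.
  rewrite integral_powR_tail// -EFinM; congr EFin.
  by rewrite (_ : 1 - s - 1 = - s); ring.
rewrite ge0_integralZl_real//.
- by rewrite integral_gammaE ?subr_gt0// -EFinM mulrC.
- by mfun.
- by move=> x _; rewrite mulr_ge0.
- by rewrite invr_ge0 ltW.
Qed.

Lemma measurable_frullani s (D : set R) : measurable_fun D (fun x : R => x `^ (- s - 1) * (1 - expR (- x))).
Proof. by apply: measurable_funTS; mfun. Qed.

Lemma integral_frullani_scale s u : 0 < s < 1 -> 0 < u ->
  (\int[mu]_(x in `]0%R, +oo[) (x `^ (- s - 1) * (1 - expR (- (u * x))))%:E =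
   (Gamma_integral (1 - s) / s * u `^ s)%:E)%E.
Proof.
move=> s01 u0.
pose f x := x `^ (- s - 1) * (1 - expR (- x)).
have f0 x : 0 < x -> 0 <= f x.
  by move=> x0; rewrite mulr_ge0// subr_ge0 -expR0 ler_expR oppr_le0 ltW.
transitivity (\int[mu]_(t in `]0%R, +oo[) ((u `^ (s + 1)) * f (u * t))%:E)%E.
  apply: eq_integral => t; rewrite inE/= in_itv/= andbT => t0; congr EFin.
  rewrite /f powRM ?ltW// !mulrA -gt0_powRD//.
  by rewrite (_ : s + 1 + (- s - 1) = 0) ?powRr0 ?mul1r//; ring.
rewrite ge0_integralZl_real//; last 2 first.
- by apply: measurable_funTS; rewrite /f; mfun.
- by move=> x; rewrite /= in_itv/= andbT => x0; apply: f0; rewrite mulr_gt0.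
rewrite (@ge0_integral0y_scale _ _ (fun t => (f t)%:E))//; last first.
  by apply: measEFin; exact: measurable_frullani.
rewrite integral_frullani// -!EFinM; congr EFin.
rewrite mulrA mulrC; congr (_ * _).
rewrite -powR_inv1 ?ltW// -gt0_powRD//.
by congr powR; ring.
Qed.

Lemma powRN1D_le1 x b : 0 <= x -> 0 <= b -> (1 + x) `^ (- b) <= 1.
Proof.
move=> x0 b0; rewrite -[leRHS](powRr0 (1 + x)) ler_powR ?lerDl//.
by rewrite oppr_le0.
Qed.

(** Write (1+x)^-b as a Gamma integral over u, exchange the integrals, and
    apply the scaled Frullani integral for each u. *)
Lemma integral_beta s b : 0 < s < 1 -> 0 < b ->
  (\int[mu]_(x in `]0%R, +oo[) (x `^ (- s - 1) * (1 - (1 + x) `^ (- b)))%:E =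
   (Gamma_integral (1 - s) / s * (Gamma_integral (b + s) / Gamma_integral b))%:E)%E.
Proof.
move=> s01 b0; have G0 := Gamma_integral_gt0 b0.
pose f (z : measurableTypeR R * measurableTypeR R) : \bar R :=
  (z.1 `^ (- s - 1) * (z.2 `^ (b - 1) * expR (- z.2) * (1 - expR (- (z.2 * z.1)))))%:E.
have f0 x u : 0 < x -> 0 < u -> (0 <= f (x, u))%E.
  move=> x0 u0; rewrite lee_fin /= !mulr_ge0// subr_ge0 -expR0 ler_expR oppr_le0.
  by rewrite mulr_ge0// ltW.
have mf : measurable_fun setT f by rewrite /f; mfun.
have E1 x : 0 < x -> (\int[mu]_(u in `]0%R, +oo[) f (x, u) =
    (Gamma_integral b * (x `^ (- s - 1) * (1 - (1 + x) `^ (- b))))%:E)%E.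
  move=> x0.
  have x1 : 0 < 1 + x by rewrite addr_gt0.
  pose h u := u `^ (b - 1) * expR (- u) * (1 - expR (- (u * x))).
  have h0 u : 0 < u -> 0 <= h u.
    move=> u0; rewrite !mulr_ge0// subr_ge0 -expR0 ler_expR oppr_le0.
    by rewrite mulr_ge0// ltW.
  have mh (D : set (measurableTypeR R)) : measurable_fun D h by apply: measurable_funTS; rewrite /h; mfun.
  have : (\int[mu]_(u in `]0%R, +oo[) (h u)%:E + \int[mu]_(u in `]0%R, +oo[) (u `^ (b - 1) * expR (- ((1 + x) * u)))%:E = (Gamma_integral b)%:E)%E.
    rewrite -ge0_integralD//; last 4 first.
    - by move=> u/=; rewrite in_itv/= andbT => u0; rewrite lee_fin h0.
    - by apply: measEFin; exact: mh.
    - by move=> u _; rewrite lee_fin mulr_ge0.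
    - by mfun.
    rewrite -integral_gammaE//; apply: eq_integral => u _; rewrite -EFinD; congr EFin.
    rewrite /h (_ : - ((1 + x) * u) = - u - u * x); last by ring.
    by rewrite expRD; ring.
  rewrite integral_gamma_scale//.
  have : (0 <= \int[mu]_(u in `]0%R, +oo[) (h u)%:E)%E.
    by apply: integral_ge0 => u/=; rewrite in_itv/= andbT => u0; rewrite lee_fin h0.
  case E : (\int[mu]_(u in `]0%R, +oo[) (h u)%:E)%E => [r| |]// _.
  rewrite -EFinD => -[rE].
  transitivity (\int[mu]_(u in `]0%R, +oo[) (x `^ (- s - 1) * h u)%:E)%E.
    by apply: eq_integral => u _; rewrite /f/=.
  rewrite ge0_integralZl_real//; last first.
    by move=> u/=; rewrite in_itv/= andbT => u0; rewrite h0.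
  rewrite E -EFinM; congr EFin.
  have -> : r = Gamma_integral b - Gamma_integral b * (1 + x) `^ (- b) by apply/eqP; rewrite -subr_eq opprK rE.
  by ring.
apply: (@eq_trans _ _ ((Gamma_integral b)^-1%:E * \int[mu]_(x in `]0%R, +oo[) \int[mu]_(u in `]0%R, +oo[) f (x, u))%E).
  transitivity ((Gamma_integral b)^-1%:E * \int[mu]_(x in `]0%R, +oo[) (Gamma_integral b * (x `^ (- s - 1) * (1 - (1 + x) `^ (- b))))%:E)%E; last first.
    congr (_ * _)%E; apply: eq_integral => x; rewrite inE/= in_itv/= andbT => x0.
    by rewrite E1.
  rewrite ge0_integralZl_real//.
  - by rewrite muleA -EFinM mulVf ?mul1e ?gt_eqF.
  - by mfun.
  - move=> x; rewrite /= in_itv/= andbT => x0; rewrite mulr_ge0// subr_ge0.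
    by apply: powRN1D_le1; exact: ltW.
  - exact: ltW.
rewrite tonelli//; last 2 first.
- exact: measurable_funTS.
- by move=> x y/=; rewrite !in_itv/= !andbT; exact: f0.
transitivity ((Gamma_integral b)^-1%:E * \int[mu]_(u in `]0%R, +oo[) ((Gamma_integral (1 - s) / s) * (u `^ (b + s - 1) * expR (- u)))%:E)%E.
  congr (_ * _)%E; apply: eq_integral => u; rewrite inE/= in_itv/= andbT => u0.
  transitivity (\int[mu]_(x in `]0%R, +oo[) ((u `^ (b - 1) * expR (- u)) * (x `^ (- s - 1) * (1 - expR (- (u * x)))))%:E)%E.
    by apply: eq_integral => x _; rewrite /f/=; congr EFin; ring.
  rewrite ge0_integralZl_real//.
  - rewrite integral_frullani_scale// -EFinM; congr EFin.
    have -> : b + s - 1 = (b - 1) + s by ring.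
    by rewrite (@gt0_powRD _ u (b - 1) s u0); ring.
  - by mfun.
  - move=> x; rewrite /= in_itv/= andbT => x0; rewrite mulr_ge0// subr_ge0 -expR0 ler_expR.
    by rewrite oppr_le0 mulr_ge0// ltW.
  - by rewrite mulr_ge0.
have /andP[s0 s1] := s01.
rewrite ge0_integralZl_real//.
- by rewrite integral_gammaE ?addr_gt0// -!EFinM; congr EFin; ring.
- by mfun.
- by move=> x _; rewrite mulr_ge0.
- by rewrite divr_ge0 ?ltW// Gamma_integral_gt0// subr_gt0.
Qed.

End frullani.

(** * Gamma quotients and the eigenvalues of the powers *)

Section gamma_ratio.
Context {R : realType}.
Local Notation mu := (@lebesgue_measure R).
Variable s : R.
Hypothesis s01 : 0 < s < 1.
Implicit Types p q b x y h : R.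

Definition gamma_ratio b : R := Gamma_integral (b + s) / Gamma_integral b.

Let s0 : 0 < s. Proof. by case/andP: s01. Qed.

Lemma gamma_ratio_gt0 b : 0 < b -> 0 < gamma_ratio b.
Proof. by move=> b0; rewrite divr_gt0// Gamma_integral_gt0// addr_gt0. Qed.

Let kap := Gamma_integral (1 - s) / s.
Let kap0 : 0 < kap.
Proof. by case/andP: s01 => s0' s1; rewrite divr_gt0// Gamma_integral_gt0// subr_gt0. Qed.

Let incr x h (t : R) := t `^ (- s - 1) * ((1 + t) `^ (- x) * (1 - (1 + t) `^ (- h))).

Let incr_ge0 x h t : 0 <= x -> 0 <= h -> 0 < t -> 0 <= incr x h t.
Proof.
by move=> x0 h0 t0; rewrite !mulr_ge0// subr_ge0 powRN1D_le1// ltW.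
Qed.

Let measurable_incr x h (D : set R) : measurable_fun D (incr x h).
Proof. by apply: measurable_funTS; rewrite /incr; mfun. Qed.

Let integral_incr x h : 0 < x -> 0 < h ->
  (\int[mu]_(t in `]0%R, +oo[) (incr x h t)%:E =
    (kap * (gamma_ratio (x + h) - gamma_ratio x))%:E)%E.
Proof.
move=> x0 h0.
have I0 : (0 <= \int[mu]_(t in `]0%R, +oo[) (incr x h t)%:E)%E.
  apply: integral_ge0 => t/=; rewrite in_itv/= andbT => t0.
  by rewrite lee_fin incr_ge0// ltW.
have : (\int[mu]_(t in `]0%R, +oo[) (incr x h t)%:E +
   \int[mu]_(t in `]0%R, +oo[) (t `^ (- s - 1) * (1 - (1 + t) `^ (- x)))%:E =
   \int[mu]_(t in `]0%R, +oo[) (t `^ (- s - 1) * (1 - (1 + t) `^ (- (x + h))))%:E)%E.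
  rewrite -ge0_integralD//; last 4 first.
  - move=> t/=; rewrite in_itv/= andbT => t0.
    by rewrite lee_fin incr_ge0// ltW.
  - by apply: measEFin; exact: measurable_incr.
  - move=> t/=; rewrite in_itv/= andbT => t0.
    by rewrite lee_fin mulr_ge0// subr_ge0 powRN1D_le1// ltW.
  - by mfun.
  apply: eq_integral => t; rewrite inE/= in_itv/= andbT => t0.
  rewrite -EFinD; congr EFin; rewrite /incr opprD (@gt0_powRD _ (1 + t))//; first by ring.
  by rewrite addr_gt0.
rewrite !integral_beta ?addr_gt0//.
case: (\int[mu]_(t in `]0%R, +oo[) (incr x h t)%:E)%E I0 => [r _| |]//.
rewrite -EFinD => -[E]; congr EFin.
by rewrite mulrBr /gamma_ratio/kap -E addrK.
Qed.

Lemma gamma_ratio_ltr x h : 0 < x -> 0 < h -> gamma_ratio x <= gamma_ratio (x + h).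
Proof.
move=> x0 h0; rewrite -subr_ge0 -(pmulr_rge0 _ kap0) -lee_fin -integral_incr//.
apply: integral_ge0 => t/=; rewrite in_itv/= andbT => t0.
by rewrite lee_fin incr_ge0// ltW.
Qed.

(** By [integral_beta], gamma_ratio is, up to a constant factor, the integral
    of 1 - (1+t)^-b against t^(-s-1), and 1 - (1+t)^-b is strictly concave in
    b.  Strictness survives integration because the difference of the
    integrands is bounded below on [[1, 2]]. *)
Lemma gamma_ratio_concave x y h : 0 < x -> x < y -> 0 < h ->
  gamma_ratio (y + h) - gamma_ratio y < gamma_ratio (x + h) - gamma_ratio x.
Proof.
move=> x0 xy h0.
have y0 : 0 < y by exact: lt_trans xy.
have yx0 : 0 < y - x by rewrite subr_gt0.
rewrite -(ltr_pM2l kap0) -lte_fin -!integral_incr//.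
(* The difference of the integrands at x and at y. *)
pose g (t : R) := incr x (y - x) t * (1 - (1 + t) `^ (- h)).
have g0 t : 0 < t -> 0 <= g t.
  move=> t0; rewrite mulr_ge0//; first by rewrite incr_ge0// ltW.
  by rewrite subr_ge0 powRN1D_le1// ltW.
have mg (D : set R) : measurable_fun D g.
  by apply: measurable_funTS; rewrite /g /incr; mfun.
have -> : (\int[mu]_(t in `]0%R, +oo[) (incr x h t)%:E =
  \int[mu]_(t in `]0%R, +oo[) (incr y h t)%:E + \int[mu]_(t in `]0%R, +oo[) (g t)%:E)%E.
  rewrite -ge0_integralD//.
  - apply: eq_integral => t; rewrite inE/= in_itv/= andbT => t0.
    have E : (1 + t) `^ (- y) = (1 + t) `^ (- x) * (1 + t) `^ (- (y - x)).
      by rewrite -gt0_powRD ?addr_gt0//; congr powR; ring.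
    by rewrite -EFinD; congr EFin; rewrite /g/incr E; ring.
  - move=> t/=; rewrite in_itv/= andbT => t0.
    by rewrite lee_fin incr_ge0// ltW.
  - by apply: measEFin; exact: measurable_incr.
  - by move=> t/=; rewrite in_itv/= andbT => t0; rewrite lee_fin g0.
  - by apply: measEFin; exact: mg.
rewrite integral_incr//.
rewrite lteDl//.
pose c := 2 `^ (- s - 1) * (3 `^ (- x) * (1 - 2 `^ (- (y - x)))) * (1 - 2 `^ (- h)) : R.
have lt1 (k : R) : 0 < k -> 0 < 1 - 2 `^ (- k) :> R.
  move=> k0; rewrite subr_gt0 powRN invf_lt1 ?powR_gt0//.
  rewrite -[ltLHS](_ : 1 `^ k = 1); last by rewrite powR1.
  by apply: gt0_ltr_powR; rewrite ?nnegrE// ltr1n.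
have c0 : 0 < c by rewrite !mulr_gt0 ?powR_gt0 ?lt1.
have npow (k a b : R) : 0 <= k -> 0 < a -> a <= b -> b `^ (- k) <= a `^ (- k) :> R.
  move=> k0 a0 ab; rewrite !powRN lef_pV2 ?posrE ?powR_gt0//; last exact: lt_le_trans ab.
  by apply: ge0_ler_powR => //; rewrite nnegrE ltW// (lt_le_trans a0).
have gc t : t \in `[1, 2] -> c <= g t.
  rewrite in_itv/= => /andP[t1 t2]; have t0 : 0 < t by exact: lt_le_trans t1.
  have p1 := ltW (lt1 _ h0); have p2 := ltW (lt1 _ yx0).
  have q1 : 2 `^ (- s - 1) <= t `^ (- s - 1).
    by rewrite -opprD; apply: npow => //; rewrite addr_ge0// ltW.
  have q2 : 3 `^ (- x) <= (1 + t) `^ (- x).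
    by apply: npow; [exact: ltW|rewrite addr_gt0|lra].
  have q3 : (1 + t) `^ (- (y - x)) <= 2 `^ (- (y - x)).
    by apply: npow; [exact: ltW| |lra].
  have q4 : (1 + t) `^ (- h) <= 2 `^ (- h).
    by apply: npow; [exact: ltW| |lra].
  rewrite /g /incr /c; apply: ler_pM; [by rewrite !mulr_ge0|by []| |by rewrite lerB].
  apply: ler_pM; [by []|by rewrite mulr_ge0|by []|].
  by apply: ler_pM; [by []|by []|by []|rewrite lerB].
apply: (@lt_le_trans _ _ (\int[mu]_(t in `[1%R, 2%R]) (cst c%:E) t)%E).
  rewrite integral_cst//= lebesgue_measure_itv/= lte_fin ltr1n -EFinB -EFinM lte_fin.
  by rewrite mulr_gt0//; lra.
apply: (@le_trans _ _ (\int[mu]_(t in `[1%R, 2%R]) (g t)%:E)%E).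
  apply: ge0_le_integral => //.
  - by move=> t _; rewrite lee_fin ltW.
  - by apply: measEFin; exact: mg.
apply: ge0_subset_integral => //.
- by apply: measEFin; exact: mg.
- by move=> t/=; rewrite in_itv/= andbT => t0; rewrite lee_fin g0.
- by move=> t/=; rewrite !in_itv/= andbT => /andP[t1 _]; exact: lt_le_trans t1.
Qed.

(** A product of two values of an increasing, strictly concave, positive
    function grows when the two points move towards each other with fixed sum.
    *)
Lemma gamma_ratio_prod x y x' y' : 0 < x -> x < x' -> x' <= y' -> x + y = x' + y' ->
  gamma_ratio x * gamma_ratio y < gamma_ratio x' * gamma_ratio y'.
Proof.
move=> x0 xx' x'y' E.
have h0 : 0 < x' - x by rewrite subr_gt0.
have Ey : y = y' + (x' - x) by lra.
have Ex : x' = x + (x' - x) by lra.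
have y'0 : 0 < y' by lra.
have x'0 : 0 < x' by exact: lt_trans xx'.
have d12 := @gamma_ratio_concave x y' (x' - x) x0 (lt_le_trans xx' x'y') h0.
have d2 := @gamma_ratio_ltr y' (x' - x) y'0 h0.
rewrite -Ex -Ey in d12 d2.
have x'y : gamma_ratio x' <= gamma_ratio y'.
  have [->|ne] := eqVneq x' y'; first exact: lexx.
  have := @gamma_ratio_ltr x' (y' - x') x'0; rewrite (_ : x' + (y' - x') = y'); last by ring.
  by apply; rewrite subr_gt0 lt_neqAle ne.
have p1 := gamma_ratio_gt0 x0; have p2 := gamma_ratio_gt0 y'0.
have p3 := gamma_ratio_gt0 x'0.
move: (gamma_ratio x) (gamma_ratio y) (gamma_ratio x') (gamma_ratio y') d12 d2 x'y p1 p2 p3.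
move=> A B C D d12 d2 CD A0 D0 C0.
rewrite -subr_gt0.
have -> : C * D - A * B = (C - A) * (D - C) + (C - A - (B - D)) * C + (C - A) * (B - D).
  by ring.
by rewrite ltr_wpDr ?mulr_ge0 ?ltr_wpDl ?mulr_gt0 ?mulr_ge0//; lra.
Qed.

(** The eigenvalue of the power of exponent -a: away from the origin (-Delta)^s
    |x|^-a = power_eigen |x|^(-a-2s).  It is symmetric under a -> N - 2s - a.
    *)
Definition power_eigen (N : nat) (a : R) : R :=
  2 `^ (2 * s) * (gamma_ratio (a / 2) * gamma_ratio ((N%:R - 2 * s - a) / 2)).

Lemma power_eigen_lt N a a' : 0 < a -> a < a' -> a' <= (N%:R - 2 * s) / 2 ->
  power_eigen N a < power_eigen N a'.
Proof.
move=> a0 aa' a'N; rewrite ltr_pM2l ?powR_gt0//.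
by apply: gamma_ratio_prod; lra.
Qed.

Lemma GammaE x : 0 < x -> Gamma x = Gamma_integral x.
Proof. by move=> x0; rewrite /Gamma x0 addr0 big_ord0 divr1. Qed.

(** The reflected value enters the normalising constant of the fractional
    Laplacian; it agrees with the Frullani integral. *)
Lemma GammaN : `|Gamma (- s)| = kap.
Proof.
case/andP: s01 => s0' s1.
rewrite /Gamma oppr_gt0 ltNge ltW//=.
have -> : Num.truncn (- - s) = 0%N.
  by apply/eqP; rewrite opprK truncn_eq ?ltW//= s1.
rewrite big_ord_recl big_ord0 /= addr0 mulr1 invrN mulrN normrN ger0_norm.
  by rewrite addrC.
by rewrite divr_ge0// ?ltW// Gamma_integral_gt0// addrC subr_gt0.
Qed.

(** The four Gamma factors pair up into two quotients whose arguments differ by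
    s. *)
Lemma lambda_of_alphaE N alpha : 0 <= alpha < (N%:R - 2 * s) / 2 ->
  lambda_of_alpha N s alpha = power_eigen N ((N%:R - 2 * s) / 2 - alpha).
Proof.
move=> /andP[a0 aN]; rewrite /lambda_of_alpha /power_eigen /gamma_ratio.
have -> : ((N%:R - 2 * s) / 2 - alpha) / 2 = (N%:R - 2 * s - 2 * alpha) / 4 by lra.
have -> : (N%:R - 2 * s - ((N%:R - 2 * s) / 2 - alpha)) / 2 = (N%:R - 2 * s + 2 * alpha) / 4 by lra.
have -> : (N%:R - 2 * s - 2 * alpha) / 4 + s = (N%:R + 2 * s - 2 * alpha) / 4 by lra.
have -> : (N%:R - 2 * s + 2 * alpha) / 4 + s = (N%:R + 2 * s + 2 * alpha) / 4 by lra.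
have s0' := s0.
have p1 : 0 < (N%:R + 2 * s + 2 * alpha) / 4 by lra.
have p2 : 0 < (N%:R + 2 * s - 2 * alpha) / 4 by lra.
have p3 : 0 < (N%:R - 2 * s + 2 * alpha) / 4 by lra.
have p4 : 0 < (N%:R - 2 * s - 2 * alpha) / 4 by lra.
by rewrite !GammaE// invfM; ring.
Qed.

Lemma fraclap_constE N : (0 < N)%N -> fraclap_const N s =
  2 `^ (2 * s) * pi `^ (- (N%:R / 2)) * (Gamma_integral (N%:R / 2 + s) / kap).
Proof.
move=> N0; rewrite /fraclap_const.
have -> : (N%:R + 2 * s) / 2 = N%:R / 2 + s by lra.
have p0 : 0 < N%:R / 2 + s by rewrite addr_gt0// divr_gt0// ltr0n.
by rewrite GammaN (GammaE p0).
Qed.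

End gamma_ratio.

(** * The Euclidean norm and integration on the space *)

Section enorm_theory.
Context {R : realType} {n : nat}.
Implicit Types x y z : 'rV[R]_n.

Definition dotr x y : R := \sum_i x ord0 i * y ord0 i.

Lemma enorm_ge0 x : 0 <= enorm x.
Proof. exact: sqrtr_ge0. Qed.

Lemma enorm_sqr x : enorm x ^+ 2 = dotr x x.
Proof.
rewrite sqr_sqrtr; first by apply: eq_bigr => i _; rewrite expr2.
by apply: sumr_ge0 => i _; exact: sqr_ge0.
Qed.

Lemma enorm_eq0 x : enorm x = 0 -> x = 0.
Proof.
move=> x0; have := enorm_sqr x; rewrite x0 expr0n /= => /esym/eqP.
rewrite psumr_eq0 => [/allP h|i _]; last by rewrite -expr2 sqr_ge0.
apply/rowP => i; have := h i (mem_index_enum _).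
by rewrite /= -expr2 sqrf_eq0 mxE => /eqP.
Qed.

Lemma enorm_gt0 x : x != 0 -> 0 < enorm x.
Proof.
move=> x0; rewrite lt_neqAle enorm_ge0 andbT; apply: contra x0 => /eqP/esym.
by move=> /enorm_eq0 ->.
Qed.

Lemma enorm0 : enorm (0 : 'rV[R]_n) = 0.
Proof. by rewrite /enorm big1 ?sqrtr0// => i _; rewrite mxE expr0n. Qed.

Lemma enormN x : enorm (- x) = enorm x.
Proof. by congr Num.sqrt; apply: eq_bigr => i _; rewrite mxE sqrrN. Qed.

Lemma enormB x y : enorm (x - y) = enorm (y - x).
Proof. by rewrite -enormN opprB. Qed.

Lemma dotrDl x y z : dotr (x + y) z = dotr x z + dotr y z.
Proof. by rewrite -big_split/=; apply: eq_bigr => i _; rewrite mxE mulrDl. Qed.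
Lemma dotrC x y : dotr x y = dotr y x.
Proof. by apply: eq_bigr => i _; rewrite mulrC. Qed.
Lemma dotrDr x y z : dotr z (x + y) = dotr z x + dotr z y.
Proof. by rewrite dotrC dotrDl !(dotrC z). Qed.
Lemma dotrNl x y : dotr (- x) y = - dotr x y.
Proof. by rewrite /dotr -sumrN; apply: eq_bigr => i _; rewrite mxE mulNr. Qed.
Lemma dotrNr x y : dotr x (- y) = - dotr x y.
Proof. by rewrite dotrC dotrNl dotrC. Qed.
Lemma dotrZl k x y : dotr (k *: x) y = k * dotr x y.
Proof. by rewrite /dotr mulr_sumr; apply: eq_bigr => i _; rewrite mxE mulrA. Qed.

Lemma enormD_sqr x y : enorm (x + y) ^+ 2 = enorm x ^+ 2 + 2 * dotr x y + enorm y ^+ 2.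
Proof. by rewrite !enorm_sqr !dotrDl !dotrDr (dotrC y x); ring. Qed.

(** Cauchy-Schwarz, from the nonnegativity of the squared norm of a suitable
    linear combination. *)
Lemma dotr_le x y : `|dotr x y| <= enorm x * enorm y.
Proof.
suff h z : dotr z y <= enorm z * enorm y.
  rewrite ler_norml h andbT lerNl -dotrNl.
  by rewrite -(enormN x) h.
have [->|y0] := eqVneq y 0.
  by rewrite enorm0 mulr0 /dotr big1// => i _; rewrite mxE mulr0.
have [->|z0] := eqVneq z 0.
  by rewrite enorm0 mul0r /dotr big1// => i _; rewrite mxE mul0r.
have ny := enorm_gt0 y0; have nz := enorm_gt0 z0.
have := sqr_ge0 (enorm (enorm y *: z - enorm z *: y)).
rewrite enormD_sqr enormN dotrNr dotrZl (dotrC z) dotrZl (dotrC y).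
have E (k : R) (u : 'rV[R]_n) : enorm (k *: u) ^+ 2 = k ^+ 2 * enorm u ^+ 2.
  by rewrite !enorm_sqr dotrZl dotrC dotrZl; ring.
rewrite !E => h.
rewrite -(ler_pM2l (mulr_gt0 ny nz)) -subr_ge0.
by move: h; set a := enorm y; set b := enorm z; move: (dotr z y) => d; lra.
Qed.

Lemma ler_enormD x y : enorm (x + y) <= enorm x + enorm y.
Proof.
rewrite -(@ler_pXn2r _ 2)// ?nnegrE ?addr_ge0 ?enorm_ge0// enormD_sqr sqrrD.
rewrite lerD2r lerD2l mulr2n mulrDl !mul1r.
by rewrite lerD// (le_trans (ler_norm _) (dotr_le _ _)).
Qed.

Lemma ler_coord_enorm x i : `|x ord0 i| <= enorm x.
Proof.
rewrite -(@ler_pXn2r _ 2)// ?nnegrE ?enorm_ge0// enorm_sqr /dotr (bigD1 i)//=.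
rewrite real_normK ?num_real// -expr2 lerDl; apply: sumr_ge0 => j _.
by rewrite -expr2 sqr_ge0.
Qed.

Lemma enorm_ler_sum x : enorm x <= \sum_i `|x ord0 i|.
Proof.
have s0 : 0 <= \sum_i `|x ord0 i| by apply: sumr_ge0.
rewrite -(@ler_pXn2r _ 2)// ?nnegrE ?enorm_ge0// enorm_sqr expr2 mulr_suml.
apply: ler_sum => i _; apply: (le_trans (ler_norm _)).
rewrite normrM ler_wpM2l// (bigD1 i)//= lerDl.
exact: sumr_ge0.
Qed.

Lemma ler_enorm_norm x : enorm x <= n%:R * `|x|.
Proof.
apply: le_trans (enorm_ler_sum x) _.
apply: (@le_trans _ _ (\sum_(i < n) `|x|)); last first.
  by rewrite sumr_const card_ord mulr_natl.
apply: ler_sum => i _; rewrite [in leRHS]/Num.norm/= mx_normrE.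
exact: (le_bigmax _ (fun ij : 'I_1 * 'I_n => `|x ij.1 ij.2|) (ord0, i)).
Qed.

End enorm_theory.

Section leb_theory.
Context {R : realType}.
Local Notation mu := (@lebesgue_measure R).

Lemma ge0_integral_lebS n (f : 'rV[R]_n.+1 -> \bar R) :
  measurable_fun setT f -> (forall x, (0 <= f x)%E) ->
  (\int[leb R n.+1]_x f x = \int[mu]_a \int[leb R n]_x f (rV_cons (a, x)))%E.
Proof.
move=> mf f0.
transitivity (\int[pushforward (mu \x leb R n)%E (@rV_cons R n)]_x f x)%E => //.
rewrite ge0_integral_pushforward//; last exact: measurable_rV_cons.
rewrite preimage_setT fubini_tonelli1//.
  exact: measurableT_comp mf (@measurable_rV_cons R n).
by move=> z; exact: f0.
Qed.

Lemma measurable_rV_op n d (T : measurableType d) (f : T -> 'rV[R]_n) :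
  (forall i, measurable_fun setT (fun x => f x ord0 i)) -> measurable_fun setT f.
Proof. by move=> h; apply/measurable_fun_rVP => i; exact: h. Qed.

Lemma measurable_coord n d (T : measurableType d) (D : set T) (f : T -> 'rV[R]_n) i :
  measurable_fun D f -> measurable_fun D (fun x => f x ord0 i).
Proof. by move=> mf; exact: (measurableT_comp (measurable_rV_coord i) mf). Qed.

Lemma measurable_rVD n d (T : measurableType d) (f g : T -> 'rV[R]_n) :
  measurable_fun setT f -> measurable_fun setT g -> measurable_fun setT (fun x => f x + g x).
Proof.
move=> mf mg; apply: measurable_rV_op => i.
under eq_fun do rewrite mxE.
by apply: measD; exact: measurable_coord.
Qed.

Lemma measurable_rVN n d (T : measurableType d) (f : T -> 'rV[R]_n) :
  measurable_fun setT f -> measurable_fun setT (fun x => - f x).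
Proof.
move=> mf; apply: measurable_rV_op => i.
under eq_fun do rewrite mxE.
by apply: measN; exact: measurable_coord.
Qed.

Lemma enormE n (x : 'rV[R]_n) : enorm x = (\sum_i x ord0 i ^+ 2) `^ (2^-1).
Proof. by rewrite powR12_sqrt// sumr_ge0// => i _; exact: sqr_ge0. Qed.

Lemma measurable_enorm n d (T : measurableType d) (D : set T) (f : T -> 'rV[R]_n) :
  measurable_fun D f -> measurable_fun D (fun x => enorm (f x)).
Proof.
move=> mf; under eq_fun do rewrite enormE.
apply: measpow; apply: measurable_sum => i.
by apply: measX; exact: measurable_coord.
Qed.

Lemma ge0_leb_shift n h (f : 'rV[R]_n -> \bar R) :
  measurable_fun setT f -> (forall x, (0 <= f x)%E) ->
  (\int[leb R n]_x f (x + h)%R = \int[leb R n]_x f x)%E.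
Proof.
elim: n h f => [|n IH] h f mf f0.
  by apply: eq_integral => x _; rewrite (_ : (x + h)%R = x)//; apply/rowP; case.
have ms : measurable_fun setT (fun x : 'rV[R]_n.+1 => x + h).
  by apply: measurable_rVD => //; exact: measurable_id.
rewrite (ge0_integral_lebS mf f0).
rewrite (ge0_integral_lebS (measurableT_comp mf ms) (fun x => f0 _)) /=.
have E a x : (rV_cons (a, x) + h)%R = rV_cons (a + h ord0 ord0, x + (rV_split h).2)%R.
  apply/rowP => i; rewrite !mxE; case: unliftP => [j ->|->]/=; by rewrite ?mxE.
under eq_integral do under eq_integral do rewrite E.
have mfc : measurable_fun setT (f \o @rV_cons R n).
  exact: measurableT_comp mf (@measurable_rV_cons R n).
transitivity (\int[mu]_a \int[leb R n]_x f (rV_cons (a + h ord0 ord0, x)%R))%E.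
  apply: eq_integral => a _.
  rewrite -(IH (rV_split h).2 (fun x => f (rV_cons (a + h ord0 ord0, x)%R)))//.
  apply: (measurableT_comp mfc).
  by apply/measurable_fun_pairP; split; [exact: measurable_cst|exact: measurable_id].
apply: (ge0_integral_shift _ (f := fun a => (\int[leb R n]_x f (rV_cons (a, x)))%E)).
  apply: (measurable_fun_fubini_tonelli_F (m2 := leb R n) (f \o @rV_cons R n)) => //.
  by move=> z; exact: f0.
by move=> a; apply: integral_ge0 => x _.
Qed.

Lemma ge0_leb_opp n (f : 'rV[R]_n -> \bar R) :
  measurable_fun setT f -> (forall x, (0 <= f x)%E) ->
  (\int[leb R n]_x f (- x)%R = \int[leb R n]_x f x)%E.
Proof.
elim: n f => [|n IH] f mf f0.
  by apply: eq_integral => x _; rewrite (_ : (- x)%R = x)//; apply/rowP; case.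
have ms : measurable_fun setT (fun x : 'rV[R]_n.+1 => - x).
  by apply: measurable_rVN => //; exact: measurable_id.
rewrite (ge0_integral_lebS mf f0).
rewrite (ge0_integral_lebS (measurableT_comp mf ms) (fun x => f0 _)) /=.
have E a x : (- (rV_cons (a, x) : 'rV[R]_n.+1))%R = rV_cons (- a, - x)%R.
  apply/rowP => i; rewrite !mxE; case: unliftP => [j _|_]/=; by rewrite ?mxE.
under eq_integral do under eq_integral do rewrite E.
have mfc : measurable_fun setT (f \o @rV_cons R n).
  exact: measurableT_comp mf (@measurable_rV_cons R n).
transitivity (\int[mu]_a \int[leb R n]_x f (rV_cons (- a, x)%R))%E.
  apply: eq_integral => a _.
  rewrite -(IH (fun x => f (rV_cons (- a, x)%R)))//.
  apply: (measurableT_comp mfc).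
  by apply/measurable_fun_pairP; split; [exact: measurable_cst|exact: measurable_id].
apply: (ge0_integral_opp (f := fun a => (\int[leb R n]_x f (rV_cons (a, x)))%E)).
  apply: (measurable_fun_fubini_tonelli_F (m2 := leb R n) (f \o @rV_cons R n)) => //.
  by move=> z; exact: f0.
by move=> a; apply: integral_ge0 => x _.
Qed.

Lemma integral_leb_prod n (g : 'I_n -> R -> R) (c : 'I_n -> R) :
  (forall i, measurable_fun setT (g i)) -> (forall i t, 0 <= g i t) ->
  (forall i, \int[mu]_t (g i t)%:E = (c i)%:E)%E ->
  (\int[leb R n]_x (\prod_i g i (x ord0 i))%:E = (\prod_i c i)%:E)%E.
Proof.
elim: n g c => [|n IH] g c mg g0 gc.
  under eq_integral do rewrite big_ord0.
  by rewrite big_ord0 integral_cst//= diracT mule1.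
rewrite ge0_integral_lebS//; last 2 first.
- apply: measEFin; apply: measurable_prod => i _.
  by apply: (measurableT_comp (mg i)); exact: (measurable_rV_coord i).
- by move=> x; rewrite lee_fin prodr_ge0.
have E a x : (\prod_i g i ((rV_cons (a, x)) ord0 i) =
    g ord0 a * \prod_i g (lift ord0 i) (x ord0 i))%R.
  rewrite big_ord_recl; congr (_ * _)%R; first by rewrite mxE unlift_none.
  by apply: eq_bigr => i _; rewrite mxE liftK.
under eq_integral do under eq_integral do rewrite E.
have P0 : 0 <= \prod_(i < n) c (lift ord0 i).
  apply: prodr_ge0 => i _; rewrite -lee_fin -gc; apply: integral_ge0 => t _.
  by rewrite lee_fin.
transitivity (\int[mu]_a (\prod_(i < n) c (lift ord0 i) * g ord0 a)%:E)%E.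
  apply: eq_integral => a _; rewrite ge0_integralZl_real//.
  - rewrite [X in (_ * X)%E](_ : _ = (\prod_(i < n) c (lift ord0 i))%:E).
      by rewrite -EFinM mulrC.
    by apply: (IH (fun i => g (lift ord0 i)) (fun i => c (lift ord0 i))).
  - apply: measurable_prod => i _.
    by apply: (measurableT_comp (mg _)); exact: (measurable_rV_coord i).
  - by move=> x _; rewrite prodr_ge0.
rewrite ge0_integralZl_real//.
rewrite [X in (_ * X)%E](_ : _ = (c ord0)%:E); last exact: gc.
by rewrite -EFinM big_ord_recl mulrC.
exact: mg.
Qed.

(** Completing the square. *)
Lemma integral_gauss1 (t tau x : R) : 0 <= t -> 0 < tau ->
  (\int[mu]_y (expR (- (t * y ^+ 2 + tau * (x - y) ^+ 2)))%:E =
  ((pi / (t + tau)) `^ (2^-1) * expR (- (t * tau / (t + tau) * x ^+ 2)))%:E)%E.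
Proof.
move=> t0 tau0.
have tt : 0 < t + tau by rewrite ltr_wpDl.
pose sg := Num.sqrt ((2 * (t + tau))^-1).
have sg2 : sg ^+ 2 = (2 * (t + tau))^-1.
  by rewrite sqr_sqrtr// invr_ge0 mulr_ge0// ltW.
have sg0 : sg != 0 by rewrite gt_eqF// sqrtr_gt0 invr_gt0 mulr_gt0.
pose m := tau * x / (t + tau).
pose C := (pi / (t + tau)) `^ (2^-1) * expR (- (t * tau / (t + tau) * x ^+ 2)).
transitivity (\int[mu]_y (C * normal_pdf m sg y)%:E)%E.
  apply: eq_integral => y _; congr EFin.
  rewrite normal_pdfE// /normal_peak /normal_fun /C.
  have -> : sg ^+ 2 * pi *+ 2 = pi / (t + tau).
    by rewrite sg2 -mulr_natr; field; rewrite gt_eqF.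
  have P0 : 0 < pi / (t + tau) by rewrite divr_gt0// pi_gt0.
  rewrite powR12_sqrt ?ltW// mulrACA divff ?gt_eqF ?sqrtr_gt0// mul1r.
  rewrite -expRD; congr expR; rewrite sg2 -mulr_natr /m.
  by field; rewrite gt_eqF.
rewrite ge0_integralZl_real//.
- by rewrite integral_normal_pdf ?mule1.
- exact: measurable_normal_pdf.
- by move=> y _; exact: normal_pdf_ge0.
- by rewrite mulr_ge0.
Qed.

(** A product of one-dimensional Gaussian convolutions; the value is again
    Gaussian in x. *)
Lemma integral_gauss n (t tau : R) (x : 'rV[R]_n) : 0 <= t -> 0 < tau ->
  (\int[leb R n]_y (expR (- (t * enorm y ^+ 2 + tau * enorm (x - y) ^+ 2)))%:E =
  ((pi / (t + tau)) `^ (n%:R / 2) * expR (- (t * tau / (t + tau) * enorm x ^+ 2)))%:E)%E.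
Proof.
move=> t0 tau0.
have expE (F : 'I_n -> R) : expR (- \sum_i F i) = \prod_i expR (- F i).
  by rewrite -sumrN expR_sum.
pose g i (y : R) := expR (- (t * y ^+ 2 + tau * (x ord0 i - y) ^+ 2)).
transitivity (\int[leb R n]_y (\prod_i g i (y ord0 i))%:E)%E.
  apply: eq_integral => y _; congr EFin; rewrite -expE; congr (expR (- _)).
  rewrite !enorm_sqr /dotr !mulr_sumr -big_split/=; apply: eq_bigr => i _.
  by rewrite !mxE !expr2.
rewrite (@integral_leb_prod _ _ (fun i => (pi / (t + tau)) `^ (2^-1) * expR (- (t * tau / (t + tau) * x ord0 i ^+ 2)))).
- congr EFin; rewrite big_split/= prodr_const card_ord -expE; congr (_ * expR (- _)).
    by rewrite -powR_mulrn// -powRrM (mulrC 2^-1).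
  by rewrite enorm_sqr /dotr mulr_sumr; apply: eq_bigr => i _; rewrite expr2.
- by move=> i; rewrite /g; mfun.
- by move=> i y; exact: expR_ge0.
- by move=> i; exact: integral_gauss1.
Qed.

Lemma leb_point n : (0 < n)%N -> leb R n [set 0] = 0%E.
Proof.
move=> n0; have -> : [set 0] = rV_box 0 (0 : 'rV[R]_n).
  apply/seteqP; split => [x -> i|x h]; first by rewrite !mxE in_itv/= lexx.
  apply/rowP => i; have := h i; rewrite !mxE in_itv/= => h'.
  by apply/eqP; rewrite eq_le andbC.
rewrite leb_box//; case: n n0 => // n _.
by rewrite big_ord_recl !mxE subrr mul0r.
Qed.

Lemma leb_eball_lty n (r : R) : 0 <= r -> (leb R n (eball 0 r) < +oo)%E.
Proof.
move=> r0.
apply: (@le_lt_trans _ _ (leb R n (rV_box (const_mx (- r)) (const_mx r)))).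
  apply: le_measure; rewrite ?inE.
  - rewrite [X in measurable X](_ : _ = (fun x => enorm (x - 0)) @^-1` `]-oo, r[%classic).
      rewrite -[X in measurable X]setTI.
      apply: measurable_enorm => //; under eq_fun do rewrite subr0; exact: measurable_id.
    by apply/seteqP; split=> x; rewrite /eball/= in_itv.
  - exact: measurable_rV_box.
  - move=> x; rewrite /eball/= subr0 => xr i; rewrite !mxE in_itv/=.
    by rewrite -ler_norml; apply: le_trans (ler_coord_enorm _ _) (ltW xr).
rewrite leb_box; first exact: ltry.
by move=> i; rewrite !mxE ge0_cp.
Qed.

End leb_theory.

(** * The kernel of the fractional Laplacian *)

Section kernel.
Context {R : realType} (N : nat).
Local Notation mu := (@lebesgue_measure R).
Local Notation L := (leb R N).
Implicit Types (s : R) (z : 'rV[R]_N).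

(** Since [0 `^ p] is 0 for nonzero p, the kernel vanishes at the origin, where
    the increments that multiply it vanish as well. *)
Definition riesz s z : R := enorm z `^ (- (N%:R + 2 * s)).

Lemma riesz_ge0 s z : 0 <= riesz s z. Proof. exact: powR_ge0. Qed.

Lemma rieszN s z : riesz s (- z) = riesz s z.
Proof. by rewrite /riesz enormN. Qed.

Lemma measurable_riesz s d (T : measurableType d) (D : set T) (f : T -> 'rV[R]_N) :
  measurable_fun D f -> measurable_fun D (fun x => riesz s (f x)).
Proof. by move=> mf; apply: measpow; exact: measurable_enorm. Qed.

(** The kernel is a superposition of Gaussians ([integral_gamma_scale] with q =
    |z|^2). *)
Lemma riesz_subord s z : 0 < s -> z != 0 ->
  (\int[mu]_(t in `]0%R, +oo[) (t `^ (N%:R / 2 + s - 1) * expR (- (t * enorm z ^+ 2)))%:E =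
   (Gamma_integral (N%:R / 2 + s) * riesz s z)%:E)%E.
Proof.
move=> s0 z0; have nz := enorm_gt0 z0.
have p0 : 0 < N%:R / 2 + s :> R by rewrite ltr_wpDl// divr_ge0.
under eq_integral do rewrite (mulrC _ (enorm z ^+ 2)).
rewrite integral_gamma_scale ?exprn_gt0//; congr (_ * _)%:E.
rewrite /riesz -powR_mulrn ?ltW// -powRrM; congr powR.
by field.
Qed.

Lemma bernoulli_ge (v : R) n : 0 <= v <= 1 -> 1 - n%:R * (1 - v) <= v ^+ n.
Proof.
move=> /andP[v0 v1]; elim: n => [|n IH]; first by rewrite mul0r subr0.
have h := ler_wpM2l v0 IH; rewrite exprS; apply: le_trans h.
rewrite -subr_ge0 -natr1.
have -> : v * (1 - n%:R * (1 - v)) - (1 - (n%:R + 1) * (1 - v)) = n%:R * (1 - v) ^+ 2 by ring.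
by rewrite mulr_ge0// sqr_ge0.
Qed.

Lemma powR_ratio_le (t : R) : 0 < t ->
  t `^ (- (N%:R / 2)) - (1 + t) `^ (- (N%:R / 2)) <= N%:R / t * t `^ (- (N%:R / 2)).
Proof.
move=> t0; have t1 : 0 < 1 + t by rewrite addr_gt0.
pose v := t / (1 + t).
have v0 : 0 < v by rewrite divr_gt0.
have v1 : v <= 1 by rewrite ler_pdivrMr// mul1r lerDr.
have E : (1 + t) `^ (- (N%:R / 2)) = t `^ (- (N%:R / 2)) * v `^ (N%:R / 2).
  rewrite /v powRM ?invr_ge0 ?ltW// mulrA -gt0_powRD// addNr powRr0 mul1r.
  by rewrite -(@powR_inv1 _ (1 + t)) ?ltW// -powRrM mulN1r.
rewrite E -[X in X - _]mulr1 -mulrBr mulrC ler_pM2r ?powR_gt0//.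
have h := @bernoulli_ge v N; rewrite v1 ltW// in h.
have h1 : v ^+ N <= v `^ (N%:R / 2).
  rewrite -(powR_mulrn _ (ltW v0)); apply: (@ger_powR _ v); first by rewrite v0.
  by rewrite ler_pdivrMr// mulr_natr mulr2n lerDl.
have h2 : 1 - v = (1 + t)^-1 by rewrite /v; field; rewrite gt_eqF.
rewrite h2 in h.
apply: (@le_trans _ _ (N%:R / (1 + t))).
  by have := le_trans (h isT) h1; lra.
by rewrite ler_wpM2l// lef_pV2 ?posrE// lerDr.
Qed.

Lemma integral_gauss_diff (t : R) : 0 < t ->
  (\int[L]_z ((1 - expR (- enorm z ^+ 2)) * expR (- (t * enorm z ^+ 2)))%:E =
   (pi `^ (N%:R / 2) * (t `^ (- (N%:R / 2)) - (1 + t) `^ (- (N%:R / 2))))%:E)%E.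
Proof.
move=> t0; have t1 : 0 < 1 + t by rewrite addr_gt0.
have men : measurable_fun setT (fun z : 'rV[R]_N => enorm z).
  by apply: measurable_enorm; exact: measurable_id.
have G u : 0 < u -> (\int[L]_z (expR (- (u * enorm z ^+ 2)))%:E =
    (pi `^ (N%:R / 2) * u `^ (- (N%:R / 2)))%:E)%E.
  move=> u0; have := @integral_gauss R N 0 u 0 (lexx _) u0.
  under eq_integral do rewrite mul0r add0r sub0r enormN.
  move=> ->; rewrite !mul0r oppr0 expR0 mulr1 add0r powRM ?pi_ge0 ?invr_ge0 ?ltW//.
  by rewrite -(@powR_inv1 _ u) ?ltW// -powRrM mulN1r.
pose f (z : 'rV[R]_N) := (1 - expR (- enorm z ^+ 2)) * expR (- (t * enorm z ^+ 2)).
have f0 z : 0 <= f z.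
  by rewrite mulr_ge0// subr_ge0 -expR0 ler_expR oppr_le0 sqr_ge0.
have mf : measurable_fun setT f by rewrite /f; mfun.
have I0 : (0 <= \int[L]_z (f z)%:E)%E by apply: integral_ge0 => z _; rewrite lee_fin.
have : (\int[L]_z (f z)%:E + \int[L]_z (expR (- ((1 + t) * enorm z ^+ 2)))%:E =
  \int[L]_z (expR (- (t * enorm z ^+ 2)))%:E)%E.
  rewrite -ge0_integralD//; last 3 first.
  - by move=> z _; rewrite lee_fin.
  - by mfun.
  - by mfun.
  apply: eq_integral => z _; rewrite -EFinD /f; congr EFin.
  have -> : - ((1 + t) * enorm z ^+ 2) = - enorm z ^+ 2 - t * enorm z ^+ 2 by ring.
  by rewrite expRD; ring.
rewrite !G// -/(f _) => /eqP; case: (\int[L]_z _)%E I0 => [r _| |]//.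
rewrite -EFinD => /eqP[E]; congr EFin.
by rewrite mulrBr -E addrK.
Qed.

(** The weight 1 - exp(-|z|^2) is comparable to min(1, |z|^2), but its integral
    against each Gaussian is explicit, so that subordination reduces the claim
    to a one-dimensional integral. *)
Lemma riesz_gauss_lty s : 0 < s < 1 ->
  (\int[L]_z ((1 - expR (- enorm z ^+ 2)) * riesz s z)%:E < +oo)%E.
Proof.
move=> /andP[s0 s1].
have men : measurable_fun setT (fun z : 'rV[R]_N => enorm z).
  by apply: measurable_enorm; exact: measurable_id.
have p0 : 0 < N%:R / 2 + s :> R by rewrite ltr_wpDl// divr_ge0.
have G0 := Gamma_integral_gt0 p0.
pose f (y : 'rV[R]_N * measurableTypeR R) := (1 - expR (- enorm y.1 ^+ 2)) *
  (y.2 `^ (N%:R / 2 + s - 1) * expR (- (y.2 * enorm y.1 ^+ 2))).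
have men1 (D : set ('rV[R]_N * measurableTypeR R)) : measurable_fun D (fun y => enorm y.1).
  by apply: measurable_enorm; exact: (measurable_funTS measurable_fst).
have e1 (z : 'rV[R]_N) : 0 <= 1 - expR (- enorm z ^+ 2).
  by rewrite subr_ge0 -expR0 ler_expR oppr_le0 sqr_ge0.
have f0 y : 0 <= f y by rewrite !mulr_ge0.
have mf (D : set ('rV[R]_N * measurableTypeR R)) : measurable_fun D f by rewrite /f; mfun.
suff : (\int[L]_z (Gamma_integral (N%:R / 2 + s) * ((1 - expR (- enorm z ^+ 2)) * riesz s z))%:E < +oo)%E.
  have mr : measurable_fun setT (riesz s) by apply: measurable_riesz; exact: measurable_id.
  rewrite ge0_integralZl_real//; last 3 first.
  - by mfun.
  - by move=> z _; rewrite mulr_ge0// riesz_ge0.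
  - exact: ltW.
  case: (\int[L]_z _)%E => [r _| |]//; first exact: ltry.
  by rewrite gt0_muley ?lte_fin// ltxx.
rewrite (_ : (\int[L]_z _)%E = (\int[L]_z \int[mu]_(t in `]0%R, +oo[) (f (z, t))%:E)%E); last first.
  apply: eq_integral => z _; rewrite /f/= ge0_integralZl_real; [|exact: measurable_itv|by mfun|by move=> *; rewrite mulr_ge0|exact: e1].
  have [->|z0] := eqVneq z 0.
    by rewrite enorm0 expr0n/= oppr0 expR0 subrr !mul0r mulr0 mul0e.
  by rewrite riesz_subord// -EFinM; congr EFin; ring.
rewrite (@tonelli _ _ _ _ _ L mu setT `]0, +oo[ (fun y => (f y)%:E))//; last 2 first.
- by apply: measEFin; exact: mf.
- by move=> *; rewrite lee_fin.
rewrite (_ : (\int[mu]_(t in _) _)%E = (\int[mu]_(t in `]0%R, +oo[)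
    (pi `^ (N%:R / 2) * (t `^ (N%:R / 2 + s - 1) * (t `^ (- (N%:R / 2)) - (1 + t) `^ (- (N%:R / 2)))))%:E)%E); last first.
  apply: eq_integral => t; rewrite inE/= in_itv/= andbT => t0.
  transitivity (\int[L]_z (t `^ (N%:R / 2 + s - 1) * ((1 - expR (- enorm z ^+ 2)) * expR (- (t * enorm z ^+ 2))))%:E)%E.
    by apply: eq_integral => z _; congr EFin; rewrite /f/=; ring.
  rewrite ge0_integralZl_real//.
  - by rewrite integral_gauss_diff// -EFinM; congr EFin; ring.
  - by mfun.
  - by move=> z _; rewrite mulr_ge0.
pose g t := t `^ (N%:R / 2 + s - 1) * (t `^ (- (N%:R / 2)) - (1 + t) `^ (- (N%:R / 2))) : R.
have g0 t : 0 < t -> 0 <= g t.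
  move=> t0; rewrite mulr_ge0// subr_ge0 !powRN lef_pV2 ?posrE ?powR_gt0 ?addr_gt0//.
  by apply: ge0_ler_powR; [rewrite divr_ge0|rewrite nnegrE ltW|rewrite nnegrE addr_ge0 // ltW|rewrite lerDr].
have mg (D : set (measurableTypeR R)) : measurable_fun D g by apply: measurable_funTS; rewrite /g; mfun.
rewrite ge0_integralZl_real//; last by move=> t; rewrite /= in_itv/= andbT; exact: g0.
rewrite lte_mul_pinfty ?lee_fin//.
have -> : `]0%R, +oo[%classic = `]0%R, 1] `|` `]1%R, +oo[ :> set R.
  apply/seteqP; split=> x /=; rewrite !in_itv/= ?andbT.
    by move=> x0; case: (leP x 1) => x1; [left; rewrite x0|right].
  by case=> [/andP[//]|]; apply: lt_trans.
rewrite ge0_integral_setU//=; last 3 first.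
- by apply: measEFin; exact: mg.
- move=> x; rewrite !in_itv/= andbT => -[/andP[x0 _]|x1]; rewrite lee_fin g0//.
  exact: lt_trans x1.
- rewrite disj_set2E; apply/eqP/seteqP; split => // x [] /=; rewrite !in_itv/= andbT.
  by move=> /andP[_ x1] /(le_lt_trans x1); rewrite ltxx.
apply: lte_add_pinfty.
  apply: le_lt_trans (integral_powR01_lty s0).
  apply: ge0_le_integral => //.
  - by move=> x/=; rewrite in_itv/= => /andP[x0 _]; rewrite lee_fin g0.
  - by apply: measEFin; exact: mg.
  - by mfun.
  - move=> x /=; rewrite in_itv/= => /andP[x0 _]; rewrite lee_fin.
    apply: (@le_trans _ _ (x `^ (N%:R / 2 + s - 1) * x `^ (- (N%:R / 2)))).
      by rewrite ler_wpM2l// gerBl.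
    by rewrite -gt0_powRD// (_ : N%:R / 2 + s - 1 - N%:R / 2 = s - 1)//; ring.
apply: (@le_lt_trans _ _ (\int[mu]_(t in `]1%R, +oo[) (N%:R * (t `^ (- (1 - s) - 1)))%:E)%E).
  apply: ge0_le_integral => //.
  - by move=> x/=; rewrite in_itv/= andbT => x1; rewrite lee_fin g0// (lt_trans _ x1).
  - by apply: measEFin; exact: mg.
  - by mfun.
  - move=> x /=; rewrite in_itv/= andbT => x1; rewrite lee_fin.
    have x0 : 0 < x by exact: lt_trans x1.
    apply: le_trans (ler_wpM2l (powR_ge0 _ _) (powR_ratio_le x0)) _.
    rewrite le_eqVlt; apply/orP; left; apply/eqP.
    rewrite -(@powR_inv1 _ x) ?ltW //.
    rewrite (_ : forall a b c d : R, a * (b * c * d) = b * (a * c * d)); last by move=> *; ring.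
    rewrite -!gt0_powRD //.
    by congr (_ * _ `^ _); ring.
rewrite ge0_integralZl_real//; last by mfun.
by rewrite integral_powR_tail ?subr_gt0// -EFinM ltry.
Qed.

Definition min1sqr z : R := Num.min 1 (enorm z ^+ 2).

Lemma min1sqr_ge0 z : 0 <= min1sqr z.
Proof. by rewrite /min1sqr le_min ler01 sqr_ge0. Qed.

Lemma measurable_min1sqr d (T : measurableType d) (D : set T) (f : T -> 'rV[R]_N) :
  measurable_fun D f -> measurable_fun D (fun x => min1sqr (f x)).
Proof.
move=> mf; apply: measurable_minr; first exact: measurable_cst.
by apply: measX; exact: measurable_enorm.
Qed.

Lemma riesz_min1sqr_lty s : 0 < s < 1 -> (\int[L]_z (min1sqr z * riesz s z)%:E < +oo)%E.
Proof.
move=> s01.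
have mr : measurable_fun setT (riesz s) by apply: measurable_riesz; exact: measurable_id.
have men : measurable_fun setT (fun z : 'rV[R]_N => enorm z).
  by apply: measurable_enorm; exact: measurable_id.
have mm : measurable_fun setT min1sqr by apply: measurable_min1sqr; exact: measurable_id.
have e1 (z : 'rV[R]_N) : 0 <= 1 - expR (- enorm z ^+ 2).
  by rewrite subr_ge0 -expR0 ler_expR oppr_le0 sqr_ge0.
apply: (@le_lt_trans _ _ (\int[L]_z (2 * ((1 - expR (- enorm z ^+ 2)) * riesz s z))%:E)%E).
  apply: ge0_le_integral => //.
  - by move=> z _; rewrite lee_fin mulr_ge0 ?min1sqr_ge0 ?riesz_ge0.
  - by mfun.
  - by mfun.
  - move=> z _; rewrite lee_fin mulrA ler_wpM2r ?riesz_ge0//.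
    set q := enorm z ^+ 2; have q0 : 0 <= q by exact: sqr_ge0.
    have q1 : 0 < 1 + q by rewrite ltr_pwDl.
    have : expR (- q) <= (1 + q)^-1.
      by rewrite expRN lef_pV2 ?posrE ?expR_gt0// expR_ge1Dx.
    have : (1 + q)^-1 <= 1 - min1sqr z / 2.
      rewrite -[leLHS]mul1r ler_pdivrMr// /min1sqr -/q.
      case: (leP 1 q) => h; nra.
    lra.
rewrite ge0_integralZl_real//.
- by rewrite lte_mul_pinfty ?lee_fin// riesz_gauss_lty.
- by mfun.
- by move=> z _; rewrite mulr_ge0 ?riesz_ge0.
Qed.

(** Hoelder continuity of the fractional Laplacian comes from interpolating
    between the bound of a second difference by |z|^2 and its modulus of
    continuity in x; the kernel that results is controlled by the kernels of
    orders s and s + e. *)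
Lemma riesz_interp s (e : R) z : 0 < e -> 0 < s ->
  min1sqr z `^ (1 - e) * riesz s z <= min1sqr z * (riesz (s + e) z + riesz s z).
Proof.
move=> e0 s0; rewrite mulrDr.
have [->|z0] := eqVneq z 0.
  rewrite /riesz enorm0 !powR0 ?mulr0 ?addr0//; rewrite oppr_eq0 gt_eqF// ltr_wpDl// mulr_gt0//.
  by rewrite addr_gt0.
have nz := enorm_gt0 z0.
rewrite /min1sqr; case: (leP 1 (enorm z ^+ 2)) => h.
  by rewrite powR1 !mul1r lerDr riesz_ge0.
rewrite -[leLHS]addr0; apply: lerD; last by rewrite mulr_ge0 ?riesz_ge0 ?sqr_ge0.
rewrite /riesz -(powR_mulrn _ (enorm_ge0 z)) -powRrM -!gt0_powRD//.
by rewrite le_eqVlt; apply/orP; left; apply/eqP; congr powR; ring.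
Qed.

End kernel.

(** * Gaussian averages of a power *)

Section fubini_restricted.
Context d1 d2 (T1 : measurableType d1) (T2 : measurableType d2) (R : realType).
Variables (m1 : {sigma_finite_measure set T1 -> \bar R}).
Variables (m2 : {sigma_finite_measure set T2 -> \bar R}).
Local Open Scope ereal_scope.

Lemma integrable_setX (A : set T1) (B : set T2) (f : T1 * T2 -> \bar R) :
  measurable A -> measurable B -> measurable_fun (A `*` B) f ->
  \int[m1]_(x in A) \int[m2]_(y in B) `|f (x, y)| < +oo ->
  (m1 \x m2).-integrable setT (f \_ (A `*` B)).
Proof.
move=> mA mB mf foo; apply/integrable12ltyP.
  by apply/(measurable_restrictT f (measurableX mA mB)).
move: foo; rewrite (@integral_setX_patch _ _ _ _ _ m1 m2 A B (fun z => `|f z|)).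
apply: le_lt_trans; rewrite le_eqVlt; apply/orP; left; apply/eqP.
apply: eq_integral => x _; apply: eq_integral => y _.
by rewrite !patchE; case: ifPn => // _; rewrite abse0.
Qed.

Lemma fubini_setX (A : set T1) (B : set T2) (f : T1 * T2 -> \bar R) :
  measurable A -> measurable B -> measurable_fun (A `*` B) f ->
  \int[m1]_(x in A) \int[m2]_(y in B) `|f (x, y)| < +oo ->
  m1.-integrable A (fun x => \int[m2]_(y in B) f (x, y)) /\
  \int[m1]_(x in A) \int[m2]_(y in B) f (x, y) =
  \int[m2]_(y in B) \int[m1]_(x in A) f (x, y).
Proof.
move=> mA mB mf foo.
have intf := integrable_setX mA mB mf foo.
split; last by rewrite integral_setX_patch integral_setX_patch2; exact: Fubini.
apply/(integrable_mkcond _ mA).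
apply: eq_integrable (integrable_fubini_F intf) => // x _.
rewrite patchE; case: ifPn => xA.
  rewrite [RHS]integral_mkcond; apply: eq_integral => y _.
  by rewrite !patchE in_setX xA.
apply: integral0_eq => y _.
by rewrite patchE in_setX (negbTE xA).
Qed.
End fubini_restricted.

Section heat_power.
Context {R : realType} (N : nat).
Local Notation mu := (@lebesgue_measure R).
Local Notation L := (leb R N).
Variables (s a : R) (x : 'rV[R]_N).
Hypotheses (s01 : 0 < s < 1) (N0 : (0 < N)%N) (a0 : 0 < a) (aN : a < N%:R - 2 * s).
Hypothesis x0 : x != 0.

Let r := enorm x.
Let r0 : 0 < r. Proof. exact: enorm_gt0. Qed.
Let s0 : 0 < s. Proof. by case/andP: s01. Qed.
Let q := a / 2 + s.
Let q0 : 0 < q. Proof. by rewrite addr_gt0// divr_gt0. Qed.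
Let a20 : 0 < a / 2. Proof. by rewrite divr_gt0. Qed.
Let kap := Gamma_integral (1 - s) / s.
Let p := N%:R / 2 + s : R.
Let b := (N%:R - 2 * s - a) / 2.
Let b0 : 0 < b. Proof. by rewrite divr_gt0// subr_gt0. Qed.

(** Up to normalisation, the value at x of the heat flow of the power |y|^-a at
    time 1/(4t). *)
Definition heat_avg (t : R) : \bar R :=
  (\int[L]_y (enorm y `^ (- a) * expR (- (t * enorm (x - y) ^+ 2)))%:E)%E.

Let P1 (t c : R) := t `^ (q - 1) * (c `^ (a / 2 - 1) * expR (- (t * r ^+ 2 * c))).
Let P2 (t c : R) := t `^ (q - 1) * (c `^ (a / 2 - 1) *
  ((1 + c) `^ (- (N%:R / 2)) * expR (- (t * r ^+ 2 * c * (1 + c) `^ (-1))))).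

Let P1_ge0 t c : 0 <= P1 t c. Proof. by rewrite !mulr_ge0. Qed.
Let P2_ge0 t c : 0 <= P2 t c. Proof. by rewrite !mulr_ge0. Qed.

Let integral_P1 t : 0 < t ->
  (\int[mu]_(c in `]0%R, +oo[) (P1 t c)%:E =
   (Gamma_integral (a / 2) * t `^ (s - 1) * r `^ (- a))%:E)%E.
Proof.
move=> t0; rewrite ge0_integralZl_real//; last 2 first.
- by mfun.
- by move=> c _; rewrite mulr_ge0.
rewrite integral_gamma_scale ?mulr_gt0 ?exprn_gt0// -EFinM; congr EFin.
rewrite powRM ?ltW ?exprn_gt0// -powR_mulrn ?ltW// -powRrM.
have -> : 2 * - (a / 2) = - a by field.
have -> : t `^ (s - 1) = t `^ (q - 1) * t `^ (- (a / 2)).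
  by rewrite -gt0_powRD//; congr powR; rewrite /q; ring.
by ring.
Qed.

Let heat_avgE t : 0 < t ->
  ((Gamma_integral (a / 2) * t `^ (p - 1))%:E * heat_avg t =
   (pi `^ (N%:R / 2))%:E * \int[mu]_(c in `]0%R, +oo[) (P2 t c)%:E)%E.
Proof.
move=> t0.
have G0 := Gamma_integral_gt0 a20.
pose f (z : 'rV[R]_N * measurableTypeR R) := expR (- (t * enorm (x - z.1) ^+ 2)) *
  (z.2 `^ (a / 2 - 1) * expR (- (enorm z.1 ^+ 2 * t * z.2))).
have me1 (D : set ('rV[R]_N * measurableTypeR R)) : measurable_fun D (fun y => enorm y.1).
  by apply: measurable_enorm; exact: (measurable_funTS measurable_fst).
have me2 (D : set ('rV[R]_N * measurableTypeR R)) : measurable_fun D (fun y => enorm (x - y.1)).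
  apply: measurable_funTS; apply: measurable_enorm; apply: measurable_rVD; first exact: measurable_cst.
  apply: measurable_rVN; exact: measurable_fst.
have me3 (D : set 'rV[R]_N) : measurable_fun D (fun y => enorm y).
  by apply: measurable_enorm; exact: measurable_id.
have me4 (D : set 'rV[R]_N) : measurable_fun D (fun y => enorm (x - y)).
  apply: measurable_funTS; apply: measurable_enorm; apply: measurable_rVD; first exact: measurable_cst.
  by apply: measurable_rVN; exact: measurable_id.
have mf (D : set ('rV[R]_N * measurableTypeR R)) : measurable_fun D f by rewrite /f; mfun.
have f0 z : 0 <= f z by rewrite !mulr_ge0.
have E : ((Gamma_integral (a / 2) * t `^ (- (a / 2)))%:E * heat_avg t =
    \int[L]_y \int[mu]_(c in `]0%R, +oo[) (f (y, c))%:E)%E.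
  have k0 : 0 <= Gamma_integral (a / 2) * t `^ (- (a / 2)).
    by rewrite mulr_ge0//; exact: ltW.
  rewrite /heat_avg -ge0_integralZl_real//; [|by mfun|by move=> y _; rewrite mulr_ge0].
  apply: ae_eq_integral => //.
  - by mfun.
  - apply: (@measurable_tonelli _ _ _ _ _ mu setT `]0, +oo[ (fun z => (f z)%:E)) => //.
      by apply: measEFin; exact: mf.
    by move=> *; rewrite lee_fin.
  exists [set 0]; split.
  - have -> : [set 0] = rV_box 0 (0 : 'rV[R]_N).
      apply/seteqP; split => [y -> i|y h]; first by rewrite !mxE in_itv/= lexx.
      apply/rowP => i; have := h i; rewrite !mxE in_itv/= => h'.
      by apply/eqP; rewrite eq_le andbC.
    exact: measurable_rV_box.
  - exact: leb_point.
  - move=> y /= /not_implyP[_]; apply: contra_notP => /eqP y0.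
    rewrite /f/= ge0_integralZl_real//; [|by mfun|by move=> c _; rewrite mulr_ge0].
    have ny := enorm_gt0 y0.
    rewrite integral_gamma_scale ?mulr_gt0 ?exprn_gt0// -EFinM; congr EFin.
    rewrite powRM ?ltW ?exprn_gt0// -(powR_mulrn _ (enorm_ge0 y)) -powRrM.
    have -> : 2 * - (a / 2) = - a by field.
    by ring.
have -> : Gamma_integral (a / 2) * t `^ (p - 1) = t `^ (p - 1 + a / 2) * (Gamma_integral (a / 2) * t `^ (- (a / 2))).
  rewrite (@gt0_powRD _ t (p - 1) (a / 2) t0).
  have : t `^ (a / 2) * t `^ (- (a / 2)) = 1 by rewrite -gt0_powRD// subrr powRr0.
  by move=> h; rewrite -[LHS]mulr1 -[X in _ * X = _]h; ring.
rewrite EFinM -muleA E.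
rewrite (@tonelli _ _ _ _ _ L mu setT `]0, +oo[ (fun z => (f z)%:E))//; last 2 first.
- by apply: measEFin; exact: mf.
- by move=> *; rewrite lee_fin.
rewrite [X in (_ * X = _)%E](_ : _ = \int[mu]_(c in `]0%R, +oo[) (pi `^ (N%:R / 2) * t `^ (- (p - 1 + a / 2)) * P2 t c)%:E)%E; last first.
  apply: eq_integral => c; rewrite inE/= in_itv/= andbT => c0.
  have c1 : 0 < 1 + c by rewrite addr_gt0.
  transitivity (\int[L]_y (c `^ (a / 2 - 1) * (expR (- ((t * c) * enorm y ^+ 2 + t * enorm (x - y) ^+ 2))))%:E)%E.
    apply: eq_integral => y _; congr EFin; rewrite /f/= opprD expRD.
    by rewrite (_ : enorm y ^+ 2 * t * c = t * c * enorm y ^+ 2); ring.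
  rewrite ge0_integralZl_real//; last by mfun.
  rewrite integral_gauss ?mulr_ge0 ?ltW// -EFinM; congr EFin.
  have -> : t * c + t = t * (1 + c) by ring.
  have -> : t * c * t / (t * (1 + c)) * enorm x ^+ 2 = t * r ^+ 2 * c * (1 + c) `^ (-1).
    by rewrite powR_inv1 ?ltW// -/r; field; rewrite !gt_eqF.
  rewrite powRM ?pi_ge0 ?invr_ge0 ?mulr_ge0 ?ltW//.
  rewrite -(@powR_inv1 _ (t * (1 + c))) ?mulr_ge0 ?ltW// -powRrM mulN1r powRM ?ltW//.
  rewrite /P2.
  have -> : t `^ (- (N%:R / 2)) = t `^ (- (p - 1 + a / 2)) * t `^ (q - 1).
    by rewrite -gt0_powRD//; congr powR; rewrite /p/q; ring.
  by ring.
have m2 (D : set R) : measurable_fun D (P2 t) by apply: measurable_funTS; rewrite /P2; mfun.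
rewrite ge0_integralZl_real//; [|exact: m2|by rewrite mulr_ge0].
rewrite muleA -EFinM mulrCA -gt0_powRD// subrr powRr0 mulr1.
by [].
Qed.

Let integral_P2_lty t : 0 < t -> (\int[mu]_(c in `]0%R, +oo[) (P2 t c)%:E < +oo)%E.
Proof.
move=> t0.
have m2 (D : set R) : measurable_fun D (P2 t).
  by apply: measurable_funTS; rewrite /P2; mfun.
pose g c := c `^ (a / 2 - 1) * (1 + c) `^ (- (N%:R / 2)) : R.
have mg (D : set R) : measurable_fun D g.
  by apply: measurable_funTS; rewrite /g; mfun.
apply: (@le_lt_trans _ _ (\int[mu]_(c in `]0%R, +oo[) (t `^ (q - 1) * g c)%:E)%E).
  apply: ge0_le_integral => //.
  - by move=> c _; rewrite lee_fin P2_ge0.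
  - by apply: measEFin; exact: m2.
  - apply: measEFin; apply: measM; [exact: measurable_cst|exact: mg].
  - move=> c; rewrite /= in_itv/= andbT => c0; rewrite lee_fin /P2 ler_wpM2l//.
    rewrite /g ler_wpM2l// ler_piMr// -expR0 ler_expR oppr_le0.
    by rewrite !mulr_ge0// ?sqr_ge0// ltW.
rewrite ge0_integralZl_real//; last 2 first.
- exact: mg.
- by move=> c _; rewrite mulr_ge0.
rewrite lte_mul_pinfty ?lee_fin//.
have -> : `]0%R, +oo[%classic = `]0%R, 1] `|` `]1%R, +oo[ :> set R.
  apply/seteqP; split=> c /=; rewrite !in_itv/= ?andbT.
    by move=> c0; case: (leP c 1) => c1; [left; rewrite c0|right].
  by case=> [/andP[//]|]; apply: lt_trans.
rewrite ge0_integral_setU//=; last 3 first.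
- by apply: measEFin; exact: mg.
- by move=> c _; rewrite lee_fin mulr_ge0.
- rewrite disj_set2E; apply/eqP/seteqP; split => // c [] /=; rewrite !in_itv/= andbT.
  by move=> /andP[_ c1] /(le_lt_trans c1); rewrite ltxx.
apply: lte_add_pinfty.
  apply: le_lt_trans (integral_powR01_lty a20).
  apply: ge0_le_integral => //.
  - by move=> c _; rewrite lee_fin mulr_ge0.
  - by apply: measEFin; exact: mg.
  - by mfun.
  - move=> c /=; rewrite in_itv/= => /andP[c0 _]; rewrite lee_fin ler_piMr//.
    by rewrite powRN1D_le1// ?ltW// divr_ge0.
have Na : 0 < (N%:R - a) / 2 by rewrite divr_gt0// subr_gt0 (lt_le_trans aN)// gerBl mulr_ge0// ltW.
apply: (@le_lt_trans _ _ (\int[mu]_(c in `]1%R, +oo[) (c `^ (- ((N%:R - a) / 2) - 1))%:E)%E).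
  apply: ge0_le_integral => //.
  - by move=> c _; rewrite lee_fin mulr_ge0.
  - by apply: measEFin; exact: mg.
  - by mfun.
  - move=> c /=; rewrite in_itv/= andbT => c1; rewrite lee_fin.
    have c0 : 0 < c by exact: lt_trans c1.
    apply: (@le_trans _ _ (c `^ (a / 2 - 1) * c `^ (- (N%:R / 2)))).
      rewrite ler_wpM2l// !powRN lef_pV2 ?posrE ?powR_gt0 ?addr_gt0//.
      by apply: ge0_ler_powR; [rewrite divr_ge0|rewrite nnegrE ltW|rewrite nnegrE addr_ge0// ltW|rewrite lerDr].
    rewrite -gt0_powRD// le_eqVlt; apply/orP; left; apply/eqP; congr powR.
    by field.
by rewrite integral_powR_tail// ltry.
Qed.

(** After subordination of |y|^-a the average is a one-dimensional integral,
    convergent at 0 because a > 0 and at infinity because a < N. *)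
Lemma heat_avg_lty t : 0 < t -> (heat_avg t < +oo)%E.
Proof.
move=> t0; have := heat_avgE t0.
have : (\int[mu]_(c in `]0%R, +oo[) (P2 t c)%:E)%E \is a fin_num.
  rewrite ge0_fin_numE ?integral_P2_lty//.
  by apply: integral_ge0 => c _; rewrite lee_fin P2_ge0.
move=> /fineK <-; rewrite -EFinM.
have : 0 < Gamma_integral (a / 2) * t `^ (p - 1) by rewrite mulr_gt0 ?powR_gt0 ?Gamma_integral_gt0.
case: (heat_avg t) => [c||] => h; rewrite ?ltry//.
by rewrite gt0_muley ?lte_fin.
Qed.

Let measurable_P1 (D : set (measurableTypeR R * measurableTypeR R)) :
  measurable_fun D (fun z => P1 z.1 z.2).
Proof. by rewrite /P1; mfun. Qed.

Let measurable_P2 (D : set (measurableTypeR R * measurableTypeR R)) :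
  measurable_fun D (fun z => P2 z.1 z.2).
Proof. by rewrite /P2; mfun. Qed.

Let g c := Gamma_integral q * r `^ (- (2 * q)) * c `^ (- s - 1).
Let g_ge0 c : 0 <= g c.
Proof. by rewrite !mulr_ge0// ltW// Gamma_integral_gt0. Qed.

Let integral_P1t c : 0 < c ->
  (\int[mu]_(t in `]0%R, +oo[) (P1 t c)%:E = (g c)%:E)%E.
Proof.
move=> c0.
have rc : 0 < r ^+ 2 * c by rewrite mulr_gt0// exprn_gt0.
transitivity (\int[mu]_(t in `]0%R, +oo[) (c `^ (a / 2 - 1) * (t `^ (q - 1) * expR (- ((r ^+ 2 * c) * t))))%:E)%E.
  apply: eq_integral => t _; congr EFin; rewrite /P1.
  by rewrite (_ : t * r ^+ 2 * c = r ^+ 2 * c * t); ring.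
rewrite ge0_integralZl_real//; [|by mfun|by move=> t _; rewrite mulr_ge0].
rewrite integral_gamma_scale// -EFinM; congr EFin.
rewrite powRM ?sqr_ge0 ?ltW// -(powR_mulrn _ (ltW r0)) -powRrM mulrN /g.
have -> : c `^ (- s - 1) = c `^ (a / 2 - 1) * c `^ (- q).
  by rewrite -gt0_powRD//; congr powR; rewrite /q; ring.
by ring.
Qed.

Let integral_P2t c : 0 < c ->
  (\int[mu]_(t in `]0%R, +oo[) (P2 t c)%:E = (g c * (1 + c) `^ (- b))%:E)%E.
Proof.
move=> c0.
have c1 : 0 < 1 + c by rewrite addr_gt0.
have rc : 0 < r ^+ 2 * c * (1 + c) `^ (-1) by rewrite !mulr_gt0 ?powR_gt0// exprn_gt0.
transitivity (\int[mu]_(t in `]0%R, +oo[) ((c `^ (a / 2 - 1) * (1 + c) `^ (- (N%:R / 2))) * (t `^ (q - 1) * expR (- ((r ^+ 2 * c * (1 + c) `^ (-1)) * t))))%:E)%E.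
  apply: eq_integral => t _; congr EFin; rewrite /P2.
  by rewrite (_ : t * r ^+ 2 * c * (1 + c) `^ (-1) = r ^+ 2 * c * (1 + c) `^ (-1) * t); ring.
rewrite ge0_integralZl_real//; [|by mfun|by move=> t _; rewrite mulr_ge0|by rewrite mulr_ge0].
rewrite integral_gamma_scale// -EFinM; congr EFin.
rewrite (@powRM _ (r ^+ 2 * c)) ?powR_ge0 //; last by rewrite mulr_ge0 ?sqr_ge0 ?(ltW c0).
rewrite (@powRM _ (r ^+ 2)) ?sqr_ge0 ?(ltW c0) //.
rewrite -(powR_mulrn _ (ltW r0)) -!powRrM mulrN /g.
have -> : c `^ (- s - 1) = c `^ (a / 2 - 1) * c `^ (- q).
  by rewrite -gt0_powRD//; congr powR; rewrite /q; ring.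
have -> : (1 + c) `^ (- b) = (1 + c) `^ (- (N%:R / 2)) * (1 + c) `^ (-1 * - q).
  by rewrite -gt0_powRD//; congr powR; rewrite /b /q; field.
by ring.
Qed.

Let D (z : measurableTypeR R * measurableTypeR R) : \bar R := (P1 z.1 z.2 - P2 z.1 z.2)%:E.

Let measurable_D A : measurable_fun A D.
Proof. by apply: measEFin; apply: measB; [exact: measurable_P1|exact: measurable_P2]. Qed.

(* P1 + P2 - 2 theta P1 with theta = (1+c)^(-N/2), which dominates |P1 - P2|
   because P2 is theta times a larger exponential than that of P1. *)
Let U t c := P1 t c + P2 t c - 2 * (1 + c) `^ (- (N%:R / 2)) * P1 t c.

Let D_le_U t c : 0 < t -> 0 < c -> `|P1 t c - P2 t c| <= U t c.
Proof.
move=> t0 c0; have c1 : 0 < 1 + c by rewrite addr_gt0.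
rewrite /U /P1 /P2.
set A := t `^ _; set B := c `^ _; set th := (1 + c) `^ (- _).
set e1 := expR _; set e2 := expR _.
have e12 : e1 <= e2.
  rewrite ler_expR lerN2 ler_piMr ?mulr_ge0 ?(ltW r0) ?(ltW t0) ?(ltW c0) //.
  by apply: powRN1D_le1 => //; exact: ltW.
have th1 : th <= 1 by rewrite powRN1D_le1// ?divr_ge0// ltW.
have th0 : 0 <= th by exact: powR_ge0.
have e10 : 0 <= e1 by exact: expR_ge0.
have AB0 : 0 <= A * B by apply: mulr_ge0; exact: powR_ge0.
have -> : A * (B * e1) - A * (B * (th * e2)) = A * B * (e1 - th * e2) by ring.
have -> : A * (B * e1) + A * (B * (th * e2)) - 2 * th * (A * (B * e1)) =
  A * B * ((1 - th) * e1 + th * (e2 - e1)) by ring.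
rewrite normrM (ger0_norm AB0) ler_wpM2l//.
have -> : e1 - th * e2 = (1 - th) * e1 - th * (e2 - e1) by ring.
apply: le_trans (ler_normB _ _) _.
by rewrite !ger0_norm ?lexx// mulr_ge0// subr_ge0.
Qed.

Let integral_U c : 0 < c ->
  (\int[mu]_(t in `]0%R, +oo[) (U t c)%:E <=
   (2 * Gamma_integral q * r `^ (- (2 * q)) * (c `^ (- s - 1) * (1 - (1 + c) `^ (- (N%:R / 2)))))%:E)%E.
Proof.
move=> c0; have c1 : 0 < 1 + c by rewrite addr_gt0.
have mU : measurable_fun (`]0, +oo[ : set (measurableTypeR R)) (U ^~ c).
  by rewrite /U /P1 /P2; mfun.
have m1 : measurable_fun (`]0, +oo[ : set (measurableTypeR R)) (P1 ^~ c).
  by rewrite /P1; mfun.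
have m2 : measurable_fun (`]0, +oo[ : set (measurableTypeR R)) (P2 ^~ c).
  by rewrite /P2; mfun.
have U0 t : 0 < t -> 0 <= U t c by move=> t0; exact: le_trans (D_le_U t0 c0).
have I0 : (0 <= \int[mu]_(t in `]0%R, +oo[) (U t c)%:E)%E.
  by apply: integral_ge0 => t; rewrite /= in_itv/= andbT => t0; rewrite lee_fin U0.
have : (\int[mu]_(t in `]0%R, +oo[) (U t c)%:E +
  \int[mu]_(t in `]0%R, +oo[) (2 * (1 + c) `^ (- (N%:R / 2)) * P1 t c)%:E =
  \int[mu]_(t in `]0%R, +oo[) (P1 t c)%:E + \int[mu]_(t in `]0%R, +oo[) (P2 t c)%:E)%E.
  transitivity (\int[mu]_(t in `]0%R, +oo[) ((U t c)%:E + (2 * (1 + c) `^ (- (N%:R / 2)) * P1 t c)%:E))%E.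
    apply/esym; apply: ge0_integralD; first exact: measurable_itv.
    - by move=> t; rewrite /= in_itv/= andbT => t0; rewrite lee_fin U0.
    - exact: measEFin.
    - by move=> t _; rewrite lee_fin; do 2 apply: mulr_ge0 => //.
    - by apply: measEFin; apply: measM => //; exact: measurable_cst.
  transitivity (\int[mu]_(t in `]0%R, +oo[) ((P1 t c)%:E + (P2 t c)%:E))%E; last first.
    apply: ge0_integralD; first exact: measurable_itv.
    - by move=> t _; rewrite lee_fin P1_ge0.
    - exact: measEFin.
    - by move=> t _; rewrite lee_fin P2_ge0.
    - exact: measEFin.
  by apply: eq_integral => t _; rewrite -!EFinD /U subrK.
rewrite ge0_integralZl_real; [|exact: measurable_itv|by []|by move=> t _; exact: P1_ge0|by rewrite mulr_ge0].
rewrite integral_P1t// integral_P2t// -EFinM -EFinD.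
case: (\int[mu]_(t in `]0%R, +oo[) (U t c)%:E)%E I0 => [u _| |]//.
rewrite -EFinD => -[E]; rewrite lee_fin.
have -> : u = g c + g c * (1 + c) `^ (- b) - 2 * (1 + c) `^ (- (N%:R / 2)) * g c.
  by rewrite -E addrK.
have h : g c * (1 + c) `^ (- b) <= g c by rewrite ler_piMr// powRN1D_le1// ltW.
have -> : 2 * Gamma_integral q * r `^ (- (2 * q)) * (c `^ (- s - 1) * (1 - (1 + c) `^ (- (N%:R / 2)))) = 2 * g c * (1 - (1 + c) `^ (- (N%:R / 2))).
  by rewrite /g; ring.
by move: h; move: (g c) ((1 + c) `^ (- b)) ((1 + c) `^ (- (N%:R / 2))) => A B C; lra.
Qed.

Let integral_abs_D : (\int[mu]_(t in `]0%R, +oo[) \int[mu]_(c in `]0%R, +oo[) `|D (t, c)| < +oo)%E.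
Proof.
have mabs A : measurable_fun A (fun z => `|D z|)%E.
  by apply: measurableT_comp => //; exact: measurable_D.
rewrite (@tonelli _ _ _ _ _ mu mu `]0, +oo[ `]0, +oo[ (fun z => `|D z|)%E)//.
have G0 : 0 < Gamma_integral q by exact: Gamma_integral_gt0.
apply: (@le_lt_trans _ _ (\int[mu]_(c in `]0%R, +oo[) (2 * Gamma_integral q * r `^ (- (2 * q)) * (c `^ (- s - 1) * (1 - (1 + c) `^ (- (N%:R / 2)))))%:E)%E).
  apply: ge0_le_integral => //.
  - by move=> c _; apply: integral_ge0 => t _; exact: abse_ge0.
  - by apply: (@measurable_tonelli2 _ _ _ (measurableTypeR R) _ mu `]0, +oo[ `]0, +oo[ (fun z => `|D z|)%E).
  - by mfun.
  - move=> c; rewrite /= in_itv/= andbT => c0; apply: le_trans (integral_U c0).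
    apply: ge0_le_integral => //.
    + have mDc : measurable_fun (`]0, +oo[ : set (measurableTypeR R)) (fun t => D (t, c)).
        by rewrite /D /P1 /P2/=; mfun.
      exact: (measurableT_comp (@abse_measurable R setT) mDc).
    + by apply: measEFin; rewrite /U /P1 /P2; mfun.
    + by move=> t; rewrite /= in_itv/= andbT => t0; rewrite lee_fin D_le_U.
rewrite ge0_integralZl_real//.
- by rewrite integral_beta// ?divr_gt0 ?ltr0n// -EFinM ltry.
- by mfun.
- move=> c; rewrite /= in_itv/= andbT => c0; rewrite mulr_ge0// subr_ge0.
  by rewrite powRN1D_le1 ?divr_ge0// ltW.
- by rewrite !mulr_ge0// ltW.
Qed.

(** The contribution of the Gaussian with parameter t to the fractional
    Laplacian of |y|^-a at x. *)
Definition heat_deficit (t : R) : R :=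
  t `^ (p - 1) * (r `^ (- a) * (pi / t) `^ (N%:R / 2) - fine (heat_avg t)).

Opaque heat_avg.
Let heat_deficitE t : 0 < t ->
  (\int[mu]_(c in `]0%R, +oo[) D (t, c) =
   (pi `^ (- (N%:R / 2)) * Gamma_integral (a / 2) * heat_deficit t)%:E)%E.
Proof.
move=> t0.
have m1 : measurable_fun (`]0, +oo[ : set (measurableTypeR R)) (P1 t).
  by rewrite /P1; mfun.
have m2 : measurable_fun (`]0, +oo[ : set (measurableTypeR R)) (P2 t).
  by rewrite /P2; mfun.
have h2 := integral_P2_lty t0.
have E2 := heat_avgE t0.
have h3 := heat_avg_lty t0.
have h4 : (0 <= heat_avg t)%E by apply: integral_ge0 => y _; rewrite lee_fin mulr_ge0.
have i1 : mu.-integrable `]0, +oo[ (EFin \o P1 t).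
  apply/integrableP; split; first exact: measEFin.
  under eq_integral do rewrite /= ger0_norm ?P1_ge0//.
  by rewrite integral_P1// ltry.
have i2 : mu.-integrable `]0, +oo[ (EFin \o P2 t).
  apply/integrableP; split; first exact: measEFin.
  by under eq_integral do rewrite /= ger0_norm ?P2_ge0//.
rewrite /D/= integralB_EFin// integral_P1//.
have : (0 <= \int[mu]_(c in `]0%R, +oo[) (P2 t c)%:E)%E.
  by apply: integral_ge0 => c _; rewrite lee_fin.
rewrite /heat_deficit.
move: h2 E2; case: (\int[mu]_(c in `]0%R, +oo[) (P2 t c)%:E)%E => [I2 _| |]//.
move: h3 h4; case: (heat_avg t) => [H _ _| |]// + _.
rewrite -!EFinM => -[E2]; rewrite -EFinB; congr EFin => /=.
have -> : I2 = pi `^ (- (N%:R / 2)) * (Gamma_integral (a / 2) * t `^ (p - 1) * H).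
  rewrite E2 mulrA -gt0_powRD ?pi_gt0// addNr powRr0 mul1r//.
have -> : t `^ (s - 1) = pi `^ (- (N%:R / 2)) * (t `^ (p - 1) * (pi / t) `^ (N%:R / 2)).
  rewrite powRM ?pi_ge0 ?invr_ge0 ?ltW// -(@powR_inv1 _ t) ?ltW// -powRrM mulN1r.
  have h1 : pi `^ (- (N%:R / 2)) * pi `^ (N%:R / 2) = 1 :> R.
    by rewrite -gt0_powRD ?pi_gt0// addNr powRr0.
  have -> : t `^ (s - 1) = t `^ (p - 1) * t `^ (- (N%:R / 2)).
    by rewrite -gt0_powRD//; congr powR; rewrite /p; ring.
  by rewrite -[LHS]mul1r -[X in X * _ = _]h1; ring.
by ring.
Qed.

(** The deficit at t is the integral over c of P1 - P2, where P1 and P2 come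
    from subordinating |x|^-a and |y|^-a.  Integrating in t first leaves 1 -
    (1+c)^-b against c^(-s-1), a Beta type integral.  The exchange is
    legitimate because |P1 - P2| is dominated by U, whose iterated integral is
    again of Beta type. *)
Lemma heat_deficit_integral :
  mu.-integrable `]0, +oo[ (EFin \o heat_deficit) /\
  (\int[mu]_(t in `]0%R, +oo[) (heat_deficit t)%:E =
   (pi `^ (N%:R / 2) * kap * (gamma_ratio s (a / 2) * gamma_ratio s b) * r `^ (- a - 2 * s))%:E)%E.
Proof.
have G0 := Gamma_integral_gt0 a20.
pose k := pi `^ (N%:R / 2) / Gamma_integral (a / 2) : R.
have kE : k * (pi `^ (- (N%:R / 2)) * Gamma_integral (a / 2)) = 1.
  have h1 : pi `^ (N%:R / 2) * pi `^ (- (N%:R / 2)) = 1 :> R.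
    by rewrite -gt0_powRD ?pi_gt0// addrN powRr0.
  have h2 : (Gamma_integral (a / 2))^-1 * Gamma_integral (a / 2) = 1.
    by apply: mulVf; rewrite (gt_eqF G0).
  by rewrite /k mulrACA h1 h2 mulr1.
have [] := @fubini_setX _ _ (measurableTypeR R) (measurableTypeR R) R mu mu `]0, +oo[ `]0, +oo[ D (measurable_itv _) (measurable_itv _) (@measurable_D _) integral_abs_D => iD ED.
have eqD : {in `]0%R, +oo[%classic, (fun t : R => \int[mu]_(c in `]0%R, +oo[) D (t, c))%E =1
    (fun t => (pi `^ (- (N%:R / 2)) * Gamma_integral (a / 2))%:E * (heat_deficit t)%:E)%E}.
  by move=> t; rewrite inE/= in_itv/= andbT => t0; rewrite heat_deficitE// EFinM.
have iD2 : mu.-integrable `]0, +oo[ (fun t => (pi `^ (- (N%:R / 2)) * Gamma_integral (a / 2))%:E * (heat_deficit t)%:E)%E.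
  by apply: eq_integrable iD => //.
have mpos : measurable (`]0, +oo[%classic : set (measurableTypeR R)) by exact: measurable_itv.
have eqH t : ((heat_deficit t)%:E = k%:E * ((pi `^ (- (N%:R / 2)) * Gamma_integral (a / 2))%:E * (heat_deficit t)%:E))%E.
  by rewrite -!EFinM mulrA kE mul1r.
have iH : mu.-integrable `]0, +oo[ (EFin \o heat_deficit).
  have h := integrableZl mpos k iD2.
  apply: (@eq_integrable _ _ _ _ _ mpos _ _ _ h) => t _.
  exact: (esym (eqH t)).
split; first exact: iH.
have -> : (\int[mu]_(t in `]0%R, +oo[) (heat_deficit t)%:E =
    k%:E * \int[mu]_(t in `]0%R, +oo[) \int[mu]_(c in `]0%R, +oo[) D (t, c))%E.
  transitivity (k%:E * \int[mu]_(t in `]0%R, +oo[) ((pi `^ (- (N%:R / 2)) * Gamma_integral (a / 2))%:E * (heat_deficit t)%:E))%E.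
    rewrite -(integralZl mpos iD2); apply: eq_integral => t _; exact: eqH.
  by congr (_ * _)%E; apply/esym; apply: eq_integral.
rewrite ED; clear ED iD eqD iD2 iH eqH.
have -> : (\int[mu]_(c in `]0%R, +oo[) \int[mu]_(t in `]0%R, +oo[) D (t, c) =
  \int[mu]_(c in `]0%R, +oo[) ((Gamma_integral q * r `^ (- (2 * q))) * (c `^ (- s - 1) * (1 - (1 + c) `^ (- b))))%:E)%E.
  apply: eq_integral => c; rewrite inE/= in_itv/= andbT => c0.
  have m1 : measurable_fun (`]0, +oo[ : set (measurableTypeR R)) (P1 ^~ c).
    by rewrite /P1; mfun.
  have m2 : measurable_fun (`]0, +oo[ : set (measurableTypeR R)) (P2 ^~ c).
    by rewrite /P2; mfun.
  rewrite /D/= integralB_EFin//.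
  - by rewrite integral_P1t// integral_P2t// -EFinB /g; congr EFin; ring.
  - apply/integrableP; split; first exact: measEFin.
    under eq_integral do rewrite /= ger0_norm ?P1_ge0//.
    by rewrite integral_P1t// ltry.
  - apply/integrableP; split; first exact: measEFin.
    under eq_integral do rewrite /= ger0_norm ?P2_ge0//.
    by rewrite integral_P2t// ltry.
have Gq := Gamma_integral_gt0 q0.
rewrite ge0_integralZl_real//; last 3 first.
- by mfun.
- move=> c; rewrite /= in_itv/= andbT => c0; rewrite mulr_ge0// subr_ge0.
  by rewrite powRN1D_le1// ltW.
- by rewrite mulr_ge0// ltW.
rewrite integral_beta// -!EFinM; congr EFin.
rewrite /k /gamma_ratio -/kap -/q.
have -> : - a - 2 * s = - (2 * q) by rewrite /q; field.
by ring.
Qed.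

End heat_power.

(** * The second-difference integral of a bump function *)

Section signed_leb.
Context {R : realType} (N : nat).
Local Notation L := (leb R N).
Implicit Types (f : 'rV[R]_N -> \bar R).

Lemma integral_leb_shift h f : measurable_fun setT f ->
  (\int[L]_x f (x + h)%R = \int[L]_x f x)%E.
Proof.
move=> mf; rewrite integralE [RHS]integralE; congr (_ - _)%E.
  transitivity (\int[L]_x (f ^\+)%E (x + h)%R)%E; first by apply: eq_integral => x _; rewrite ?funeposE ?funenegE.
  by apply: (@ge0_leb_shift R N h (f ^\+)%E); [exact: measurable_funepos|move=> x].
transitivity (\int[L]_x (f ^\-)%E (x + h)%R)%E; first by apply: eq_integral => x _; rewrite ?funeposE ?funenegE.
  by apply: (@ge0_leb_shift R N h (f ^\-)%E); [exact: measurable_funeneg|move=> x].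
Qed.

Lemma integral_leb_opp f : measurable_fun setT f ->
  (\int[L]_x f (- x)%R = \int[L]_x f x)%E.
Proof.
move=> mf; rewrite integralE [RHS]integralE; congr (_ - _)%E.
  transitivity (\int[L]_x (f ^\+)%E (- x)%R)%E; first by apply: eq_integral => x _; rewrite ?funeposE ?funenegE.
  by apply: (@ge0_leb_opp R N (f ^\+)%E); [exact: measurable_funepos|move=> x].
transitivity (\int[L]_x (f ^\-)%E (- x)%R)%E; first by apply: eq_integral => x _; rewrite ?funeposE ?funenegE.
  by apply: (@ge0_leb_opp R N (f ^\-)%E); [exact: measurable_funeneg|move=> x].
Qed.
End signed_leb.

Section dominated_integral.
Context d (T : measurableType d) (R : realType) (m : {measure set T -> \bar R}).
Implicit Types f g : T -> R.

Lemma integrable_dominated f g : measurable_fun setT f -> measurable_fun setT g ->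
  (forall x, `|f x| <= g x) -> (\int[m]_x (g x)%:E < +oo)%E ->
  m.-integrable setT (EFin \o f).
Proof.
move=> mf mg fg goo; apply/integrableP; split; first exact: measEFin.
apply: le_lt_trans goo; apply: ge0_le_integral => //.
- by apply: measurableT_comp => //; exact: measEFin.
- exact: measEFin.
- by move=> x _; rewrite /= lee_fin.
Qed.

Lemma normr_Rintegral_dominated f g : measurable_fun setT f -> measurable_fun setT g ->
  (forall x, `|f x| <= g x) -> (\int[m]_x (g x)%:E < +oo)%E ->
  `|\int[m]_x f x| <= fine (\int[m]_x (g x)%:E).
Proof.
move=> mf mg fg goo.
have intf := integrable_dominated mf mg fg goo.
have g0 x : 0 <= g x by exact: le_trans (fg x).
have intg : m.-integrable setT (EFin \o g).
  by apply: (integrable_dominated mg mg _ goo) => x; rewrite ger0_norm.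
apply: (le_trans (le_normr_Rintegral _ _)) => //.
apply: le_Rintegral => //.
exact: integrable_norm.
Qed.
End dominated_integral.

Section bump.
Context {R : realType} (N : nat).
Local Notation L := (leb R N).
Implicit Types (s e : R) (x y z : 'rV[R]_N).

Definition kernel_mass s : R := fine (\int[L]_z (min1sqr z * riesz s z)%:E).

Lemma min1riesz_ge0 s z : 0 <= min1sqr z * riesz s z.
Proof. by rewrite mulr_ge0 ?min1sqr_ge0 ?riesz_ge0. Qed.

Lemma kernel_massE s : 0 < s < 1 ->
  (\int[L]_z (min1sqr z * riesz s z)%:E = (kernel_mass s)%:E)%E.
Proof.
move=> s01; rewrite /kernel_mass fineK// ge0_fin_numE ?riesz_min1sqr_lty//.
by apply: integral_ge0 => z _; rewrite lee_fin mulr_ge0 ?min1sqr_ge0 ?riesz_ge0.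
Qed.

Lemma measurable_min1riesz s (k : R) :
  measurable_fun setT (fun z : 'rV[R]_N => k * (min1sqr z * riesz s z)).
Proof.
apply: measM; first exact: measurable_cst.
apply: measM; first by apply: measurable_min1sqr; exact: measurable_id.
by apply: measurable_riesz; exact: measurable_id.
Qed.

Lemma integral_min1riesz s k : 0 < s < 1 -> 0 <= k ->
  (\int[L]_z (k * (min1sqr z * riesz s z))%:E = (k * kernel_mass s)%:E)%E.
Proof.
move=> s01 k0; rewrite ge0_integralZl_real//.
- by rewrite kernel_massE.
- have := measurable_min1riesz s 1; by under eq_fun do rewrite mul1r.
- by move=> z _; rewrite mulr_ge0 ?min1sqr_ge0 ?riesz_ge0.
Qed.

Variables (psi : 'rV[R]_N -> R) (M : R).
Hypotheses (M0 : 0 <= M) (mpsi : measurable_fun setT psi).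
Hypothesis psiM : forall x, `|psi x| <= M.
Hypothesis psiL : forall x y, `|psi x - psi y| <= M * enorm (x - y).
Hypothesis psi2 : forall x z, `|psi (x + z) + psi (x - z) - 2 * psi x| <= M * enorm z ^+ 2.

(** Minus half of the second difference: the symmetrised increment, of order
    |z|^2 at the origin. *)
Definition sdiff x z : R := (2 * psi x - psi (x + z) - psi (x - z)) / 2.

Lemma measurable_psiD d (T : measurableType d) (f g : T -> 'rV[R]_N) :
  measurable_fun setT f -> measurable_fun setT g ->
  measurable_fun setT (fun w => psi (f w + g w)).
Proof. by move=> mf mg; apply: (measurableT_comp mpsi); exact: measurable_rVD. Qed.

Lemma measurable_sdiff x : measurable_fun setT (sdiff x).
Proof.
rewrite /sdiff; apply: measM; last exact: measurable_cst.
apply: measB; first (apply: measB; first exact: measurable_cst).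
  by apply: measurable_psiD; [exact: measurable_cst|exact: measurable_id].
apply: measurable_psiD; [exact: measurable_cst|].
by apply: measurable_rVN; exact: measurable_id.
Qed.

Lemma sdiff_le x z : `|sdiff x z| <= 2 * M * min1sqr z.
Proof.
have h1 : `|sdiff x z| <= 2 * M.
  have := psiM x; have := psiM (x + z); have := psiM (x - z).
  rewrite /sdiff !ler_norml => /andP[? ?] /andP[? ?] /andP[? ?].
  by apply/andP; split; lra.
have h2 : `|sdiff x z| <= 2 * M * enorm z ^+ 2.
  have := psi2 x z; have := mulr_ge0 M0 (sqr_ge0 (enorm z)).
  rewrite /sdiff !ler_norml => ? /andP[? ?].
  by apply/andP; split; lra.
by rewrite /min1sqr; case: (leP 1 (enorm z ^+ 2)) => _; rewrite ?mulr1.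
Qed.

Lemma sdiffB_le x y z : `|sdiff x z - sdiff y z| <= 2 * M * enorm (x - y).
Proof.
have := psiL x y; have := psiL (x + z) (y + z); have := psiL (x - z) (y - z).
rewrite !opprD !addrA.
have -> : x - z - y + - - z = x - y by rewrite opprK -addrA [- y + z]addrC addrA subrK.
have -> : x + z - y - z = x - y by rewrite addrAC addrK.
rewrite /sdiff !ler_norml => /andP[? ?] /andP[? ?] /andP[? ?].
by apply/andP; split; lra.
Qed.

Lemma measurable_sdiff_riesz s x : measurable_fun setT (fun z => sdiff x z * riesz s z).
Proof.
apply: measM; first exact: measurable_sdiff.
by apply: measurable_riesz; exact: measurable_id.
Qed.

Lemma sdiff_riesz_le s x z : `|sdiff x z * riesz s z| <= 2 * M * (min1sqr z * riesz s z).
Proof.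
by rewrite normrM (ger0_norm (riesz_ge0 _ _)) mulrA ler_wpM2r ?riesz_ge0 ?sdiff_le.
Qed.

(** The fractional Laplacian without its normalising constant, as an absolutely
    convergent integral. *)
Definition Lop s x : R := \int[L]_z (sdiff x z * riesz s z).

Lemma integrable_sdiff s x : 0 < s < 1 ->
  L.-integrable setT (EFin \o (fun z => sdiff x z * riesz s z)).
Proof.
move=> s01; apply: (integrable_dominated (g := fun z => 2 * M * (min1sqr z * riesz s z))).
- exact: measurable_sdiff_riesz.
- exact: measurable_min1riesz.
- exact: sdiff_riesz_le.
- by rewrite integral_min1riesz ?mulr_ge0// ltry.
Qed.

Lemma Lop_bounded s x : 0 < s < 1 -> `|Lop s x| <= 2 * M * kernel_mass s.
Proof.
move=> s01; rewrite -[leRHS]/(fine (2 * M * kernel_mass s)%:E).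
rewrite -integral_min1riesz ?mulr_ge0//.
apply: normr_Rintegral_dominated.
- exact: measurable_sdiff_riesz.
- exact: measurable_min1riesz.
- exact: sdiff_riesz_le.
- by rewrite integral_min1riesz ?mulr_ge0// ltry.
Qed.

Lemma powR_min_le (a b t e : R) : 0 <= t -> 0 <= e <= 1 -> t <= a -> t <= b ->
  t <= a `^ e * b `^ (1 - e).
Proof.
move=> t0 /andP[e0 e1] ta tb.
have [->|t'] := eqVneq t 0; first by rewrite mulr_ge0.
have tp : 0 < t by rewrite lt_neqAle eq_sym t' t0.
have -> : t = t `^ e * t `^ (1 - e).
  by rewrite -gt0_powRD// addrC subrK powRr1.
apply: ler_pM => //; apply: ge0_ler_powR; rewrite ?nnegrE ?subr_ge0//.
- exact: le_trans ta.
- exact: le_trans tb.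
Qed.

(** The increment of [sdiff] in x is at most a constant times both |x - y| and
    min(1, |z|^2); the geometric mean of the two bounds is integrable against
    the kernel by [riesz_interp]. *)
Lemma Lop_hoelder s e x y : 0 < s -> 0 < e -> s + e < 1 ->
  `|Lop s x - Lop s y| <=
   2 * M * (kernel_mass (s + e) + kernel_mass s) * 2 * enorm (x - y) `^ e.
Proof.
move=> s0 e0 se1.
have s01 : 0 < s < 1 by rewrite s0 (lt_trans _ se1)// ltrDl.
have se01 : 0 < s + e < 1 by rewrite addr_gt0.
rewrite /Lop -RintegralB//; [|exact: integrable_sdiff|exact: integrable_sdiff].
pose k := 2 * M * 2 * enorm (x - y) `^ e.
have k0 : 0 <= k by rewrite !mulr_ge0.
pose g z := k * (min1sqr z * riesz (s + e) z) + k * (min1sqr z * riesz s z).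
have mg : measurable_fun setT g by apply: measD; exact: measurable_min1riesz.
have gE : (\int[L]_z (g z)%:E = (k * kernel_mass (s + e) + k * kernel_mass s)%:E)%E.
  under eq_integral do rewrite /g EFinD.
  rewrite ge0_integralD//; last 4 first.
  - by move=> z _; rewrite lee_fin; apply: (mulr_ge0 k0); exact: min1riesz_ge0.
  - by apply: measEFin; exact: measurable_min1riesz.
  - by move=> z _; rewrite lee_fin; apply: (mulr_ge0 k0); exact: min1riesz_ge0.
  - by apply: measEFin; exact: measurable_min1riesz.
  by rewrite !integral_min1riesz.
have -> : 2 * M * (kernel_mass (s + e) + kernel_mass s) * 2 * enorm (x - y) `^ e =
   fine (\int[L]_z (g z)%:E).
  by rewrite gE /= /k; ring.
apply: normr_Rintegral_dominated => //.
- by apply: measB; exact: measurable_sdiff_riesz.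
- move=> z; rewrite -mulrBl normrM (ger0_norm (riesz_ge0 _ _)).
  have h : `|sdiff x z - sdiff y z| <= k * min1sqr z `^ (1 - e).
    have [M00|M00] := eqVneq M 0.
      apply: (le_trans (sdiffB_le x y z)); rewrite M00 mulr0 mul0r mulr_ge0//.
    have Mp : 0 < 2 * M * 2 by rewrite !mulr_gt0// lt_neqAle eq_sym M00.
    rewrite /k -mulrA mulrC -ler_pdivrMr//.
    apply: powR_min_le.
    + by rewrite divr_ge0// ltW.
    + by rewrite (ltW e0)/= ltW// (lt_trans _ se1)// ltrDr.
    + rewrite ler_pdivrMr//; apply: (le_trans (sdiffB_le x y z)).
      rewrite mulrC ler_wpM2l ?enorm_ge0//.
      by rewrite ler_peMr ?mulr_ge0// ler1n.
    + rewrite ler_pdivrMr//; apply: (le_trans (ler_normB _ _)).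
      have := sdiff_le x z; have := sdiff_le y z; lra.
  apply: (le_trans (ler_wpM2r (riesz_ge0 _ _) h)).
  by rewrite /g -mulrDr -mulrDr -mulrA ler_wpM2l// riesz_interp.
- by rewrite gE ltry.
Qed.

End bump.

(** * Convergence of the principal value *)

Section principal_value.
Context {R : realType} (N : nat).
Local Notation L := (leb R N).
Implicit Types (s e : R) (x y z : 'rV[R]_N).
Variables (psi : 'rV[R]_N -> R) (M : R).
Hypotheses (M0 : 0 <= M) (mpsi : measurable_fun setT psi).
Hypothesis psiM : forall x, `|psi x| <= M.
Hypothesis psiL : forall x y, `|psi x - psi y| <= M * enorm (x - y).
Hypothesis psi2 : forall x z, `|psi (x + z) + psi (x - z) - 2 * psi x| <= M * enorm z ^+ 2.

Definition far e : set 'rV[R]_N := [set z | e < enorm z].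

Lemma measurable_far e : measurable (far e).
Proof.
rewrite [X in measurable X](_ : _ = (fun z => enorm z) @^-1` `]e, +oo[%classic).
  rewrite -[X in measurable X]setTI.
  by apply: measurable_enorm => //; exact: measurable_id.
by apply/seteqP; split=> z; rewrite /far/= in_itv/= andbT.
Qed.

Lemma measurable_far_indic e d (T : measurableType d) (f : T -> 'rV[R]_N) :
  measurable_fun setT f -> measurable_fun setT (fun w => \1_(far e) (f w) : R).
Proof.
move=> mf; apply: (measurableT_comp _ mf).
by apply: measurable_indic; exact: measurable_far.
Qed.

Lemma far_indicN e z : \1_(far e) (- z) = \1_(far e) z :> R.
Proof.
by rewrite !indicE; congr (nat_of_bool _)%:R; apply: asbool_equiv_eq => /=; rewrite /far/= enormN.
Qed.

Lemma far_indic_le e z : 0 < e -> \1_(far e) z <= (Num.min 1 (e ^+ 2))^-1 * min1sqr z.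
Proof.
move=> e0; have m0 : 0 < Num.min 1 (e ^+ 2) by rewrite lt_min ltr01 exprn_gt0.
rewrite indicE; have [h|h] := boolP (z \in far e); last first.
  by rewrite mulr_ge0 ?min1sqr_ge0// invr_ge0 ltW.
move: h; rewrite inE /far/= => h.
rewrite mulrC ler_pdivlMr// mul1r /min1sqr.
rewrite le_min !ge_min lexx/=; apply/orP; right.
by rewrite lerXn2r ?nnegrE ?enorm_ge0 ?(ltW e0) ?(ltW h).
Qed.

Lemma indic01 (A : set 'rV[R]_N) z : 0 <= (\1_A z : R) <= 1.
Proof. by rewrite indicE; case: (_ \in _); rewrite lexx ler01. Qed.

Definition far_diff s e x z : R := (psi x - psi (x + z)) * (riesz s z * \1_(far e) z).

Lemma measurable_far_diff s e x : measurable_fun setT (far_diff s e x).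
Proof.
apply: measM.
  apply: measB; first exact: measurable_cst.
  by apply: measurable_psiD => //; exact: measurable_id.
apply: measM; first by apply: measurable_riesz; exact: measurable_id.
by apply: measurable_far_indic; exact: measurable_id.
Qed.

Definition far_const e := 2 * M * (Num.min 1 (e ^+ 2))^-1.

Lemma far_const_ge0 e : 0 < e -> 0 <= far_const e.
Proof.
move=> e0; rewrite !mulr_ge0// invr_ge0 ltW//.
by rewrite lt_min ltr01 exprn_gt0.
Qed.

Lemma far_diff_le s e x z : 0 < e ->
  `|far_diff s e x z| <= far_const e * (min1sqr z * riesz s z).
Proof.
move=> e0; have /andP[i0 _] := indic01 (far e) z.
rewrite normrM (ger0_norm (mulr_ge0 (riesz_ge0 _ _) i0)).
have h1 : `|psi x - psi (x + z)| <= 2 * M.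
  apply: (le_trans (ler_normB _ _)); have := psiM x; have := psiM (x + z); lra.
have h2 : riesz s z * \1_(far e) z <= (Num.min 1 (e ^+ 2))^-1 * (min1sqr z * riesz s z).
  by rewrite mulrA mulrC ler_wpM2r ?riesz_ge0 ?far_indic_le.
rewrite /far_const -mulrA; apply: ler_pM => //.
by rewrite mulr_ge0 ?riesz_ge0.
Qed.

Lemma integrable_far_diff s e x : 0 < s < 1 -> 0 < e ->
  L.-integrable setT (EFin \o far_diff s e x).
Proof.
move=> s01 e0; apply: (integrable_dominated (g := fun z => far_const e * (min1sqr z * riesz s z))).
- exact: measurable_far_diff.
- exact: measurable_min1riesz.
- by move=> z; exact: far_diff_le.
- by rewrite integral_min1riesz ?far_const_ge0// ltry.
Qed.

Lemma fraclap_trunc_far s e x :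
  fraclap_trunc s psi x e = \int[L]_z far_diff s e x z.
Proof.
pose F (z : 'rV[R]_N) := (far_diff s e x z)%:E.
rewrite /fraclap_trunc Rintegral_mkcond /Rintegral; congr fine.
have mF : measurable_fun setT F by apply: measEFin; exact: measurable_far_diff.
transitivity (\int[L]_y F (y - x)%R)%E; last first.
  exact: (integral_leb_shift (- x) mF).
apply: eq_integral => y _; rewrite patchE /F /far_diff; congr EFin.
rewrite (_ : x + (y - x) = y); last by rewrite addrC subrK.
have E : (y \in [set y | e < enorm (x - y)]) = (y - x \in far e).
  by apply/idP/idP; rewrite !inE /far/= enormB.
rewrite indicE E; case: (_ \in _).
  by rewrite mulr1 /riesz powRN enormB.
by rewrite !mulr0.
Qed.

(** The kernel is even, so that averaging over z and -z replaces the first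
    difference by the second one. *)
Lemma fraclap_trunc_sym s e x : 0 < s < 1 -> 0 < e ->
  fraclap_trunc s psi x e = \int[L]_z (sdiff psi x z * riesz s z * \1_(far e) z).
Proof.
move=> s01 e0; rewrite fraclap_trunc_far.
have i1 := integrable_far_diff x s01 e0.
have mF : measurable_fun setT (EFin \o far_diff s e x).
  by apply: measEFin; exact: measurable_far_diff.
have E2 : \int[L]_z far_diff s e x z = \int[L]_z far_diff s e x (- z).
  by rewrite /Rintegral; congr fine; apply/esym; exact: (integral_leb_opp mF).
have i2 : L.-integrable setT (EFin \o (fun z => far_diff s e x (- z))).
  apply: (integrable_dominated (g := fun z => far_const e * (min1sqr z * riesz s z))).
  - apply: (measurableT_comp (measurable_far_diff s e x)).
    by apply: measurable_rVN; exact: measurable_id.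
  - exact: measurable_min1riesz.
  - move=> z; apply: (le_trans (far_diff_le _ _ _ e0)).
    by rewrite rieszN /min1sqr enormN.
  - by rewrite integral_min1riesz ?far_const_ge0// ltry.
have E : \int[L]_z far_diff s e x z = 2^-1 * \int[L]_z (far_diff s e x z + far_diff s e x (- z)).
  rewrite RintegralD; [|exact: measurableT|exact: i1|exact: i2].
  have h (I J : R) : I = J -> I = 2^-1 * (I + J) by move=> ->; field.
  exact: (h _ _ E2).
rewrite E -RintegralZl; [|exact: measurableT|exact: integrableD i1 i2].
congr fine; apply: eq_integral => z _; congr EFin.
by rewrite /far_diff far_indicN rieszN /sdiff; field.
Qed.

(** Dominated convergence, the dominating function being the integrable
    second-difference integrand. *)
Lemma cvg_fraclap_trunc s x : 0 < s < 1 ->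
  fraclap_trunc s psi x e @[e --> 0^'+] --> Lop psi s x.
Proof.
move=> s01; apply/cvg_at_rightP => u [u0 ul].
under eq_cvg do rewrite fraclap_trunc_sym//.
have iL := integrable_sdiff M0 mpsi psiM psi2 x s01.
have ioo : (\int[L]_z (sdiff psi x z * riesz s z)%:E)%E \is a fin_num by apply: integrable_fin_num.
rewrite /Lop /Rintegral.
apply: fine_cvg; rewrite fineK//.
have [//|//|//|//|//|_ _] := @dominated_convergence _ _ _ L setT measurableT
  (fun n z => (sdiff psi x z * riesz s z * \1_(far (u n)) z)%:E)
  (fun z => (sdiff psi x z * riesz s z)%:E)
  (fun z => (2 * M * (min1sqr z * riesz s z))%:E).
- move=> n; apply: measEFin; apply: measM; first exact: measurable_sdiff_riesz.
  by apply: measurable_far_indic; exact: measurable_id.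
- by apply: measEFin; exact: measurable_sdiff_riesz.
- apply: aeW => z _; apply: cvg_EFin; first by apply: nearW.
  rewrite /=; have [->|z0] := eqVneq z 0.
    rewrite /sdiff addr0 subr0 (_ : 2 * psi x - psi x - psi x = 0); last by ring.
    by rewrite !mul0r; under eq_fun do rewrite mul0r; exact: cvg_cst.
  have nz := enorm_gt0 z0.
  apply: cvg_near_cst; near=> n.
  rewrite /= indicE mem_set ?mulr1// /far/=.
  by near: n; move/cvgrPdist_lt : ul => /(_ _ nz); apply: filterS => n;
    rewrite sub0r normrN gtr0_norm.
- apply: (integrable_dominated (g := fun z => 2 * M * (min1sqr z * riesz s z))).
  + exact: measurable_min1riesz.
  + exact: measurable_min1riesz.
  + move=> z; rewrite ger0_norm; first exact: lexx.
    by apply: mulr_ge0; [exact: mulr_ge0|exact: min1riesz_ge0].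
  + by rewrite integral_min1riesz ?mulr_ge0// ltry.
- apply: aeW => z n _; rewrite abse_EFin lee_fin normrM.
  have /andP[i0 i1] := indic01 (far (u n)) z.
  rewrite (ger0_norm i0); apply: (le_trans _ (sdiff_riesz_le M0 psiM psi2 s x z)).
  by rewrite ler_piMr.
by [].
Unshelve. all: by end_near. Qed.

Lemma has_fraclap_bump s x : 0 < s < 1 -> has_fraclap s psi x.
Proof. by move=> s01; apply/cvg_ex; exists (Lop psi s x); exact: cvg_fraclap_trunc. Qed.

Lemma fraclap_bump s x : 0 < s < 1 -> fraclap s psi x = fraclap_const N s * Lop psi s x.
Proof.
by move=> s01; rewrite /fraclap; congr (_ * _); apply: cvg_lim => //; exact: cvg_fraclap_trunc.
Qed.

End principal_value.

(** * Finite energy of a bump function *)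

Section energy.
Context {R : realType} (N : nat).
Local Notation L := (leb R N).
Local Notation V := ('rV[R]_N).
Implicit Types (s e : R) (x y z : 'rV[R]_N).
Variables (s : R) (psi : 'rV[R]_N -> R) (M rho : R).
Hypothesis (s01 : 0 < s < 1).
Hypotheses (M0 : 0 <= M) (mpsi : measurable_fun setT psi).
Hypothesis psiM : forall x, `|psi x| <= M.
Hypothesis psiL : forall x y, `|psi x - psi y| <= M * enorm (x - y).
Hypothesis psi2 : forall x z, `|psi (x + z) + psi (x - z) - 2 * psi x| <= M * enorm z ^+ 2.
Hypotheses (rho0 : 0 < rho) (psi0 : forall x, rho <= enorm x -> psi x = 0).

Lemma measurable_eball (r : R) : measurable (eball (0 : V) r).
Proof.
rewrite [X in measurable X](_ : _ = (fun z => enorm (z - 0)) @^-1` `]-oo, r[%classic).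
  rewrite -[X in measurable X]setTI.
  by apply: measurable_enorm => //; under eq_fun do rewrite subr0; exact: measurable_id.
by apply/seteqP; split=> z; rewrite /eball/= in_itv.
Qed.

Let B := eball (0 : V) rho.
Let b x : R := \1_B x.
Let mb : measurable_fun setT b.
Proof. by apply: measurable_indic; exact: measurable_eball. Qed.
Let b0 x : 0 <= b x. Proof. by have /andP[] := indic01 B x. Qed.

Let psi_b x : `|psi x| <= M * b x.
Proof.
rewrite /b indicE; have [h|h] := boolP (x \in B); first by rewrite mulr1.
rewrite psi0 ?normr0 ?mulr0//.
by move: h; rewrite notin_setE /B /eball/= subr0 => /negP; rewrite -leNgt.
Qed.

Let integral_b : (\int[L]_x (b x)%:E = (fine (L B))%:E)%E.
Proof.
rewrite integral_indic ?setIT//; last exact: measurable_eball.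
by rewrite fineK// ge0_fin_numE//; apply: leb_eball_lty; exact: ltW.
Qed.

Let psi_diff_sqr x y : (psi x - psi y) ^+ 2 <= 4 * M ^+ 2 * (b x + b y) * min1sqr (x - y).
Proof.
have h1 : `|psi x - psi y| <= 2 * M.
  by apply: (le_trans (ler_normB _ _)); have := psiM x; have := psiM y; lra.
have h2 := psiL x y.
have hb : 1 <= b x + b y \/ (x \notin B /\ y \notin B).
  rewrite /b !indicE; case: (x \in B); case: (y \in B) => /=; first by left; lra.
  - by left; lra.
  - by left; lra.
  - by right.
have k0 : 0 <= 4 * M ^+ 2 by rewrite mulr_ge0 ?sqr_ge0.
case: hb => [hb|[hx hy]]; last first.
  have z w : w \notin B -> psi w = 0.
    move=> h; apply: psi0; move: h.
    by rewrite notin_setE /B /eball/= subr0 => /negP; rewrite -leNgt.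
  rewrite !z// subrr expr0n/=; apply: mulr_ge0; last exact: min1sqr_ge0.
  by apply: mulr_ge0 => //; exact: addr_ge0.
apply: (@le_trans _ _ (4 * M ^+ 2 * min1sqr (x - y))); last first.
  by rewrite ler_wpM2r ?min1sqr_ge0// ler_peMr.
have -> : 4 * M ^+ 2 = (2 * M) ^+ 2 by ring.
have M20 : 0 <= 2 * M by exact: mulr_ge0.
rewrite /min1sqr -(@real_normK _ (psi x - psi y)) ?num_real//.
case: (leP 1 (enorm (x - y) ^+ 2)) => _; rewrite ?mulr1.
  by rewrite lerXn2r// nnegrE.
rewrite -exprMn lerXn2r ?nnegrE ?mulr_ge0 ?enorm_ge0//.
by apply: (le_trans h2); rewrite ler_wpM2r ?enorm_ge0// ler_peMl// ler1n.
Qed.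

Let mBz d (T : measurableType d) (f g : T -> V) :
  measurable_fun setT f -> measurable_fun setT g -> measurable_fun setT (fun w => f w - g w).
Proof. by move=> mf mg; apply: measurable_rVD => //; exact: measurable_rVN. Qed.

Let kk (w : V * V) := min1sqr (w.1 - w.2) * riesz s (w.1 - w.2).
Let mkk : measurable_fun setT kk.
Proof. by apply: measM; [apply: measurable_min1sqr|apply: measurable_riesz]; exact: mBz. Qed.
Let mkkx x : measurable_fun setT (fun y => kk (x, y)).
Proof.
have mc : measurable_fun setT (fun _ : V => x) by exact: measurable_cst.
have mi : measurable_fun setT (fun y : V => y) by exact: measurable_id.
by apply: measM; [apply: measurable_min1sqr|apply: measurable_riesz]; exact: mBz.
Qed.
Let kk0 w : 0 <= kk w. Proof. exact: min1riesz_ge0. Qed.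

Let integral_kk x : (\int[L]_y (kk (x, y))%:E = (kernel_mass N s)%:E)%E.
Proof.
rewrite -(@kernel_massE R N s s01).
have mF : measurable_fun setT (fun z : V => (min1sqr z * riesz s z)%:E).
  have := @measurable_min1riesz R N s 1; under eq_fun do rewrite mul1r; exact: measEFin.
transitivity (\int[L]_y (fun z : V => (min1sqr z * riesz s z)%:E) (y - x)%R)%E; last first.
  exact: (integral_leb_shift (- x) mF).
have kkE y : kk (x, y) = min1sqr (y - x) * riesz s (y - x).
  by rewrite /kk /= -(opprB y x) /min1sqr enormN rieszN.
apply: eq_integral => y _; rewrite kkE; reflexivity.
Qed.

Let integral_bkk : (\int[L \x L]_w (b w.1 * kk w)%:E < +oo)%E.
Proof.
have m : measurable_fun setT (fun w : V * V => (b w.1 * kk w)%:E).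
  by apply: measEFin; apply: measM => //; exact: (measurableT_comp mb).
rewrite (@fubini_tonelli1 _ _ _ _ _ L L (fun w => (b w.1 * kk w)%:E))//; last first.
  by move=> w; rewrite lee_fin mulr_ge0.
have km0 : 0 <= kernel_mass N s.
  by rewrite -lee_fin -(@kernel_massE R N s s01) integral_ge0// => z _; rewrite lee_fin min1riesz_ge0.
have inner x : (\int[L]_y (b x * kk (x, y))%:E = (kernel_mass N s * b x)%:E)%E.
  rewrite ge0_integralZl_real; [|exact: measurableT|exact: mkkx|by move=> y _; exact: kk0|exact: b0].
  by rewrite integral_kk -EFinM mulrC.
rewrite /fubini_F (eq_integral (fun x => (kernel_mass N s * b x)%:E)); last first.
  by move=> x _; exact: inner.
rewrite ge0_integralZl_real; [|exact: measurableT|exact: mb|by move=> y _; exact: b0|exact: km0].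
by rewrite integral_b -EFinM ltry.
Qed.

Let integral_bkk2 : (\int[L \x L]_w (b w.2 * kk w)%:E < +oo)%E.
Proof.
have m : measurable_fun setT (fun w : V * V => (b w.2 * kk w)%:E).
  by apply: measEFin; apply: measM => //; exact: (measurableT_comp mb).
have m' : measurable_fun setT (fun w : V * V => (b w.1 * kk w)%:E).
  by apply: measEFin; apply: measM => //; exact: (measurableT_comp mb).
have p w : (0 <= (b w.2 * kk w)%:E)%E by rewrite lee_fin mulr_ge0.
have p' w : (0 <= (b w.1 * kk w)%:E)%E by rewrite lee_fin mulr_ge0.
have kkC x y : kk (x, y) = kk (y, x).
  by rewrite /kk/= /min1sqr enormB -(opprB x y) rieszN.
rewrite (fubini_tonelli1 (m1 := L) (m2 := L) _ m p).
rewrite /fubini_F (fubini_tonelli (m1 := L) (m2 := L) _ m p).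
have := integral_bkk; rewrite (fubini_tonelli1 (m1 := L) (m2 := L) _ m' p').
apply: le_lt_trans; rewrite le_eqVlt; apply/orP; left; apply/eqP.
apply: eq_integral => x _; rewrite /fubini_F; apply: eq_integral => y _.
by rewrite [in LHS]kkC.
Qed.

(** The squared increment is at most a multiple of min(1, |x - y|^2) and
    vanishes unless one of the points lies in the ball that supports psi, so
    that the double integral is at most a constant times the volume of the
    ball. *)
Lemma Hs_normsq_bump : (Hs_normsq s psi < +oo)%E.
Proof.
rewrite /Hs_normsq; apply: lte_add_pinfty.
  apply: (@le_lt_trans _ _ (\int[L]_x (M ^+ 2 * b x)%:E)%E).
    apply: ge0_le_integral => //.
    - by move=> x _; rewrite lee_fin sqr_ge0.
    - by mfun.
    - by mfun.
    - move=> x _; rewrite lee_fin -(@real_normK _ (psi x)) ?num_real//.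
      rewrite expr2; apply: (@le_trans _ _ (M * (M * b x))); last by rewrite mulrA expr2.
      by apply: ler_pM.
  rewrite ge0_integralZl_real ?sqr_ge0// integral_b -EFinM; exact: ltry.
have ms : measurable_fun setT (fun w : V * V => b w.1 * kk w).
  by apply: measM => //; exact: (measurableT_comp mb).
have ms2 : measurable_fun setT (fun w : V * V => b w.2 * kk w).
  by apply: measM => //; exact: (measurableT_comp mb).
have K0 : 0 <= 4 * M ^+ 2 by rewrite mulr_ge0 ?sqr_ge0.
apply: (@le_lt_trans _ _ (\int[L \x L]_w ((4 * M ^+ 2 * (b w.1 * kk w))%:E + (4 * M ^+ 2 * (b w.2 * kk w))%:E))%E).
  apply: ge0_le_integral => //.
  - by move=> w _; rewrite lee_fin -powRN mulr_ge0 ?sqr_ge0.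
  - apply: measEFin; under eq_fun do rewrite -powRN.
    apply: measM; last by apply: measurable_riesz; exact: mBz.
    by apply: measX; apply: measB; exact: (measurableT_comp mpsi).
  - by apply: emeasurable_funD; apply: measEFin; apply: measM => //; exact: measurable_cst.
  - move=> w _; rewrite -EFinD lee_fin -powRN -mulrDr -mulrDl.
    rewrite /kk mulrA mulrA ler_wpM2r//; exact: psi_diff_sqr.
rewrite ge0_integralD//; last 4 first.
- by move=> w _; rewrite lee_fin; apply: (mulr_ge0 K0); exact: mulr_ge0.
- by apply: measEFin; apply: measM => //; exact: measurable_cst.
- by move=> w _; rewrite lee_fin; apply: (mulr_ge0 K0); exact: mulr_ge0.
- by apply: measEFin; apply: measM => //; exact: measurable_cst.
apply: lte_add_pinfty; rewrite ge0_integralZl_real//.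
- by apply: lte_mul_pinfty; [rewrite lee_fin|by []|exact: integral_bkk].
- by move=> w _; exact: mulr_ge0.
- by apply: lte_mul_pinfty; [rewrite lee_fin|by []|exact: integral_bkk2].
- by move=> w _; exact: mulr_ge0.
Qed.

End energy.

(** * The bilinear form against a bump function *)

Section weak_form.
Context {R : realType} (N : nat).
Local Notation L := (leb R N).
Local Notation V := ('rV[R]_N).
Implicit Types (e : R) (x y z : 'rV[R]_N).
Variables (s : R) (psi : 'rV[R]_N -> R) (M rho : R).
Hypothesis (s01 : 0 < s < 1).
Hypotheses (M0 : 0 <= M) (mpsi : measurable_fun setT psi).
Hypothesis psiM : forall x, `|psi x| <= M.
Hypothesis psiL : forall x y, `|psi x - psi y| <= M * enorm (x - y).
Hypothesis psi2 : forall x z, `|psi (x + z) + psi (x - z) - 2 * psi x| <= M * enorm z ^+ 2.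
Hypotheses (rho0 : 0 < rho) (psi0 : forall x, rho <= enorm x -> psi x = 0).
Variables (Omega : set V) (v : V -> R).
Hypotheses (mOmega : measurable Omega) (finOmega : (L Omega < +oo)%E).
Hypothesis (hv : H0s Omega s v).

Let mv : measurable_fun setT v. Proof. by case: hv. Qed.
Let v2lty : (\int[L]_x (v x ^+ 2)%:E < +oo)%E.
Proof.
case: hv => _ + _; rewrite /Hs_normsq; apply: le_lt_trans.
by rewrite leeDl// integral_ge0// => w _; rewrite lee_fin -powRN mulr_ge0 ?sqr_ge0.
Qed.
Let vHs : (\int[L \x L]_z ((v z.1 - v z.2) ^+ 2 / enorm (z.1 - z.2) `^ (N%:R + 2 * s))%:E < +oo)%E.
Proof.
case: hv => _ + _; rewrite /Hs_normsq; apply: le_lt_trans.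
by rewrite leeDr// integral_ge0// => w _; rewrite lee_fin sqr_ge0.
Qed.
Let v0 : {ae L, forall x, ~ Omega x -> v x = 0}. Proof. by case: hv. Qed.

(** On Omega, of finite measure, |v| <= 1 + v^2, and v vanishes almost
    everywhere outside. *)
Lemma integrable_H0s : L.-integrable setT (EFin \o v).
Proof.
apply/integrableP; split; first exact: measEFin.
have mi : measurable_fun setT (\1_Omega : V -> R) by exact: measurable_indic.
apply: (@le_lt_trans _ _ (\int[L]_x ((\1_Omega x)%:E + (v x ^+ 2)%:E))%E); last first.
  rewrite ge0_integralD; [|exact: measurableT| |exact: measEFin| |by mfun].
  - by rewrite lte_add_pinfty// integral_indic// setIT.
  - by move=> x _; rewrite lee_fin indicE.
  - by move=> x _; rewrite lee_fin sqr_ge0.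
apply: ae_ge0_le_integral => //.
- by apply: measurableT_comp => //; exact: measEFin.
- by move=> x _; rewrite -EFinD lee_fin addr_ge0 ?sqr_ge0// indicE.
- by apply: emeasurable_funD; [exact: measEFin|mfun].
- apply: filterS v0 => x vx _; rewrite /= -EFinD lee_fin indicE.
  have [h|h] := pselect (Omega x).
    rewrite mem_set// -(@real_normK _ (v x)) ?num_real//.
    have := normr_ge0 (v x); move: `|v x| => t t0 /=.
    by have := sqr_ge0 (t - 1); rewrite sqrrB1; nra.
  by rewrite vx// normr0 expr0n/= addr0.
Qed.

Let far_pair e (w : V * V) : R := \1_(far e) (w.1 - w.2).

Let mBz d (T : measurableType d) (f g : T -> V) :
  measurable_fun setT f -> measurable_fun setT g -> measurable_fun setT (fun w => f w - g w).
Proof. by move=> mf mg; apply: measurable_rVD => //; exact: measurable_rVN. Qed.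
Let mfst : measurable_fun setT (fun w : V * V => w.1). Proof. exact: measurable_fst. Qed.
Let msnd : measurable_fun setT (fun w : V * V => w.2). Proof. exact: measurable_snd. Qed.
Let mdif : measurable_fun setT (fun w : V * V => w.1 - w.2). Proof. exact: mBz. Qed.
Let mfar e : measurable_fun setT (far_pair e).
Proof. exact: measurable_far_indic. Qed.
Let mr : measurable_fun setT (fun w : V * V => riesz s (w.1 - w.2)).
Proof. exact: measurable_riesz. Qed.
Let mp1 : measurable_fun setT (fun w : V * V => psi w.1).
Proof. exact: (measurableT_comp mpsi). Qed.
Let mp2 : measurable_fun setT (fun w : V * V => psi w.2).
Proof. exact: (measurableT_comp mpsi). Qed.
Let mv1 : measurable_fun setT (fun w : V * V => v w.1).
Proof. exact: (measurableT_comp mv). Qed.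
Let mv2 : measurable_fun setT (fun w : V * V => v w.2).
Proof. exact: (measurableT_comp mv). Qed.

Let Q (w : V * V) : R := (psi w.1 - psi w.2) * (v w.1 - v w.2) * riesz s (w.1 - w.2).
Let mQ : measurable_fun setT Q.
Proof. by apply: measM => //; apply: measM; apply: measB. Qed.

Let intQ : (L \x L)%E.-integrable setT (EFin \o Q).
Proof.
have h1 := Hs_normsq_bump s01 M0 mpsi psiM psiL rho0 psi0.
have {}h1 : (\int[L \x L]_w ((psi w.1 - psi w.2) ^+ 2 * riesz s (w.1 - w.2))%:E < +oo)%E.
  move: h1; rewrite /Hs_normsq; apply: le_lt_trans.
  under eq_integral do rewrite /riesz powRN.
  by rewrite leeDr// integral_ge0// => w _; rewrite lee_fin sqr_ge0.
have h2 : (\int[L \x L]_w ((v w.1 - v w.2) ^+ 2 * riesz s (w.1 - w.2))%:E < +oo)%E.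
  by under eq_integral do rewrite /riesz powRN.
pose g1 (w : V * V) := (psi w.1 - psi w.2) ^+ 2 * riesz s (w.1 - w.2).
pose g2 (w : V * V) := (v w.1 - v w.2) ^+ 2 * riesz s (w.1 - w.2).
have m1 : measurable_fun setT g1 by apply: measM => //; apply: measX; exact: measB.
have m2 : measurable_fun setT g2 by apply: measM => //; apply: measX; exact: measB.
have p1 w : 0 <= g1 w by rewrite mulr_ge0 ?sqr_ge0 ?riesz_ge0.
have p2 w : 0 <= g2 w by rewrite mulr_ge0 ?sqr_ge0 ?riesz_ge0.
apply: (integrable_dominated (g := fun w => g1 w + g2 w)) => //.
- exact: measD.
- move=> w; rewrite /Q /g1 /g2 normrM (ger0_norm (riesz_ge0 _ _)) -mulrDl.
  rewrite ler_wpM2r ?riesz_ge0//; set a := psi _ - _; set c := v _ - _.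
  rewrite ler_norml; have := sqr_ge0 (a + c); have := sqr_ge0 (a - c).
  have := sqr_ge0 a; have := sqr_ge0 c.
  by move=> ? ? ? ?; apply/andP; split; nra.
- under eq_integral do rewrite EFinD.
  rewrite ge0_integralD; [|exact: measurableT| |exact: measEFin| |exact: measEFin].
  + exact: lte_add_pinfty.
  + by move=> w _; rewrite lee_fin.
  + by move=> w _; rewrite lee_fin.
Qed.

Let P e (w : V * V) : R := (psi w.1 - psi w.2) * v w.1 * (riesz s (w.1 - w.2) * far_pair e w).
Let mP e : measurable_fun setT (P e).
Proof. by apply: measM; [apply: measM => //; exact: measB|exact: measM]. Qed.

Let PE e x y : P e (x, y) = v x * far_diff psi s e x (y - x).
Proof.
rewrite /P /far_diff /far_pair /= (_ : x + (y - x) = y); last by rewrite addrC subrK.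
by rewrite -(opprB y x) rieszN far_indicN; ring.
Qed.

Let mfd e x : measurable_fun setT (fun y : V => far_diff psi s e x (y - x)).
Proof.
apply: (measurableT_comp (measurable_far_diff mpsi s e x)).
by apply: measurable_rVD; [exact: measurable_id|exact: measurable_cst].
Qed.

Let integral_far_diff_abs e x : 0 < e ->
  (\int[L]_y (`|far_diff psi s e x (y - x)|)%:E <= (far_const M e * kernel_mass N s)%:E)%E.
Proof.
move=> e0.
have mF : measurable_fun setT (fun z : V => (`|far_diff psi s e x z|)%:E).
  by apply: measEFin; apply: measnorm; exact: measurable_far_diff.
rewrite (_ : (\int[L]_y _)%E = (\int[L]_z (`|far_diff psi s e x z|)%:E)%E); last first.
  exact: (integral_leb_shift (- x) mF).
rewrite -integral_min1riesz; [|exact: s01|exact: far_const_ge0].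
apply: ge0_le_integral; [exact: measurableT| |exact: mF| |].
- by move=> z _; rewrite lee_fin.
- by apply: measEFin; exact: measurable_min1riesz.
- by move=> z _; rewrite lee_fin far_diff_le.
Qed.

Let intP e : 0 < e -> (L \x L)%E.-integrable setT (EFin \o P e).
Proof.
move=> e0; have c0 : 0 <= far_const M e by exact: far_const_ge0.
apply/integrable12ltyP; first by apply: measEFin; exact: mP.
apply: (@le_lt_trans _ _ (\int[L]_x ((far_const M e * kernel_mass N s) * `|v x|)%:E)%E).
  apply: ge0_le_integral; [exact: measurableT| | | |].
  - by move=> x _; apply: integral_ge0 => y _; exact: abse_ge0.
  - apply: (measurable_fun_fubini_tonelli_F (m2 := L) (fun w => `|(EFin \o P e) w|)%E).
      by apply: measurableT_comp => //; apply: measEFin; exact: mP.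
    by move=> w; exact: abse_ge0.
  - by apply: measEFin; apply: measM; [exact: measurable_cst|exact: measnorm].
  - move=> x _; rewrite mulrC EFinM.
    rewrite (eq_integral (fun y => (`|v x| * `|far_diff psi s e x (y - x)|)%:E)); last first.
      by move=> y _; rewrite /= PE normrM.
    rewrite ge0_integralZl_real; [|exact: measurableT| | |exact: normr_ge0].
    + apply: lee_wpmul2l; first by rewrite lee_fin.
      exact: integral_far_diff_abs.
    + by apply: measnorm; exact: mfd.
    + by move=> y _; exact: normr_ge0.
have km0 : 0 <= kernel_mass N s.
  by rewrite -lee_fin -(@kernel_massE R N s s01) integral_ge0// => z _; rewrite lee_fin min1riesz_ge0.
rewrite ge0_integralZl_real; [|exact: measurableT|exact: measnorm| |exact: mulr_ge0].
- apply: lte_mul_pinfty; [by rewrite lee_fin mulr_ge0|by []|].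
  by have /integrableP[_] := integrable_H0s.
- by move=> x _; exact: normr_ge0.
Qed.

Let integral_P e : 0 < e ->
  (\int[L \x L]_w (P e w)%:E = \int[L]_x (v x * fraclap_trunc s psi x e)%:E)%E.
Proof.
move=> e0; have iP := intP e0.
rewrite -(integral12_prod_meas1 iP); apply: eq_integral => x _.
rewrite /fubini_F/=.
have mF : measurable_fun setT (EFin \o far_diff psi s e x).
  by apply: measEFin; exact: measurable_far_diff.
have if1 := integrable_far_diff M0 mpsi psiM x s01 e0.
rewrite (eq_integral (fun y => ((v x)%:E * (EFin \o far_diff psi s e x) (y - x)%R)%E)); last first.
  by move=> y _; rewrite PE.
have if2 : L.-integrable setT (fun y => (EFin \o far_diff psi s e x) (y - x)%R).
  apply/integrableP; split; first by apply: measEFin; exact: mfd.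
  by apply: le_lt_trans (ltry _); exact: integral_far_diff_abs.
rewrite (integralZl measurableT if2) (integral_leb_shift (- x) mF).
rewrite EFinM; congr (_ * _)%E.
by rewrite fraclap_trunc_far // /Rintegral fineK//; exact: (integrable_fin_num measurableT if1).
Qed.

Let integral_Pswap e : 0 < e ->
  (L \x L)%E.-integrable setT (fun w => (P e (w.2, w.1))%:E) /\
  (\int[L \x L]_w (P e (w.2, w.1))%:E = \int[L \x L]_w (P e w)%:E)%E.
Proof.
move=> e0; have iP := intP e0.
have mS : measurable_fun setT (fun w : V * V => (P e (w.2, w.1))%:E).
  apply: measEFin; apply: (measurableT_comp (mP e)).
  by apply/measurable_fun_pairP; split.
have iS : (L \x L)%E.-integrable setT (fun w => (P e (w.2, w.1))%:E).
  apply/(integrable21ltyP _ _ mS).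
  by have /(integrable12ltyP _ _ (measurable_int _ iP)) := iP.
split; first exact: iS.
by rewrite -(integral21_prod_meas1 iS) -(integral12_prod_meas1 iP).
Qed.

Let QE e w : Q w * far_pair e w = P e w + P e (w.2, w.1).
Proof.
rewrite /Q /P /far_pair /= -(opprB w.1 w.2) rieszN far_indicN.
by ring.
Qed.

Let integral_Q_far e : 0 < e ->
  (\int[L \x L]_w (Q w * far_pair e w)%:E =
   (2 * \int[L]_x (v x * fraclap_trunc s psi x e))%:E)%E.
Proof.
move=> e0; have [iS ES] := integral_Pswap e0; have iP := intP e0.
rewrite (eq_integral (fun w => (P e w)%:E + (P e (w.2, w.1))%:E)%E); last first.
  by move=> w _; rewrite QE.
rewrite (integralD_EFin measurableT iP iS) ES.
have Pfin := integrable_fin_num measurableT iP.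
rewrite -(fineK Pfin) -EFinD; congr EFin.
rewrite mulr_natl mulr2n; congr (fine _ + fine _); exact: integral_P.
Qed.

Let u n : R := n.+1%:R^-1.
Let u0 n : 0 < u n. Proof. by rewrite invr_gt0. Qed.
Let ul : u n @[n --> \oo] --> (0 : R).
Proof. exact: cvg_harmonic. Qed.

Let cvg_Q : (\int[L \x L]_w (Q w * far_pair (u n) w)%:E @[n --> \oo] -->
  \int[L \x L]_w (Q w)%:E)%E.
Proof.
have [||_ _ cvQ] := @dominated_convergence _ _ _ (L \x L)%E setT measurableT
  (fun n w => (Q w * far_pair (u n) w)%:E) (fun w => (Q w)%:E) (fun w => (`|Q w|)%:E)
  (fun n => measEFin (measM mQ (mfar (u n)))) (measEFin mQ) _
  (integrable_norm intQ) _; last exact: cvQ.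
- apply: aeW => -[x y] _; apply: cvg_EFin; first by apply: nearW.
  rewrite /=; have [->|xy] := eqVneq x y.
    by rewrite /Q/= subrr !mul0r; under eq_fun do rewrite mul0r; exact: cvg_cst.
  have nz : 0 < enorm (x - y) by apply: enorm_gt0; rewrite subr_eq0.
  apply: cvg_near_cst; near=> n.
  rewrite /= /far_pair/= indicE mem_set ?mulr1// /far/=.
  by near: n; move/cvgrPdist_lt : ul => /(_ _ nz); apply: filterS => n;
    rewrite sub0r normrN gtr0_norm.
- apply: aeW => w n _; rewrite abse_EFin lee_fin normrM.
  have /andP[i0 i1] := indic01 (far (u n)) (w.1 - w.2).
  by rewrite (ger0_norm i0) ler_piMr.
Unshelve. all: by end_near. Qed.

Lemma measurable_fraclap_trunc e : 0 < e -> measurable_fun setT (fun x => fraclap_trunc s psi x e).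
Proof.
move=> e0; under eq_fun do rewrite fraclap_trunc_far// /Rintegral.
pose F (w : V * V) := (far_diff psi s e w.1 w.2)%:E.
have mF : measurable_fun setT F.
  apply: measEFin; apply: measM.
    by apply: measB => //; apply: (measurableT_comp mpsi); exact: measurable_rVD.
  apply: measM; first by apply: measurable_riesz; exact: measurable_snd.
  by apply: measurable_far_indic; exact: measurable_snd.
suff h : measurable_fun setT (fun x => \int[L]_z F (x, z))%E.
  exact: (measurableT_comp (fine_measurable measurableT) h).
rewrite (_ : (fun x => _) = (fun x => \int[L]_z (F ^\+)%E (x, z) - \int[L]_z (F ^\-)%E (x, z))%E).
  apply: emeasurable_funB.
    by apply: (measurable_fun_fubini_tonelli_F (m2 := L) (F ^\+)%E) => //; exact: measurable_funepos.
  by apply: (measurable_fun_fubini_tonelli_F (m2 := L) (F ^\-)%E) => //; exact: measurable_funeneg.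
apply/funext => x; rewrite integralE; congr (_ - _)%E; by apply: eq_integral => z _; rewrite ?funeposE ?funenegE.
Qed.

(** A pointwise limit of truncated integrals, which are measurable by Fubini.
    *)
Lemma measurable_Lop : measurable_fun setT (Lop psi s).
Proof.
apply: (measurable_fun_cvg (fun n => measurable_fraclap_trunc (u0 n))) => x _.
have h := @cvg_fraclap_trunc _ _ _ _ M0 mpsi psiM psi2 s x s01.
by move/cvg_at_rightP : h; apply; split => //; exact: ul.
Qed.

Let trunc_bounded e x : 0 < e -> `|fraclap_trunc s psi x e| <= 2 * M * kernel_mass N s.
Proof.
move=> e0; rewrite (fraclap_trunc_sym M0 mpsi psiM x s01 e0).
rewrite -[leRHS]/(fine (2 * M * kernel_mass N s)%:E).
rewrite -integral_min1riesz; [|exact: s01|exact: mulr_ge0].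
apply: normr_Rintegral_dominated.
- apply: measM; first exact: measurable_sdiff_riesz.
  by apply: measurable_far_indic; exact: measurable_id.
- exact: measurable_min1riesz.
- move=> z; apply: (le_trans _ (sdiff_riesz_le M0 psiM psi2 s x z)).
  have /andP[i0 i1] := indic01 (far e) z.
  by rewrite normrM (ger0_norm i0) ler_piMr.
- by rewrite integral_min1riesz ?mulr_ge0// ltry.
Qed.

Let cvg_vtrunc : (\int[L]_x (v x * fraclap_trunc s psi x (u n)) @[n --> \oo] -->
  \int[L]_x (v x * Lop psi s x))%R /\ L.-integrable setT (fun x => (v x * Lop psi s x)%:E).
Proof.
set C := 2 * M * kernel_mass N s.
have iv := integrable_norm integrable_H0s.
have iC : L.-integrable setT (fun x => C%:E * (`|v x|)%:E)%E.
  exact: (integrableZl measurableT C iv).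
have [||i1 _ c1] := @dominated_convergence _ _ _ L setT measurableT
  (fun n x => (v x * fraclap_trunc s psi x (u n))%:E) (fun x => (v x * Lop psi s x)%:E)
  (fun x => C%:E * (`|v x|)%:E)%E
  (fun n => measEFin (measM mv (measurable_fraclap_trunc (u0 n)))) (measEFin (measM mv measurable_Lop))
  (_ : {ae L, forall x, setT x -> _ --> _})
  iC (_ : {ae L, forall x n, setT x -> _}); last first.
- split; last exact: i1.
  by apply: fine_cvg; rewrite fineK//; exact: (integrable_fin_num measurableT i1).
- apply: aeW => x n _; rewrite abse_EFin -EFinM lee_fin normrM mulrC.
  by rewrite ler_wpM2r//; exact: trunc_bounded.
- apply: aeW => x _; apply: cvg_EFin; first by apply: nearW.
  apply: cvgM; first exact: cvg_cst.
  have h := @cvg_fraclap_trunc _ _ _ _ M0 mpsi psiM psi2 s x s01.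
  by move/cvg_at_rightP : h; apply; split => //; exact: ul.
Qed.

(** Integration by parts.  Away from the diagonal the form splits into two
    convergent halves exchanged by (x, y) -> (y, x), each equal to the integral
    of v against the truncated fractional Laplacian; then the truncation is
    removed on both sides by dominated convergence. *)
Lemma fraclap_form_bump :
  fraclap_form s psi v = \int[L]_(x in Omega) (fraclap s psi x * v x).
Proof.
have [cv iv] := cvg_vtrunc.
have Qfin := integrable_fin_num measurableT intQ.
have E1 : fine (\int[L \x L]_w (Q w)%:E) = 2 * \int[L]_x (v x * Lop psi s x).
  have c1 := cvg_Q; rewrite -(fineK Qfin) in c1.
  have c2 := fine_cvg c1.
  have c3 : (fine \o (fun n => \int[L \x L]_w (Q w * far_pair (u n) w)%:E)%E) n @[n --> \oo] -->
      2 * \int[L]_x (v x * Lop psi s x).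
    under eq_cvg do rewrite /= integral_Q_far//.
    by apply: cvgM cv; exact: cvg_cst.
  exact: (cvg_unique (@Rhausdorff R) (c2 _) c3).
have E2 : \int[L]_(x in Omega) (fraclap s psi x * v x) = fraclap_const N s * \int[L]_x (v x * Lop psi s x).
  rewrite -RintegralZl; [|exact: measurableT|exact: iv].
  rewrite Rintegral_mkcond /Rintegral; congr fine.
  apply: ae_eq_integral; [exact: measurableT| | |].
  - apply: measEFin; apply/(measurable_restrictT _ mOmega); apply: measurable_funTS.
    rewrite (_ : (fun x => _) = (fun x => fraclap_const N s * Lop psi s x * v x)).
      by apply: measM => //; apply: measM; [exact: measurable_cst|exact: measurable_Lop].
    by apply/funext => x; rewrite (@fraclap_bump _ _ _ _ M0 mpsi psiM psi2 s x s01).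
  - by apply: measEFin; apply: measM; [exact: measurable_cst|apply: measM => //; exact: measurable_Lop].
  - apply: filterS v0 => x vx _; rewrite patchE; case: ifPn => h.
      by rewrite (@fraclap_bump _ _ _ _ M0 mpsi psiM psi2 s x s01); congr EFin; ring.
    by rewrite vx ?mul0r ?mulr0//; move: h; rewrite notin_setE.
rewrite E2 /fraclap_form.
rewrite (_ : (\int[(L \x L)%E]_z _)%R = 2 * \int[L]_x (v x * Lop psi s x)).
  by rewrite mulrA divfK// pnatr_eq0.
rewrite -E1 /Rintegral; congr fine; apply: eq_integral => w _.
by rewrite /Q /riesz powRN.
Qed.

End weak_form.

(** * Scaling of norms, and powers of T - t *)

Section scaling.
Context {R : realType} (N : nat).
Local Notation L := (leb R N).
Local Notation V := ('rV[R]_N).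
Implicit Types (s c : R) (v : V -> R).

Lemma Hs_normsqZ s c v : measurable_fun setT v ->
  (Hs_normsq s (fun x => c * v x)%R = (c ^+ 2)%:E * Hs_normsq s v)%E.
Proof.
move=> mv; rewrite /Hs_normsq.
have c2 : 0 <= c ^+ 2 by exact: sqr_ge0.
have mdif : measurable_fun setT (fun w : V * V => w.1 - w.2).
  apply: measurable_rVD; first exact: measurable_fst.
  by apply: measurable_rVN; exact: measurable_snd.
have mv1 : measurable_fun setT (fun w : V * V => v w.1).
  exact: (measurableT_comp mv measurable_fst).
have mv2 : measurable_fun setT (fun w : V * V => v w.2).
  exact: (measurableT_comp mv measurable_snd).
pose G (w : V * V) := (v w.1 - v w.2) ^+ 2 / enorm (w.1 - w.2) `^ (N%:R + 2 * s).
have G0 w : 0 <= G w by rewrite /G -powRN mulr_ge0 ?sqr_ge0.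
have mG : measurable_fun setT G.
  rewrite /G; under eq_fun do rewrite -powRN.
  by apply: measM; [apply: measX; exact: measB|apply: measpow; exact: measurable_enorm].
rewrite ge0_muleDr; last 2 first.
- by apply: integral_ge0 => x _; rewrite lee_fin sqr_ge0.
- by apply: integral_ge0 => w _; rewrite lee_fin G0.
congr (_ + _)%E.
  rewrite -ge0_integralZl_real; [|exact: measurableT|by mfun|by move=> *; exact: sqr_ge0|by []].
  by apply: eq_integral => x _; rewrite exprMn.
rewrite -(@ge0_integralZl_real _ _ _ _ setT (c ^+ 2) G); [|exact: measurableT|exact: mG|by move=> *; exact: G0|by []].
by apply: eq_integral => w _; rewrite /G -mulrBr exprMn mulrA.
Qed.

Lemma LnormZ c v (Omega : set V) : measurable Omega -> measurable_fun setT v ->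
  ('N[L]_2%:E[EFin \o ((fun x => c * v x)%R \_ Omega)] =
   `|c|%:E * 'N[L]_2%:E[EFin \o (v \_ Omega)])%E.
Proof.
move=> mO mv; rewrite unlock /=.
have mvO : measurable_fun setT (v \_ Omega).
  by apply/(measurable_restrictT _ mO); exact: measurable_funTS.
rewrite (eq_integral (fun x => ((`|c| `^ 2) * (`|(v \_ Omega) x| `^ 2))%:E)); last first.
  move=> x _; rewrite /= -powRM//; congr (_ `^ _)%:E.
  by rewrite -normrM; congr (`|_|); rewrite !patchE; case: ifP; rewrite ?mulr0.
rewrite ge0_integralZl_real; [|exact: measurableT|by apply: measpow; exact: measnorm|by move=> *; exact: powR_ge0|exact: powR_ge0].
rewrite poweRM; last 2 first.
- by rewrite lee_fin powR_ge0.
- by apply: integral_ge0 => x _; rewrite lee_fin powR_ge0.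
rewrite poweR_EFin -powRrM mulfV ?powRr1// ?pnatr_eq0//.
Qed.

Lemma Lnorm2_lty v (Omega : set V) : measurable Omega -> measurable_fun setT v ->
  (\int[L]_x (v x ^+ 2)%:E < +oo)%E ->
  ('N[L]_2%:E[EFin \o (v \_ Omega)] < +oo)%E.
Proof.
move=> mO mv v2; rewrite unlock /=; apply: poweR_lty; apply: le_lt_trans v2.
have mvO : measurable_fun setT (v \_ Omega).
  by apply/(measurable_restrictT _ mO); exact: measurable_funTS.
apply: ge0_le_integral; [exact: measurableT| | | |].
- by move=> x _; rewrite lee_fin powR_ge0.
- by apply: measEFin; apply: measpow; exact: measnorm.
- by mfun.
- move=> x _; rewrite lee_fin powR_mulrn// patchE real_normK ?num_real//.
  by case: ifP => _ //; rewrite expr0n/= sqr_ge0.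
Qed.

Lemma integrable_mul_bounded (g v : V -> R) C : measurable_fun setT g -> measurable_fun setT v ->
  (forall x, `|g x| <= C) -> L.-integrable setT (EFin \o v) ->
  L.-integrable setT (fun x => (g x * v x)%:E).
Proof.
move=> mg mv gC /integrableP[_ iv].
have C0 : 0 <= C by exact: le_trans (gC 0).
apply: (integrable_dominated (g := fun x => C * `|v x|)).
- exact: measM.
- by apply: measM; [exact: measurable_cst|exact: measnorm].
- by move=> x; rewrite normrM ler_wpM2r.
- rewrite ge0_integralZl_real; [|exact: measurableT|exact: measnorm|by move=> *; exact: normr_ge0|by []].
  by apply: lte_mul_pinfty; [rewrite lee_fin|by []|exact: iv].
Qed.

End scaling.

Section time_power.
Context {R : realType}.
Local Notation mu := (@lebesgue_measure R).
Implicit Types (T t r : R).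

Lemma exprB_lip T k : 0 <= T -> exists2 K : R, 0 <= K &
  forall a b, 0 <= a <= T -> 0 <= b <= T -> `|a ^+ k - b ^+ k| <= K * `|a - b|.
Proof.
move=> T0; elim: k => [|k [K K0 IH]].
  by exists 0 => // a b _ _; rewrite subrr normr0 mul0r.
exists (T * K + T ^+ k).
  by rewrite addr_ge0 ?mulr_ge0 ?exprn_ge0.
move=> a b aT bT; have /andP[a0 aT'] := aT; have /andP[b0 bT'] := bT.
have -> : a ^+ k.+1 - b ^+ k.+1 = a * (a ^+ k - b ^+ k) + b ^+ k * (a - b).
  by rewrite !exprS; ring.
apply: (le_trans (ler_normD _ _)); rewrite !normrM mulrDl; apply: lerD.
  rewrite -mulrA; apply: ler_pM => //; last exact: IH.
  by rewrite ger0_norm.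
rewrite ler_wpM2r// ger0_norm ?exprn_ge0//.
by rewrite lerXn2r// nnegrE.
Qed.

Lemma is_derive_tpow T m t : is_derive t 1 (fun r => (T - r) ^+ m.+1)
  (- (m.+1%:R * (T - t) ^+ m)).
Proof.
have h : is_derive (t : R^o) (1 : R^o) ((cst T : R^o -> R^o) \+ (-%R : R^o -> R^o)) (0 + (-1)).
  by apply: is_deriveD.
rewrite add0r in h.
have h2 := @is_deriveX _ _ (fun r : R => T - r) m.+1 t 1 (-1) h.
have -> : - (m.+1%:R * (T - t) ^+ m) = (m.+1%:R * (T - t) ^+ m.+1.-1) *: (-1 : R^o).
  by rewrite /GRing.scale/= mulrN1.
rewrite (_ : (fun r => (T - r) ^+ m.+1) = (fun r : R => T - r) ^+ m.+1)//.
by apply/funext => r; rewrite fctE.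
Qed.

Lemma is_derive_tpowZ T m (c t : R) :
  is_derive t 1 (fun r : R => (T - r) ^+ m.+1 * c) (- (m.+1%:R * (T - t) ^+ m) * c).
Proof.
have := is_deriveZ c (is_derive_tpow T m t).
rewrite /GRing.scale/= mulrC.
by rewrite (_ : (c \*: (fun r => (T - r) ^+ m.+1))%R = (fun r => (T - r) ^+ m.+1 * c))//;
  apply/funext => r; rewrite /GRing.scale/= mulrC.
Qed.

Lemma continuous_tpow T m : continuous (fun r : R => (T - r) ^+ m).
Proof.
move=> t; case: m => [|m].
  by under eq_fun do rewrite expr0; exact: cvg_cst.
apply: differentiable_continuous; apply/derivable1_diffP.
by have [] := is_derive_tpow T m t.
Qed.

Lemma integral_tpow T m t : t <= T ->
  (\int[mu]_(r in `]t, T[) (m.+1%:R * (T - r) ^+ m)%:E = ((T - t) ^+ m.+1)%:E)%E.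
Proof.
rewrite le_eqVlt => /predU1P[->|tT].
  by rewrite set_itvoo0 integral_set0 subrr expr0n.
rewrite -(@integral_itv_bndoo _ t T (fun r => (m.+1%:R * (T - r) ^+ m)%:E) true false); last first.
  apply: measEFin; apply: measM; first exact: measurable_cst.
  by apply: measX; apply: measB; [exact: measurable_cst|exact: measurable_id].
have h r : is_derive r 1 (fun r => - (T - r) ^+ m.+1) (m.+1%:R * (T - r) ^+ m).
  by have := is_deriveN (is_derive_tpow T m r); rewrite opprK.
have hc r : {for r, continuous (fun r => - (T - r) ^+ m.+1)}.
  by apply: differentiable_continuous; apply/derivable1_diffP; have [] := h r.
rewrite (@continuous_FTC2 _ _ (fun r => - (T - r) ^+ m.+1)) //.
- by rewrite subrr expr0n/= oppr0 -EFinB sub0r opprK.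
- apply: continuous_subspaceT => r; apply: cvgM; first exact: cvg_cst.
  exact: continuous_tpow.
- split.
  + by move=> r _; have [] := h r.
  + by apply: cvg_at_right_filter; exact: hc.
  + by apply: cvg_at_left_filter; exact: hc.
- by move=> r _; rewrite derive1E derive_val.
Qed.

Lemma integrable_tpow T m t : mu.-integrable `]t, T[ (fun r => ((T - r) ^+ m)%:E).
Proof.
have h : mu.-integrable `[t, T] (EFin \o (fun r => (T - r) ^+ m)).
  apply: continuous_compact_integrable; first exact: segment_compact.
  by apply: continuous_subspaceT; exact: continuous_tpow.
by apply: integrableS h => //; exact: subset_itv_oo_cc.
Qed.

End time_power.

(** * Bump functions times powers of T - t in the test class *)

Lemma ler_mulD4 (R : realType) (a b c d : R) :
  0 <= a * d -> 0 <= b * c -> a * c + b * d <= (a + b) * (c + d).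
Proof. by move=> h1 h2; rewrite mulrDr !mulrDl; lra. Qed.

Section test_function.
Context {R : realType} (N : nat).
Local Notation L := (leb R N).
Local Notation mu := (@lebesgue_measure R).
Local Notation V := ('rV[R]_N).
Implicit Types (e t r : R) (x y z : 'rV[R]_N).
Variables (s : R) (psi : 'rV[R]_N -> R) (M rho : R).
Hypothesis (s01 : 0 < s < 1).
Hypotheses (M0 : 0 <= M) (mpsi : measurable_fun setT psi).
Hypothesis psiM : forall x, `|psi x| <= M.
Hypothesis psiL : forall x y, `|psi x - psi y| <= M * enorm (x - y).
Hypothesis psi2 : forall x z, `|psi (x + z) + psi (x - z) - 2 * psi x| <= M * enorm z ^+ 2.
Hypotheses (rho0 : 0 < rho) (psi0 : forall x, rho <= enorm x -> psi x = 0).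
Variables (Omega : set V) (D T : R) (m : nat).
Hypotheses (oOmega : open Omega) (OmegaD : forall x, Omega x -> enorm x < D).
Hypotheses (ballO : eball (0 : V) rho `<=` Omega) (T0 : 0 < T).

Definition test_fun x t : R := (T - t) ^+ m.+1 * psi x.

Let mO : measurable Omega. Proof. exact: open_rV_measurable. Qed.

Let finO : (L Omega < +oo)%E.
Proof.
apply: (@le_lt_trans _ _ (L (eball (0 : V) `|D|))).
  apply: le_measure; rewrite ?inE//; first exact: measurable_eball.
  by move=> x Ox; rewrite /eball/= subr0; apply: (lt_le_trans (OmegaD Ox)); exact: ler_norm.
by apply: leb_eball_lty.
Qed.

Let psiO x : ~ Omega x -> psi x = 0.
Proof.
move=> nO; apply: psi0; rewrite leNgt; apply/negP => h; apply: nO; apply: ballO.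
by rewrite /eball/= subr0.
Qed.

Section scaled.
Variable c : R.
Let cpsi x := c * psi x.
Let cM0 : 0 <= `|c| * M. Proof. exact: mulr_ge0. Qed.
Let mc : measurable_fun setT cpsi. Proof. by apply: measM => //; exact: measurable_cst. Qed.
Let cpsiM x : `|cpsi x| <= `|c| * M. Proof. by rewrite normrM ler_wpM2l. Qed.
Let cpsiL x y : `|cpsi x - cpsi y| <= `|c| * M * enorm (x - y).
Proof. by rewrite -mulrBr normrM -mulrA ler_wpM2l. Qed.
Let cpsi2 x z : `|cpsi (x + z) + cpsi (x - z) - 2 * cpsi x| <= `|c| * M * enorm z ^+ 2.
Proof.
rewrite (_ : cpsi (x + z) + cpsi (x - z) - 2 * cpsi x = c * (psi (x + z) + psi (x - z) - 2 * psi x)).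
  by rewrite normrM -mulrA ler_wpM2l.
by rewrite /cpsi; ring.
Qed.
Let cpsi0 x : rho <= enorm x -> cpsi x = 0.
Proof. by move=> h; rewrite /cpsi psi0// mulr0. Qed.

Lemma has_fraclap_scaled x : has_fraclap s cpsi x.
Proof. by apply: (has_fraclap_bump cM0 mc cpsiM cpsi2). Qed.

Lemma fraclap_scaled x : fraclap s cpsi x = c * fraclap s psi x.
Proof.
rewrite (@fraclap_bump _ _ _ _ cM0 mc cpsiM cpsi2 s x s01).
rewrite (@fraclap_bump _ _ _ _ M0 mpsi psiM psi2 s x s01).
rewrite mulrCA; congr (_ * _); rewrite /Lop.
rewrite -RintegralZl; [|exact: measurableT|exact: (integrable_sdiff M0 mpsi psiM psi2 x s01)].
by congr fine; apply: eq_integral => z _; congr EFin; rewrite /sdiff /cpsi; ring.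
Qed.

Lemma H0s_scaled : H0s Omega s cpsi.
Proof.
split => //.
  exact: (Hs_normsq_bump s01 cM0 mc cpsiM cpsiL rho0 cpsi0).
by apply: aeW => x nO; rewrite /cpsi psiO// mulr0.
Qed.

Lemma form_scaled v : H0s Omega s v ->
  fraclap_form s cpsi v = c * \int[L]_(x in Omega) (fraclap s psi x * v x).
Proof.
move=> hv.
rewrite (fraclap_form_bump s01 cM0 mc cpsiM cpsiL cpsi2 rho0 cpsi0 mO finO hv).
have iv := integrable_H0s mO finO hv.
have mv : measurable_fun setT v by case: hv.
have mfr : measurable_fun setT (fraclap s psi).
  rewrite (_ : fraclap s psi = fun x => fraclap_const N s * Lop psi s x).
    by apply: measM; [exact: measurable_cst|exact: (measurable_Lop s01 M0 mpsi psiM psi2)].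
  by apply/funext => x; exact: (@fraclap_bump _ _ _ _ M0 mpsi psiM psi2 s x s01).
have i1 : L.-integrable setT (fun x => (fraclap s psi x * v x)%:E).
  apply: (integrable_mul_bounded (C := `|fraclap_const N s| * (2 * M * kernel_mass N s))) => //.
  move=> x; rewrite (@fraclap_bump _ _ _ _ M0 mpsi psiM psi2 s x s01) normrM ler_wpM2l//.
  exact: (Lop_bounded M0 mpsi psiM psi2).
rewrite -RintegralZl; [|exact: mO|exact: (integrableS measurableT mO (@subsetT _ _) i1)].
by congr fine; apply: eq_integral => x _; rewrite fraclap_scaled mulrA.
Qed.
End scaled.

Let ell x := fraclap s psi x.
Let ellE x : ell x = fraclap_const N s * Lop psi s x.
Proof. exact: (@fraclap_bump _ _ _ _ M0 mpsi psiM psi2 s x s01). Qed.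
Let CL := `|fraclap_const N s| * (2 * M * kernel_mass N s).
Let ellC x : `|ell x| <= CL.
Proof.
by rewrite ellE normrM ler_wpM2l//; exact: (Lop_bounded M0 mpsi psiM psi2).
Qed.
Let CL0 : 0 <= CL. Proof. exact: le_trans (ellC 0). Qed.

Lemma measurable_fraclap_bump : measurable_fun setT (fraclap s psi).
Proof.
rewrite (_ : fraclap s psi = fun x => fraclap_const N s * Lop psi s x).
  by apply: measM; [exact: measurable_cst|exact: (measurable_Lop s01 M0 mpsi psiM psi2)].
by apply/funext => x; exact: ellE.
Qed.

Let rhs x t : R := m.+1%:R * (T - t) ^+ m * psi x + (T - t) ^+ m.+1 * ell x.

(* Any exponent e with s + e < 1 would do. *)
Let e := (1 - s) / 2.
Let e0 : 0 < e. Proof. by case/andP: s01 => s0 s1; rewrite divr_gt0// subr_gt0. Qed.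
Let e1 : e < 1. Proof. by case/andP: s01 => s0 s1; rewrite /e; lra. Qed.
Let se1 : s + e < 1. Proof. by case/andP: s01 => s0 s1; rewrite /e; lra. Qed.

Let psi_hoelder x y : `|psi x - psi y| <= 2 * M * enorm (x - y) `^ e.
Proof.
have h1 : `|psi x - psi y| <= 2 * M.
  by apply: (le_trans (ler_normB _ _)); have := psiM x; have := psiM y; lra.
case: (leP (enorm (x - y)) 1) => h.
  apply: (le_trans (psiL x y)); apply: ler_pM => //; first exact: enorm_ge0.
    by rewrite ler_peMl// ler1n.
  have [->|xy] := eqVneq (enorm (x - y)) 0; first exact: powR_ge0.
  apply: ger1_powR; last exact: ltW.
  by rewrite h lt_neqAle eq_sym xy enorm_ge0.
apply: (le_trans h1); rewrite ler_peMr ?mulr_ge0//.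
by rewrite -[leLHS](powRr0 (enorm (x - y))) ler_powR// ltW.
Qed.

Let Ch := `|fraclap_const N s| * (2 * M * (kernel_mass N (s + e) + kernel_mass N s) * 2).
Let ell_hoelder x y : `|ell x - ell y| <= Ch * enorm (x - y) `^ e.
Proof.
have /andP[s0 s1] := s01.
rewrite !ellE -mulrBr normrM /Ch -mulrA ler_wpM2l//.
exact: (Lop_hoelder M0 mpsi psiM psiL psi2 x y s0 e0 se1).
Qed.

Let TtP t : 0 <= t <= T -> 0 <= T - t <= T.
Proof. by move=> /andP[? ?]; apply/andP; split; lra. Qed.

Let pow_bound k t : 0 <= t <= T -> 0 <= (T - t) ^+ k <= T ^+ k.
Proof.
move=> /TtP/andP[h1 h2]; rewrite exprn_ge0//=.
by rewrite lerXn2r// nnegrE ltW.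
Qed.

Let abs_pow k t : 0 <= t <= T -> `|(T - t) ^+ k| <= T ^+ k.
Proof. by move=> h; have /andP[h1 h2] := pow_bound k h; rewrite ger0_norm. Qed.

Let ltr_itv t : 0 < t < T -> 0 <= t <= T.
Proof. by move=> /andP[/ltW-> /ltW->]. Qed.

Let bounded_Hoelder_rhs : bounded_Hoelder Omega T rhs.
Proof.
have Tk k : 0 <= T ^+ k by rewrite exprn_ge0// ltW.
have m0 : 0 <= m.+1%:R :> R by exact: ler0n.
split.
  exists (m.+1%:R * T ^+ m * M + T ^+ m.+1 * CL) => x t _ /ltr_itv ht.
  apply: (le_trans (ler_normD _ _)); apply: lerD.
    rewrite 2!normrM; apply: ler_pM; [by rewrite mulr_ge0|by []| |exact: psiM].
    by rewrite ger0_norm// ler_wpM2l// abs_pow.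
  rewrite (normrM _ (ell x)).
  exact: (ler_pM (normr_ge0 _) (normr_ge0 _) (abs_pow _ ht) (ellC x)).
have [K1 K10 K1P] := @exprB_lip R T m (ltW T0).
have [K2 K20 K2P] := @exprB_lip R T m.+1 (ltW T0).
pose CA := m.+1%:R * T ^+ m * (2 * M) + T ^+ m.+1 * Ch.
pose CB := (m.+1%:R * K1 * M + K2 * CL) * T `^ (2^-1).
have km0 sg : 0 <= kernel_mass N sg :> R.
  by rewrite /kernel_mass; apply: Rintegral_ge0 => z _; exact: min1riesz_ge0.
have Ch0 : 0 <= Ch.
  rewrite /Ch mulr_ge0 ?normr_ge0// mulr_ge0 ?ler0n// mulr_ge0 ?mulr_ge0 ?ler0n//.
  by rewrite addr_ge0.
have CA0 : 0 <= CA by exact: addr_ge0 (mulr_ge0 (mulr_ge0 m0 (Tk m)) (mulr_ge0 (ler0n _ 2) M0)) (mulr_ge0 (Tk m.+1) Ch0).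
have CB0 : 0 <= CB.
  exact: mulr_ge0 (addr_ge0 (mulr_ge0 (mulr_ge0 m0 K10) M0) (mulr_ge0 K20 CL0)) (powR_ge0 _ _).
exists e, 2^-1, (CA + CB); split; [by rewrite e0 e1|by apply/andP; split; lra|].
move=> x y t r _ _ /ltr_itv ht /ltr_itv hr.
set E := enorm (x - y) `^ e; set F := `|t - r| `^ 2^-1.
have E0 : 0 <= E by exact: powR_ge0.
have F0 : 0 <= F by exact: powR_ge0.
have tr : `|t - r| <= T `^ 2^-1 * F.
  have TtR : `|t - r| <= T.
    by rewrite ler_norml; move: ht hr => /andP[? ?] /andP[? ?]; apply/andP; split; lra.
  have -> : `|t - r| = `|t - r| `^ 2^-1 * F.
    by rewrite /F powR12_sqrt// -expr2 sqr_sqrtr.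
  rewrite ler_wpM2r//; apply: ge0_ler_powR => //.
  by rewrite nnegrE ltW.
have Ttr : `|(T - t) - (T - r)| = `|t - r|.
  by rewrite -normrN; congr (`|_|); ring.
have -> : rhs x t - rhs y r =
    (m.+1%:R * (T - t) ^+ m * (psi x - psi y) + (T - t) ^+ m.+1 * (ell x - ell y)) +
    (m.+1%:R * ((T - t) ^+ m - (T - r) ^+ m) * psi y + ((T - t) ^+ m.+1 - (T - r) ^+ m.+1) * ell y).
  rewrite /rhs; generalize (ell x) (ell y) (psi x) (psi y) => a b c d; ring.
apply: (@le_trans _ _ (CA * E + CB * F)); last first.
  exact: (ler_mulD4 (mulr_ge0 CA0 F0) (mulr_ge0 CB0 E0)).
apply: (le_trans (ler_normD _ _)); apply: lerD.
  rewrite /CA mulrDl; apply: (le_trans (ler_normD _ _)); apply: lerD.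
    rewrite 2!normrM -[leRHS]mulrA; apply: ler_pM; [by rewrite mulr_ge0|by []| |exact: psi_hoelder].
    by rewrite ger0_norm// ler_wpM2l// abs_pow.
  rewrite (normrM _ (ell x - ell y)) -[leRHS]mulrA.
  exact: (ler_pM (normr_ge0 _) (normr_ge0 _) (abs_pow _ ht) (ell_hoelder x y)).
have h1 : `|(T - t) ^+ m - (T - r) ^+ m| <= K1 * (T `^ 2^-1 * F).
  apply: (le_trans (K1P _ _ (TtP ht) (TtP hr))); rewrite Ttr ler_wpM2l//.
have h2 : `|(T - t) ^+ m.+1 - (T - r) ^+ m.+1| <= K2 * (T `^ 2^-1 * F).
  apply: (le_trans (K2P _ _ (TtP ht) (TtP hr))); rewrite Ttr ler_wpM2l//.
have -> : CB * F = m.+1%:R * (K1 * (T `^ 2^-1 * F)) * M + K2 * (T `^ 2^-1 * F) * CL.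
  by rewrite /CB; ring.
apply: (le_trans (ler_normD _ _)); apply: lerD.
  rewrite 2!normrM; apply: ler_pM; [by rewrite mulr_ge0|by []| |exact: psiM].
  by rewrite ger0_norm// ler_wpM2l.
rewrite (normrM _ (ell y)).
exact: (ler_pM (normr_ge0 _) (normr_ge0 _) h2 (ellC y)).
Qed.

Let psi2lty : (\int[L]_x (psi x ^+ 2)%:E < +oo)%E.
Proof.
have := Hs_normsq_bump s01 M0 mpsi psiM psiL rho0 psi0; rewrite /Hs_normsq.
apply: le_lt_trans; rewrite leeDl// integral_ge0// => w _.
by rewrite lee_fin -powRN mulr_ge0 ?sqr_ge0.
Qed.

Let C_Lp_test_fun : C_Lp `[0, T] Omega 2%:E test_fun.
Proof.
have N2 := Lnorm2_lty mO mpsi psi2lty.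
have N2fin : 'N[L]_2%:E[EFin \o (psi \_ Omega)]%E \is a fin_num.
  by rewrite ge0_fin_numE ?Lnorm_ge0.
split.
  move=> t _; split.
    by apply: measurable_funTS; apply: measM => //; exact: measurable_cst.
  rewrite (LnormZ ((T - t) ^+ m.+1) mO mpsi).
  by apply: lte_mul_pinfty; [rewrite lee_fin|by []|exact: N2].
move=> t0 _; apply: cvg_within_filter.
have -> : (fun t => 'N[L]_2%:E[EFin \o ((fun x => test_fun x t - test_fun x t0)%R \_ Omega)]%E) =
    (fun t => (`|(T - t) ^+ m.+1 - (T - t0) ^+ m.+1| * fine 'N[L]_2%:E[EFin \o (psi \_ Omega)])%:E)%E.
  apply/funext => t.
  rewrite (_ : (fun x => test_fun x t - test_fun x t0)%R = (fun x => ((T - t) ^+ m.+1 - (T - t0) ^+ m.+1) * psi x)).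
    by rewrite (LnormZ _ mO mpsi) EFinM fineK.
  by apply/funext => x; rewrite /test_fun mulrBl.
apply: cvg_EFin; first by apply: nearW.
set n := fine 'N[L]_2%:E[EFin \o (psi \_ Omega)]%E.
have c : (fun t => `|(T - t) ^+ m.+1 - (T - t0) ^+ m.+1| * n) @ t0 -->
    `|(T - t0) ^+ m.+1 - (T - t0) ^+ m.+1| * n.
  apply: cvgM; last exact: cvg_cst.
  apply: cvg_norm; apply: cvgB; last exact: cvg_cst.
  exact: continuous_tpow.
by move: c; rewrite subrr normr0 mul0r; exact.
Qed.

Let weak_eq t v : 0 <= t <= T -> H0s Omega s v ->
  \int[L]_(x in Omega) (test_fun x t * v x)
  + \int[mu]_(r in `]t, T[) fraclap_form s (test_fun^~ r) v
  = \int[mu]_(r in `]t, T[) \int[L]_(x in Omega) (rhs x r * v x).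
Proof.
move=> /andP[t0 tT] hv.
have iv := integrable_H0s mO finO hv.
have mv : measurable_fun setT v by case: hv.
have i1 : L.-integrable Omega (EFin \o (fun x => psi x * v x)).
  by apply: (integrableS measurableT mO (@subsetT _ _)); exact: (integrable_mul_bounded mpsi mv psiM iv).
have i2 : L.-integrable Omega (EFin \o (fun x => ell x * v x)).
  apply: (integrableS measurableT mO (@subsetT _ _)).
  exact: (integrable_mul_bounded measurable_fraclap_bump mv ellC iv).
set B := \int[L]_(x in Omega) (psi x * v x).
set A := \int[L]_(x in Omega) (ell x * v x).
have E1 : \int[L]_(x in Omega) (test_fun x t * v x) = (T - t) ^+ m.+1 * B.
  rewrite /B -RintegralZl//; congr fine; apply: eq_integral => x _.
  by rewrite /test_fun mulrA.
have E2 : \int[mu]_(r in `]t, T[) fraclap_form s (test_fun^~ r) v =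
    \int[mu]_(r in `]t, T[) ((T - r) ^+ m.+1 * A).
  congr fine; apply: eq_integral => r _; congr EFin.
  exact: (form_scaled ((T - r) ^+ m.+1) hv).
have E3 : \int[mu]_(r in `]t, T[) \int[L]_(x in Omega) (rhs x r * v x) =
   \int[mu]_(r in `]t, T[) (m.+1%:R * (T - r) ^+ m * B + (T - r) ^+ m.+1 * A).
  congr fine; apply: eq_integral => r _; congr EFin.
  rewrite /A /B -RintegralZl// -RintegralZl// -RintegralD//; last 2 first.
  - exact: (integrableZl mO (m.+1%:R * (T - r) ^+ m) i1).
  - exact: (integrableZl mO ((T - r) ^+ m.+1) i2).
  by congr fine; apply: eq_integral => x _; congr EFin; rewrite /rhs; ring.
have mitv : measurable (`]t, T[%classic : set (measurableTypeR R)) by exact: measurable_itv.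
have j1 : mu.-integrable `]t, T[ (EFin \o (fun r => m.+1%:R * (T - r) ^+ m)).
  have := @integrableZl _ _ _ mu _ mitv m.+1%:R _ (integrable_tpow T m t).
  by apply: eq_integrable.
have j2 : mu.-integrable `]t, T[ (EFin \o (fun r => (T - r) ^+ m.+1)).
  exact: (integrable_tpow T m.+1 t).
have E4 : \int[mu]_(r in `]t, T[) (m.+1%:R * (T - r) ^+ m) = (T - t) ^+ m.+1.
  by rewrite /Rintegral integral_tpow.
rewrite E1 E2 E3 (RintegralD mitv (integrableZr mitv B j1) (integrableZr mitv A j2)).
congr (_ + _).
by rewrite -E4 -(RintegralZr B mitv j1).
Qed.

(** As a function of t everything is an explicit polynomial, and in x the
    regularity needed is that of psi and of its fractional Laplacian; the weak
    form reduces to [fraclap_form_bump] and an integration of (T - t)^m. *)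
Lemma test_class_bump : test_class Omega s T test_fun.
Proof.
exists rhs; split.
- exact: bounded_Hoelder_rhs.
- move=> x t Ox tT; have hd := is_derive_tpowZ T m (psi x) t.
  split; [by have [] := hd| |].
    exact: (@has_fraclap_scaled ((T - t) ^+ m.+1) x).
  rewrite (@fraclap_scaled ((T - t) ^+ m.+1)) derive1E.
  rewrite (_ : 'D_1 (test_fun x) t = - (m.+1%:R * (T - t) ^+ m) * psi x).
    by rewrite mulNr opprK.
  exact: derive_val.
- by move=> x t nO _; rewrite /test_fun psiO// mulr0.
- by move=> x _; rewrite /test_fun subrr expr0n mul0r.
- split; last first.
    exists (T ^+ m.+1 * M) => x t tT; rewrite normrM.
    by apply: ler_pM; [by []|by []|exact: abs_pow|exact: psiM].
  split.
  + apply: measurable_funTS; apply: measM; last exact: (measurableT_comp mpsi measurable_fst).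
    by apply: measX; apply: measB; [exact: measurable_cst|exact: measurable_snd].
  + exact: C_Lp_test_fun.
  + by apply: aeW => t _; exact: (H0s_scaled ((T - t) ^+ m.+1)).
  + have H0 : (0 <= Hs_normsq s psi)%E.
      by rewrite /Hs_normsq adde_ge0// integral_ge0// => w _; rewrite lee_fin ?sqr_ge0// -powRN mulr_ge0 ?sqr_ge0.
    have Hfin : Hs_normsq s psi \is a fin_num.
      by rewrite ge0_fin_numE//; exact: (Hs_normsq_bump s01 M0 mpsi psiM psiL rho0 psi0).
    have -> : (\int[mu]_(t in `]0%R, T[) Hs_normsq s (test_fun^~ t))%E =
        (\int[mu]_(t in `]0%R, T[) (fine (Hs_normsq s psi) * (T - t) ^+ (m.+1 * 2))%:E)%E.
      apply: eq_integral => t _.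
      rewrite (Hs_normsqZ s ((T - t) ^+ m.+1) mpsi) -{1}(fineK Hfin) -EFinM; congr EFin.
      by rewrite mulrC exprM.
    have j := integrable_tpow T (m.+1 * 2) 0.
    have mitv : measurable (`]0, T[%classic : set (measurableTypeR R)) by exact: measurable_itv.
    have jj := integrableZl mitv (fine (Hs_normsq s psi)) j.
    have /integrableP[_] := jj.
    apply: le_lt_trans; apply: le_trans (le_abse_integral _ _ _) => //.
      exact: lee_abs.
    exact: measurable_int jj.
  + by move=> t tT v hv; exact: weak_eq.
Qed.

End test_function.

(** * Convergent integrals with their values *)

Section has_integral.
Context d (T : measurableType d) (R : realType) (m : {measure set T -> \bar R}).
Implicit Types (D : set T) (f g : T -> R) (I J c : R).

(** Keeping integrability and value together lets linear combinations of
    integrals be handled as real numbers. *)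
Definition has_integral D f I :=
  m.-integrable D (EFin \o f) /\ (\int[m]_(x in D) (f x)%:E = I%:E)%E.

Lemma has_integral_Rintegral D f : measurable D -> m.-integrable D (EFin \o f) ->
  has_integral D f (\int[m]_(x in D) f x).
Proof.
move=> mD h; split; first exact: h.
by rewrite /Rintegral fineK//; exact: (integrable_fin_num mD h).
Qed.

Lemma has_integralD D f g I J : measurable D -> has_integral D f I -> has_integral D g J ->
  has_integral D (fun x => f x + g x) (I + J).
Proof.
move=> mD [i1 e1] [i2 e2]; split.
  exact: (integrableD mD i1 i2).
transitivity (\int[m]_(x in D) ((EFin \o f) \+ (EFin \o g)) x)%E.
  by apply: eq_integral => x _.
by rewrite (integralD_EFin mD i1 i2) EFinD -e1 -e2.
Qed.

Lemma has_integralZ D f I c : measurable D -> has_integral D f I ->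
  has_integral D (fun x => c * f x) (c * I).
Proof.
move=> mD [i1 e1]; split.
  exact: (integrableZl mD c i1).
transitivity (\int[m]_(x in D) (c%:E * (EFin \o f) x))%E.
  by apply: eq_integral => x _.
by rewrite (integralZl mD i1 c) EFinM -e1.
Qed.

Lemma has_integralB D f g I J : measurable D -> has_integral D f I -> has_integral D g J ->
  has_integral D (fun x => f x - g x) (I - J).
Proof.
move=> mD h1 h2; have := has_integralD mD h1 (has_integralZ (-1) mD h2).
rewrite mulN1r; congr (has_integral _ _ _).
by apply/funext => x; rewrite mulN1r.
Qed.

Lemma has_integral_eq D f g I : measurable D -> (forall x, D x -> f x = g x) ->
  has_integral D f I -> has_integral D g I.
Proof.
move=> mD fg [i e]; split.
  by apply: (eq_integrable mD _ _ _ i) => x; rewrite inE /= => Dx; rewrite fg.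
by rewrite -e; apply: eq_integral => x; rewrite inE /= => Dx; rewrite fg.
Qed.

Lemma has_integral_le D f g I J : measurable D -> has_integral D f I -> has_integral D g J ->
  (forall x, D x -> f x <= g x) -> I <= J.
Proof.
move=> mD [i1 e1] [i2 e2] fg; rewrite -lee_fin -e1 -e2.
by apply: (le_integral mD i1 i2) => x; rewrite inE /= => Dx; rewrite lee_fin fg.
Qed.

Lemma has_integral0 D : measurable D -> has_integral D (fun=> 0) 0.
Proof. by move=> mD; split; [exact: integrable0|exact: integral0]. Qed.

Lemma ge0_int_is D f : measurable D -> measurable_fun D f ->
  (forall x, D x -> 0 <= f x) -> (\int[m]_(x in D) (f x)%:E < +oo)%E ->
  has_integral D f (fine (\int[m]_(x in D) (f x)%:E)%E).
Proof.
move=> mD mf f0 foo.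
have p0 : (0 <= \int[m]_(x in D) (f x)%:E)%E.
  by apply: integral_ge0 => x Dx; rewrite lee_fin f0.
split; last by rewrite fineK// ge0_fin_numE.
apply/integrableP; split; first exact: measEFin.
apply: le_lt_trans foo; rewrite le_eqVlt; apply/orP; left; apply/eqP.
by apply: eq_integral => x; rewrite inE /= => Dx; rewrite ger0_norm ?f0.
Qed.
End has_integral.

Section has_integral_leb.
Context {R : realType} (N : nat).
Local Notation L := (leb R N).

Lemma has_integral_shift (h : 'rV[R]_N) (f : 'rV[R]_N -> R) I : measurable_fun setT f -> has_integral L setT f I ->
  has_integral L setT (fun x : 'rV[R]_N => f (x + h)) I.
Proof.
move=> mf [i e]; split.
  have mfh : measurable_fun setT (fun x : 'rV[R]_N => f (x + h)).
    by apply: (measurableT_comp mf); apply: measurable_rVD; [exact: measurable_id|exact: measurable_cst].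
  apply/integrableP; split; first exact: measEFin.
  have /integrableP[_] := i; apply: le_lt_trans.
  have mn : measurable_fun setT (fun x => (`|f x|)%:E) by apply: measEFin; exact: measnorm.
  have n0 x : (0 <= (`|f x|)%:E)%E by rewrite lee_fin.
  by rewrite -(@ge0_leb_shift R N h _ mn n0).
rewrite -e; exact: (@integral_leb_shift R N h (EFin \o f) (measEFin mf)).
Qed.

Lemma has_integral_opp (f : 'rV[R]_N -> R) I : measurable_fun setT f -> has_integral L setT f I ->
  has_integral L setT (fun x : 'rV[R]_N => f (- x)) I.
Proof.
move=> mf [i e]; split.
  have mfh : measurable_fun setT (fun x : 'rV[R]_N => f (- x)).
    by apply: (measurableT_comp mf); apply: measurable_rVN; exact: measurable_id.
  apply/integrableP; split; first exact: measEFin.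
  have /integrableP[_] := i; apply: le_lt_trans.
  have mn : measurable_fun setT (fun x => (`|f x|)%:E) by apply: measEFin; exact: measnorm.
  have n0 x : (0 <= (`|f x|)%:E)%E by rewrite lee_fin.
  by rewrite -(@ge0_leb_opp R N _ mn n0).
rewrite -e; exact: (@integral_leb_opp R N (EFin \o f) (measEFin mf)).
Qed.

End has_integral_leb.

(** * Comparison with powers *)

Section comparison.
Context {R : realType} (N : nat).
Local Notation mu := (@lebesgue_measure R).
Local Notation L := (leb R N).
Variables (s : R) (x : 'rV[R]_N).
Hypotheses (s01 : 0 < s < 1) (N0 : (0 < N)%N) (x0 : x != 0).
Local Notation p := (N%:R / 2 + s).
Local Notation kap := (Gamma_integral (1 - s) / s).
Implicit Types (a t : R) (z : 'rV[R]_N).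

Let mnpow a : measurable_fun setT (fun y : 'rV[R]_N => enorm y `^ (- a)).
Proof. by apply: measpow; apply: measurable_enorm; exact: measurable_id. Qed.

Let gauss_is t : 0 < t ->
  has_integral L setT (fun z => expR (- (t * enorm z ^+ 2))) ((pi / t) `^ (N%:R / 2)).
Proof.
move=> t0.
have mg : measurable_fun setT (fun z : 'rV[R]_N => expR (- (t * enorm z ^+ 2))).
  apply: measexp; apply: measN; apply: measM; first exact: measurable_cst.
  by apply: measX; apply: measurable_enorm; exact: measurable_id.
have E : (\int[L]_z (expR (- (t * enorm z ^+ 2)))%:E = ((pi / t) `^ (N%:R / 2))%:E)%E.
  have := @integral_gauss R N 0 t 0 (lexx 0) t0.
  rewrite add0r mul0r mul0r mul0r oppr0 expR0 mulr1 => <-.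
  by apply: eq_integral => z _; rewrite mul0r add0r sub0r enormN.
have foo : (\int[L]_z (expR (- (t * enorm z ^+ 2)))%:E < +oo)%E by rewrite E ltry.
by have := ge0_int_is measurableT mg (fun z _ => expR_ge0 _) foo; rewrite /= E.
Qed.

(** The Gaussian is even, so the two shifted powers have the same average. *)
Lemma has_integral_heat_sdiff a t : 0 < a -> a < N%:R - 2 * s -> 0 < t ->
  has_integral L setT
    (fun z => sdiff (fun y => enorm y `^ (- a)) x z * expR (- (t * enorm z ^+ 2)))
    (enorm x `^ (- a) * (pi / t) `^ (N%:R / 2) - fine (heat_avg a x t)).
Proof.
move=> a0 aN t0.
pose f (y : 'rV[R]_N) := enorm y `^ (- a) * expR (- (t * enorm (x - y) ^+ 2)).
have mf : measurable_fun setT f.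
  apply: measM; first exact: mnpow.
  apply: measexp; apply: measN; apply: measM; first exact: measurable_cst.
  apply: measX; apply: measurable_enorm; apply: measurable_rVD; first exact: measurable_cst.
  by apply: measurable_rVN; exact: measurable_id.
have h1 : has_integral L setT f (fine (heat_avg a x t)).
  apply: ge0_int_is => //.
  - by move=> y _; rewrite mulr_ge0.
  - exact: (heat_avg_lty s01 N0 a0 aN x0 t0).
have h2 := has_integral_shift x mf h1.
have mfx : measurable_fun setT (fun y : 'rV[R]_N => f (y + x)).
  by apply: (measurableT_comp mf); apply: measurable_rVD; [exact: measurable_id|exact: measurable_cst].
have h3 := has_integral_opp mfx h2.
have h4 := has_integralZ (enorm x `^ (- a)) measurableT (gauss_is t0).
have h5 := has_integralZ 2^-1 measurableT (has_integralD measurableT h2 h3).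
have := has_integralB measurableT h4 h5.
have -> : 2^-1 * (fine (heat_avg a x t) + fine (heat_avg a x t)) = fine (heat_avg a x t).
  by move: (fine _) => c; lra.
apply: has_integral_eq => // z _.
have -> : f (z + x) = enorm (x + z) `^ (- a) * expR (- (t * enorm z ^+ 2)).
  by rewrite /f opprD addrCA subrr addr0 enormN (addrC z).
have -> : f (- z + x) = enorm (x - z) `^ (- a) * expR (- (t * enorm z ^+ 2)).
  by rewrite /f opprD opprK addrCA subrr addr0 (addrC (- z)).
rewrite /sdiff; move: (expR _) (enorm _ `^ _) (enorm _ `^ _) (enorm _ `^ _) => A B C D.
by field.
Qed.

Variables (psi : 'rV[R]_N -> R) (M : R).
Hypotheses (M0 : 0 <= M) (mpsi : measurable_fun setT psi).
Hypothesis psiM : forall x, `|psi x| <= M.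
Hypothesis psi2 : forall x z, `|psi (x + z) + psi (x - z) - 2 * psi x| <= M * enorm z ^+ 2.

Let F (w : R * 'rV[R]_N) := sdiff psi x w.2 * (w.1 `^ (p - 1) * expR (- (w.1 * enorm w.2 ^+ 2))).

Let mF D : measurable_fun D (F : measurableTypeR R * 'rV[R]_N -> R).
Proof.
rewrite /F; apply: measM.
  apply: measurable_funTS.
  apply: (measurableT_comp (measurable_sdiff mpsi x)); exact: measurable_snd.
have m1 : measurable_fun D (fun w : measurableTypeR R * 'rV[R]_N => w.1 : R).
  by apply: measurable_funTS; exact: measurable_fst.
apply: measM; first exact: measpow.
apply: measexp; apply: measN; apply: measM; first exact: m1.
by apply: measX; apply: measurable_enorm; apply: measurable_funTS; exact: measurable_snd.
Qed.

Let s0 : 0 < s. Proof. by case/andP: s01. Qed.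

Let p0 : 0 < p. Proof. by rewrite addr_gt0// divr_gt0// ltr0n. Qed.

Let mpos : measurable (`]0, +oo[%classic : set (measurableTypeR R)).
Proof. exact: measurable_itv. Qed.

Let F_z t : 0 < t -> has_integral L setT (fun z => F (t, z)) (\int[L]_z F (t, z)).
Proof.
move=> t0; apply: has_integral_Rintegral; first exact: measurableT.
have [ig _] := has_integralZ (t `^ (p - 1)) measurableT (gauss_is t0).
apply: (integrable_mul_bounded (C := 2 * M)) ig.
- exact: measurable_sdiff.
- apply: measM; first exact: measurable_cst.
  apply: measexp; apply: measN; apply: measM; first exact: measurable_cst.
  by apply: measX; apply: measurable_enorm; exact: measurable_id.
- move=> z; apply: (le_trans (sdiff_le M0 psiM psi2 x z)).
  by rewrite ler_piMr ?mulr_ge0// /min1sqr ge_min lexx.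
Qed.

Let kernel_t z : z != 0 -> has_integral mu `]0, +oo[
  (fun t => t `^ (p - 1) * expR (- (t * enorm z ^+ 2))) (Gamma_integral p * riesz s z).
Proof.
move=> z0.
have mk : measurable_fun (`]0, +oo[ : set (measurableTypeR R)) (fun t => t `^ (p - 1) * expR (- (t * enorm z ^+ 2))).
  by mfun.
have E := riesz_subord s0 z0.
have foo : (\int[mu]_(t in `]0%R, +oo[) (t `^ (p - 1) * expR (- (t * enorm z ^+ 2)))%:E < +oo)%E.
  by rewrite E ltry.
have h0 t : `]0, +oo[%classic t -> 0 <= t `^ (p - 1) * expR (- (t * enorm z ^+ 2)) by move=> _; rewrite mulr_ge0.
have := ge0_int_is mpos mk h0 foo; by rewrite /= E.
Qed.

Let F_t z : has_integral mu `]0, +oo[ (fun t => F (t, z)) (sdiff psi x z * (Gamma_integral p * riesz s z)).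
Proof.
have [->|z0] := eqVneq z 0.
  have sd0 : sdiff psi x 0 = 0 by rewrite /sdiff addr0 subr0; move: (psi x) => c; field.
  rewrite sd0 mul0r; apply: has_integral_eq (has_integral0 mu mpos) => // t _.
  by rewrite /F/= sd0 mul0r.
exact: (has_integralZ (sdiff psi x z) mpos (kernel_t z0)).
Qed.

Let F_abs_t z : has_integral mu `]0, +oo[ (fun t => `|F (t, z)|) (`|sdiff psi x z| * (Gamma_integral p * riesz s z)).
Proof.
have [->|z0] := eqVneq z 0.
  have sd0 : sdiff psi x 0 = 0 by rewrite /sdiff addr0 subr0; move: (psi x) => c; field.
  rewrite sd0 normr0 mul0r; apply: has_integral_eq (has_integral0 mu mpos) => // t _.
  by rewrite /F/= sd0 mul0r normr0.
have := has_integralZ (`|sdiff psi x z|) mpos (kernel_t z0).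
apply: has_integral_eq => // t _.
by rewrite /F/= [RHS]normrM (ger0_norm (mulr_ge0 (powR_ge0 _ _) (expR_ge0 _))).
Qed.

Let G0 : 0 < Gamma_integral p :> R. Proof. exact: Gamma_integral_gt0. Qed.

Let F_abs : (\int[mu]_(t in `]0%R, +oo[) \int[L]_z (`|F (t, z)|)%:E < +oo)%E.
Proof.
rewrite (@tonelli _ _ (measurableTypeR R) _ R mu L _ setT (fun w => (`|F w|)%:E) mpos measurableT); last 2 first.
- by apply: measEFin; apply: measnorm; exact: mF.
- by move=> t z _ _; rewrite lee_fin.
have -> : (\int[L]_z \int[mu]_(t in `]0%R, +oo[) (`|F (t, z)|)%:E =
    \int[L]_z (Gamma_integral p * `|sdiff psi x z * riesz s z|)%:E)%E.
  apply: eq_integral => z _.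
  have [_] := F_abs_t z; move=> ->; congr EFin.
  rewrite (normrM (sdiff psi x z)) (ger0_norm (riesz_ge0 _ _)).
  by rewrite mulrCA.
rewrite ge0_integralZl_real; [|exact: measurableT| | |exact: ltW].
- apply: lte_mul_pinfty; [by rewrite lee_fin ltW|by []|].
  by have /integrableP[_] := integrable_sdiff M0 mpsi psiM psi2 x s01.
- by apply: measnorm; exact: measurable_sdiff_riesz.
- by [].
Qed.

Let Lop_int : has_integral mu `]0, +oo[ (fun t => \int[L]_z F (t, z)) (Gamma_integral p * Lop psi s x).
Proof.
have mE : measurable_fun (`]0, +oo[ `*` setT : set (measurableTypeR R * 'rV[R]_N)) (EFin \o F).
  by apply: measEFin; exact: mF.
have [i E] := @fubini_setX _ _ (measurableTypeR R) _ R mu L `]0, +oo[ setT (EFin \o F) mpos measurableT mE F_abs.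
have e t : `]0, +oo[%classic t -> (\int[L]_z (EFin \o F) (t, z) = (\int[L]_z F (t, z))%:E)%E.
  move=> tp.
  have t0 : 0 < t by move: tp; rewrite /= in_itv/= andbT.
  by have [_] := F_z t0.
split.
  apply: (eq_integrable mpos _ _ _ i) => t; rewrite inE; exact: e.
transitivity (\int[mu]_(t in `]0%R, +oo[) \int[L]_z (EFin \o F) (t, z))%E.
  by apply: eq_integral => t; rewrite inE => tp; rewrite -e.
rewrite E.
transitivity (\int[L]_z (Gamma_integral p * (sdiff psi x z * riesz s z))%:E)%E.
  apply: eq_integral => z _.
  have [_ /= ->] := F_t z.
  by rewrite mulrCA.
have h := has_integral_Rintegral measurableT (integrable_sdiff M0 mpsi psiM psi2 x s01).
by have [_] := has_integralZ (Gamma_integral p) measurableT h.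
Qed.

(** Subordinate the kernel, compare the integrals for each Gaussian, and
    integrate the result over the Gaussian parameter.  For a fixed Gaussian the
    second difference of a power splits into separately convergent averages,
    which it does not against the kernel. *)
Lemma Lop_le_heat a b c dl : 0 < a -> a < N%:R - 2 * s -> 0 < b -> b < N%:R - 2 * s ->
  (forall z, sdiff psi x z <= c * (sdiff (fun y => enorm y `^ (- a)) x z -
                             dl * sdiff (fun y => enorm y `^ (- b)) x z)) ->
  Gamma_integral p * Lop psi s x <= c *
   (pi `^ (N%:R / 2) * kap * (gamma_ratio s (a / 2) * gamma_ratio s ((N%:R - 2 * s - a) / 2)) * enorm x `^ (- a - 2 * s)
   - dl * (pi `^ (N%:R / 2) * kap * (gamma_ratio s (b / 2) * gamma_ratio s ((N%:R - 2 * s - b) / 2)) * enorm x `^ (- b - 2 * s))).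
Proof.
move=> a0 aN b0 bN cmp.
have ha := heat_deficit_integral s01 N0 a0 aN x0.
have hb := heat_deficit_integral s01 N0 b0 bN x0.
have h := has_integralZ c mpos (has_integralB mpos ha (has_integralZ dl mpos hb)).
apply: (has_integral_le mpos Lop_int h) => t; rewrite /= in_itv/= andbT => t0.
have ka := has_integral_heat_sdiff a0 aN t0.
have kb := has_integral_heat_sdiff b0 bN t0.
have k := has_integralZ (t `^ (p - 1) * c) measurableT (has_integralB measurableT ka (has_integralZ dl measurableT kb)).
have -> : c * (heat_deficit s a x t - dl * heat_deficit s b x t) =
  t `^ (p - 1) * c * (enorm x `^ (- a) * (pi / t) `^ (N%:R / 2) - fine (heat_avg a x t)
   - dl * (enorm x `^ (- b) * (pi / t) `^ (N%:R / 2) - fine (heat_avg b x t))).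
  rewrite /heat_deficit; move: (fine _) (fine _) (enorm x `^ _) (enorm x `^ _) (_ `^ (_ / _)) (t `^ _) => A B C D E G; ring.
apply: (has_integral_le measurableT (F_z t0) k) => z _.
rewrite /F /=.
have := ler_wpM2r (mulr_ge0 (powR_ge0 t (p - 1)) (expR_ge0 (- (t * enorm z ^+ 2)))) (cmp z).
move/le_trans; apply; rewrite le_eqVlt; apply/orP; left; apply/eqP.
move: (sdiff _ _ _) (sdiff _ _ _) (t `^ _) (expR _) => A B C D; ring.
Qed.

(** The fractional Laplacian at x is monotone under touching: a function whose
    increments from x are at most c times those of w has a fractional Laplacian
    at most c times that of w. *)
Lemma fraclap_le_power a b c dl : 0 < a -> a < N%:R - 2 * s -> 0 < b -> b < N%:R - 2 * s ->
  (forall y, psi x - psi y <= c * ((enorm x `^ (- a) - dl * enorm x `^ (- b)) -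
                                (enorm y `^ (- a) - dl * enorm y `^ (- b)))) ->
  fraclap s psi x <= c * (power_eigen s N a * enorm x `^ (- a - 2 * s) -
                        dl * power_eigen s N b * enorm x `^ (- b - 2 * s)).
Proof.
move=> a0 aN b0 bN cmp.
have cmp2 z : sdiff psi x z <= c * (sdiff (fun y => enorm y `^ (- a)) x z -
                             dl * sdiff (fun y => enorm y `^ (- b)) x z).
  have := cmp (x + z); have := cmp (x - z); rewrite /sdiff.
  move: (enorm (x + z) `^ _) (enorm (x + z) `^ _) (enorm (x - z) `^ _) (enorm (x - z) `^ _).
  move: (enorm x `^ _) (enorm x `^ _) (psi _) (psi _) (psi _) => A B C D E G H I J h1 h2.
  rewrite -subr_ge0; rewrite -subr_ge0 in h1; rewrite -subr_ge0 in h2.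
  have := addr_ge0 h1 h2; rewrite -(pmulr_lge0 _ (_ : 0 < 2^-1)); last by rewrite invr_gt0.
  by congr (0 <= _); field.
have h := Lop_le_heat a0 aN b0 bN cmp2.
rewrite (fraclap_bump M0 mpsi psiM psi2 x s01) (fraclap_constE s01 N0).
have pi0 : 0 < pi `^ (N%:R / 2) :> R by rewrite powR_gt0 ?pi_gt0.
have kap0 : 0 < kap :> R.
  apply: divr_gt0 s0; apply: Gamma_integral_gt0.
  by have /andP[_ s1] := s01; rewrite subr_gt0.
rewrite powRN /power_eigen.
have t0 : 0 < 2 `^ (2 * s) :> R by rewrite powR_gt0.
have K0 : 0 < 2 `^ (2 * s) / pi `^ (N%:R / 2) / kap :> R.
  exact: (divr_gt0 (divr_gt0 t0 pi0) kap0).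
have := ler_wpM2l (ltW K0) h.
move: (2 `^ _) (pi `^ _) kap (Gamma_integral p) (Lop _ _ _) (enorm x `^ _) (enorm x `^ _) (gamma_ratio _ _) (gamma_ratio _ _) (gamma_ratio _ _) (gamma_ratio _ _) pi0 kap0.
move=> A B C D E G H I J K W B0 C0.
have -> : A / B / C * (D * E) = A / B * (D / C) * E by field; rewrite ?gt_eqF//.
move/le_trans; apply; rewrite le_eqVlt; apply/orP; left; apply/eqP.
by field; rewrite ?gt_eqF.
Qed.

End comparison.

(** * The convex ramp and radial bump functions *)

Section ramp.
Context {R : realType}.
Implicit Types (q a b : R).

(** The derivative of [ramp]. *)
Definition clamp q : R := Num.min (Num.max q 0) 1.

(** The convex primitive of [clamp]: zero, then a parabola, then affine with
    slope one. *)
Definition ramp q : R := clamp q * q - clamp q ^+ 2 / 2.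

Variant clamp_spec q : R -> R -> Type :=
| ClampLow of q <= 0 : clamp_spec q 0 0
| ClampMid of 0 <= q & q <= 1 : clamp_spec q q (q ^+ 2 / 2)
| ClampHigh of 1 <= q : clamp_spec q 1 (q - 2^-1).

Lemma clampP q : clamp_spec q (clamp q) (ramp q).
Proof.
rewrite /ramp /clamp; case: (leP q 0) => h.
  have -> : Num.min (0 : R) 1 = 0 by apply/min_idPl.
  by rewrite mul0r expr0n mul0r subrr; constructor.
case: (leP q 1) => h1.
  have -> : q * q - q ^+ 2 / 2 = q ^+ 2 / 2 by field.
  by constructor; rewrite // ltW.
have -> : 1 * q - 1 ^+ 2 / 2 = q - 2^-1 by rewrite expr1n mul1r div1r.
by constructor; rewrite ltW.
Qed.

Lemma clamp_ge0 q : 0 <= clamp q.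
Proof. by case: clampP. Qed.

Lemma clamp_le1 q : clamp q <= 1.
Proof. by case: clampP. Qed.

Lemma ramp_ge0 q : 0 <= ramp q.
Proof. by case: clampP => // *; nra. Qed.

Lemma clamp_le0 q : q <= 0 -> clamp q = 0.
Proof. by move=> h; rewrite /clamp (max_idPr h); apply/min_idPl. Qed.

Lemma ramp_le0 q : q <= 0 -> ramp q = 0.
Proof. by case: clampP => // *; nra. Qed.

Lemma ramp_le_clamp q : ramp q <= clamp q * q.
Proof. by rewrite lerBlDr lerDl divr_ge0// sqr_ge0. Qed.

Lemma le_ramp q : q <= ramp q + 1.
Proof. by have := sqr_ge0 (q - 1); case: clampP => *; nra. Qed.

Lemma ramp_convex a b : 0 <= ramp b - ramp a - clamp a * (b - a).
Proof.
have := sqr_ge0 (b - a); have := sqr_ge0 b; have := sqr_ge0 (b - 1).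
by case: (clampP a) => *; case: (clampP b) => *; nra.
Qed.

Lemma ramp_taylor a b : ramp b - ramp a - clamp a * (b - a) <= (b - a) ^+ 2 / 2.
Proof.
have := sqr_ge0 (b - a); have := sqr_ge0 (b - a - 1); have := sqr_ge0 a; have := sqr_ge0 (a - 1).
by case: (clampP a) => *; case: (clampP b) => *; nra.
Qed.

Lemma ramp_le q : ramp q <= Num.max q 0.
Proof. by case: clampP => *; rewrite le_max; apply/orP; [right|left|left]; nra. Qed.

Lemma measurable_clamp d (T : measurableType d) (D : set T) (f : T -> R) :
  measurable_fun D f -> measurable_fun D (fun x => clamp (f x)).
Proof.
move=> mf; apply: measurable_minr; last exact: measurable_cst.
by apply: measurable_maxr => //; exact: measurable_cst.
Qed.

Lemma measurable_ramp d (T : measurableType d) (D : set T) (f : T -> R) :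
  measurable_fun D f -> measurable_fun D (fun x => ramp (f x)).
Proof.
move=> mf; have mc := measurable_clamp mf.
apply: measB; first exact: measM.
by apply: measM; [exact: measX|exact: measurable_cst].
Qed.

(** Mean value theorem on a half-line that stays away from the singularity. *)
Lemma powRN_MVT e q0 q q' : 0 < q0 -> q0 <= q -> q0 <= q' -> exists xi,
  [/\ q0 <= xi, `|xi - q| <= `|q' - q| &
      q' `^ (- e) - q `^ (- e) = - e * xi `^ (- e - 1) * (q' - q)].
Proof.
move=> q00.
have hd x : q0 <= x -> is_derive x 1 (fun y : R => y `^ (- e)) (- e * x `^ (- e - 1)).
  by move=> h; apply: is_derive_powR; exact: lt_le_trans h.
have main u v : q0 <= u -> u <= v -> exists xi, [/\ u <= xi, xi <= v &
    v `^ (- e) - u `^ (- e) = - e * xi `^ (- e - 1) * (v - u)].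
  move=> qu uv.
  have [||xi] := @MVT_segment R (fun y : R => y `^ (- e)) (fun x => - e * x `^ (- e - 1)) u v uv.
  - by move=> x; rewrite in_itv/= => /andP[ux _]; apply: hd; exact: le_trans (ltW ux).
  - apply/continuous_in_subspaceT => x; rewrite inE/= in_itv/= => /andP[ux _].
    by apply: continuous_powR; apply: (lt_le_trans q00); exact: le_trans ux.
  by rewrite in_itv/= => /andP[h1 h2] E; exists xi.
move=> qq qq'; case: (leP q q') => h.
  have [xi [h1 h2 E]] := main _ _ qq h; exists xi; split => //; first exact: le_trans h1.
  by rewrite !ger0_norm ?subr_ge0// lerD2r.
have [xi [h1 h2 E]] := main _ _ qq' (ltW h); exists xi; split.
- exact: le_trans h1.
- by rewrite (distrC xi) (distrC q') !ger0_norm ?subr_ge0 ?(ltW h)//; lra.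
- by rewrite -opprB E; ring.
Qed.

Lemma powRN_antimono e q0 q : 0 <= e -> 0 < q0 -> q0 <= q -> q `^ (- e) <= q0 `^ (- e).
Proof.
move=> e0 q00 h; rewrite !powRN lef_pV2 ?posrE ?powR_gt0//; last exact: lt_le_trans h.
by apply: ge0_ler_powR => //; rewrite nnegrE ltW// (lt_le_trans q00).
Qed.

Lemma powRN_lip e q0 q q' : 0 <= e -> 0 < q0 -> q0 <= q -> q0 <= q' ->
  `|q' `^ (- e) - q `^ (- e)| <= e * q0 `^ (- e - 1) * `|q' - q|.
Proof.
move=> e0 q00 h h'; have [xi [h1 h2 ->]] := powRN_MVT e q00 h h'.
rewrite normrM ler_wpM2r// normrM normrN (ger0_norm e0) (ger0_norm (powR_ge0 _ _)).
rewrite ler_wpM2l// -opprD; apply: powRN_antimono => //.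
by rewrite addr_ge0.
Qed.

Lemma powRN_taylor e q0 q q' : 0 <= e -> 0 < q0 -> q0 <= q -> q0 <= q' ->
  `|q' `^ (- e) - q `^ (- e) - (- e * q `^ (- e - 1)) * (q' - q)| <=
    e * ((e + 1) * q0 `^ (- e - 2)) * (q' - q) ^+ 2.
Proof.
move=> e0 q00 h h'; have [xi [h1 h2 ->]] := powRN_MVT e q00 h h'.
rewrite -mulrBl -mulrBr !normrM normrN (ger0_norm e0) -mulrA -[leRHS]mulrA ler_wpM2l//.
rewrite -[(q' - q) ^+ 2]real_normK ?num_real// expr2 mulrA ler_wpM2r//.
have e10 : 0 <= e + 1 by rewrite addr_ge0.
have := powRN_lip e10 q00 h h1; rewrite opprD.
have -> : - e - 1 - 1 = - e - 2 by ring.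
move/le_trans; apply; rewrite ler_wpM2l// mulr_ge0//.
Qed.

End ramp.

Section radial.
Context {R : realType} (N : nat).
Variables (F D : R -> R) (rho Mb C : R).
Hypotheses (rho0 : 0 < rho).
Hypothesis FM : forall q, 0 <= q -> `|F q| <= Mb.
Hypothesis F0 : forall q, rho ^+ 2 <= q -> F q = 0.
Hypothesis D0 : forall q, rho ^+ 2 <= q -> D q = 0.
Hypothesis DC : forall q, 0 <= q -> `|D q| <= C.
Hypothesis FT : forall q q', 0 <= q -> 0 <= q' ->
  `|F q' - F q - D q * (q' - q)| <= C * (q' - q) ^+ 2.

Let psi (x : 'rV[R]_N) := F (enorm x ^+ 2).

Let Mb0 : 0 <= Mb. Proof. exact: le_trans (normr_ge0 _) (FM (lexx 0)). Qed.
Let C0 : 0 <= C. Proof. exact: le_trans (normr_ge0 _) (DC (lexx 0)). Qed.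
Let K := 2 * Mb + 2 * C * rho + C * (2 * rho + 3) ^+ 2 + C.

Let K0 : 0 <= K.
Proof.
have h1 : 0 <= 2 * Mb by rewrite mulr_ge0.
have h2 : 0 <= 2 * C * rho by rewrite !mulr_ge0// ltW.
have h3 : 0 <= C * (2 * rho + 3) ^+ 2 by rewrite mulr_ge0// sqr_ge0.
by rewrite /K !addr_ge0.
Qed.

Let dx (x v : 'rV[R]_N) : `|D (enorm x ^+ 2) * (2 * dotr x v)| <= 2 * C * rho * enorm v.
Proof.
case: (leP rho (enorm x)) => h.
  rewrite D0; last by rewrite lerXn2r ?nnegrE ?enorm_ge0 ?(ltW rho0).
  by rewrite mul0r normr0 !mulr_ge0 ?enorm_ge0 ?(ltW rho0).
rewrite normrM (mulrC 2 C) -2!mulrA; apply: ler_pM => //; first exact: DC (sqr_ge0 _).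
rewrite normrM ger0_norm// ler_wpM2l//; apply: (le_trans (dotr_le _ _)).
by rewrite ler_wpM2r ?enorm_ge0// ltW.
Qed.

Let radial_taylor (x v : 'rV[R]_N) :
  `|psi (x + v) - psi x - D (enorm x ^+ 2) * (2 * dotr x v)| <= K * enorm v ^+ 2.
Proof.
have X0 := enorm_ge0 x; have V0 := enorm_ge0 v; have Y0 := enorm_ge0 (x + v).
have CR0 : 0 <= C * rho by rewrite mulr_ge0// ltW.
have CT0 : 0 <= C * (2 * rho + 3) ^+ 2 by rewrite mulr_ge0// sqr_ge0.
case: (leP 1 (enorm v)) => v1.
  apply: (@le_trans _ _ (2 * Mb + 2 * C * rho * enorm v)).
    apply: (le_trans (ler_normB _ _)); apply: lerD; last exact: dx.
    apply: (le_trans (ler_normB _ _)).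
    by have := FM (sqr_ge0 (enorm x)); have := FM (sqr_ge0 (enorm (x + v))); rewrite /psi; lra.
  have V2 : enorm v <= enorm v ^+ 2 by rewrite expr2 ler_peMr.
  have V3 : 1 <= enorm v ^+ 2 by exact: le_trans V2.
  rewrite /K; move: (enorm v ^+ 2) V2 V3 => W V2 V3; move: CT0; set E := C * (2 * rho + 3) ^+ 2 => CT0.
  have := mulr_ge0 Mb0 (_ : 0 <= W - 1); rewrite subr_ge0 => /(_ V3).
  have := mulr_ge0 CR0 (_ : 0 <= W - enorm v); rewrite subr_ge0 => /(_ V2).
  have W0 : 0 <= W by exact: le_trans V3.
  have := mulr_ge0 CT0 W0; have := mulr_ge0 C0 W0.
  by move: E CT0 (enorm v) => E _ nv; lra.
have YX : enorm (x + v) <= enorm x + enorm v by exact: ler_enormD.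
have XY : enorm x <= enorm (x + v) + enorm v.
  by have := ler_enormD (x + v) (- v); rewrite addrK enormN.
case: (leP (rho + 1) (enorm x)) => h.
  have hx : rho ^+ 2 <= enorm x ^+ 2 by rewrite lerXn2r ?nnegrE ?(ltW rho0)//; lra.
  have hy : rho ^+ 2 <= enorm (x + v) ^+ 2 by rewrite lerXn2r ?nnegrE ?(ltW rho0)//; lra.
  rewrite /psi !F0// D0// subrr mul0r subr0 normr0.
  exact: (mulr_ge0 K0 (sqr_ge0 _)).
have E : enorm (x + v) ^+ 2 - enorm x ^+ 2 = 2 * dotr x v + enorm v ^+ 2.
  by rewrite enormD_sqr; ring.
have h1 := FT (sqr_ge0 (enorm x)) (sqr_ge0 (enorm (x + v))).
have h2 : (enorm (x + v) ^+ 2 - enorm x ^+ 2) ^+ 2 <= (2 * rho + 3) ^+ 2 * enorm v ^+ 2.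
  rewrite -exprMn -[leLHS]real_normK ?num_real// lerXn2r ?nnegrE ?mulr_ge0//.
    by rewrite addr_ge0// mulr_ge0// ltW.
  rewrite subr_sqr normrM mulrC (ger0_norm (addr_ge0 Y0 X0)).
  apply: ler_pM => //; first exact: addr_ge0.
    by lra.
  by rewrite ler_norml; apply/andP; split; lra.
have -> : psi (x + v) - psi x - D (enorm x ^+ 2) * (2 * dotr x v) =
   (psi (x + v) - psi x - D (enorm x ^+ 2) * (enorm (x + v) ^+ 2 - enorm x ^+ 2)) + D (enorm x ^+ 2) * enorm v ^+ 2.
  by rewrite E; ring.
apply: (le_trans (ler_normD _ _)).
apply: (@le_trans _ _ (C * ((2 * rho + 3) ^+ 2 * enorm v ^+ 2) + C * enorm v ^+ 2)).
  apply: lerD; first by apply: (le_trans h1); rewrite ler_wpM2l.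
  by rewrite normrM (ger0_norm (sqr_ge0 _)) ler_wpM2r ?sqr_ge0// DC// sqr_ge0.
rewrite mulrA -mulrDl ler_wpM2r ?sqr_ge0// /K lerD2r lerDr addr_ge0 ?mulr_ge0//; last exact: ltW.
Qed.

(** A first-order Taylor estimate for F, valid for all pairs of points, gives
    one for x -> F(|x|^2); adding it for z and -z cancels the linear terms.
    Far from the support, and for |z| >= 1, boundedness of F and D suffices. *)
Lemma radial_bump : exists2 M, 0 <= M & [/\ forall x, `|psi x| <= M,
  forall x y, `|psi x - psi y| <= M * enorm (x - y) &
  forall x z, `|psi (x + z) + psi (x - z) - 2 * psi x| <= M * enorm z ^+ 2].
Proof.
have CR0 : 0 <= C * rho by rewrite mulr_ge0// ltW.
have P0 : 0 <= 2 * K + 2 * C * rho.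
  by rewrite addr_ge0 -?mulrA ?(mulr_ge0 _ K0) ?(mulr_ge0 _ CR0).
exists (2 * K + 2 * C * rho + 2 * Mb).
  by rewrite addr_ge0// mulr_ge0.
split.
- move=> x; have := FM (sqr_ge0 (enorm x)); rewrite /psi.
  by move: `|_| K K0 => p k k0; move: Mb0 CR0; lra.
- move=> x y; have V0 := enorm_ge0 (x - y).
  case: (leP 1 (enorm (x - y))) => v1.
    apply: (@le_trans _ _ (2 * Mb)).
      apply: (le_trans (ler_normB _ _)).
      by have := FM (sqr_ge0 (enorm x)); have := FM (sqr_ge0 (enorm y)); rewrite /psi; lra.
    apply: (@le_trans _ _ (2 * Mb * enorm (x - y))); first by rewrite ler_peMr ?mulr_ge0.
    rewrite ler_wpM2r// lerDr; exact: P0.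
  have := radial_taylor y (x - y); rewrite (addrC y) subrK.
  have := dx y (x - y); set d := D _ * _ => h1 h2.
  have V2 : enorm (x - y) ^+ 2 <= enorm (x - y).
    by move: (enorm (x - y)) V0 v1 => X; nra.
  have -> : psi x - psi y = (psi x - psi y - d) + d by rewrite subrK.
  apply: (le_trans (ler_normD _ _)).
  apply: (@le_trans _ _ (K * enorm (x - y) + 2 * C * rho * enorm (x - y))).
    by apply: lerD => //; apply: (le_trans h2); rewrite ler_wpM2l.
  rewrite -mulrDl ler_wpM2r//.
  by move: K K0 Mb0 => k; lra.
- move=> x z; have h1 := radial_taylor x z; have h2 := radial_taylor x (- z).
  have -> : psi (x + z) + psi (x - z) - 2 * psi x =
     (psi (x + z) - psi x - D (enorm x ^+ 2) * (2 * dotr x z)) +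
     (psi (x + - z) - psi x - D (enorm x ^+ 2) * (2 * dotr x (- z))).
    by rewrite dotrNr; ring.
  apply: (le_trans (ler_normD _ _)).
  rewrite enormN in h2.
  apply: (@le_trans _ _ (2 * K * enorm z ^+ 2)).
    by move: h1 h2; move: `|_| `|_| (enorm z ^+ 2) K => p1 p2 W k; lra.
  rewrite ler_wpM2r ?sqr_ge0//.
  by move: K K0 Mb0 => k k0; move: CR0; lra.
Qed.

End radial.

(** * Truncated powers *)

Section truncated_power.
Context {R : realType} (N : nat).
Variables (a b dl rho : R).
Hypotheses (a0 : 0 < a) (ab : a < b) (dl0 : 0 < dl) (rho0 : 0 < rho) (rho1 : rho <= 1).

(** The second term makes the difference tend to -oo at the origin when b > a.
    *)
Definition power_gap (r : R) : R := r `^ (- a) - dl * r `^ (- b).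

(** The level rho^-b exceeds the gap as soon as |x| >= rho, and the gap is
    negative near 0, so that this function lives in an annulus. *)
Definition trunc_power (x : 'rV[R]_N) : R := ramp (power_gap (enorm x) - rho `^ (- b)).

Let al := a / 2.
Let be := b / 2.
Let k := rho `^ (- b).
Let f q : R := q `^ (- al) - dl * q `^ (- be) - k.
Let df q : R := - al * q `^ (- al - 1) - dl * (- be * q `^ (- be - 1)).
Let F q := ramp (f q).
Let D q := clamp (f q) * df q.
(* The zero of q^-al - dl q^-be. *)
Let q1 := dl `^ ((be - al)^-1).
Let q0 := q1 / 2.
Let al0 : 0 < al. Proof. by rewrite divr_gt0. Qed.
Let alN : 0 <= al. Proof. exact: ltW. Qed.
Let b0 : 0 < b. Proof. exact: lt_trans ab. Qed.
Let be0 : 0 < be. Proof. by rewrite divr_gt0. Qed.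
Let beN : 0 <= be. Proof. exact: ltW. Qed.
Let ba0 : 0 < be - al. Proof. by rewrite subr_gt0 /be /al ltr_pM2r ?invr_gt0. Qed.
Let q10 : 0 < q1. Proof. exact: powR_gt0. Qed.
Let q00 : 0 < q0. Proof. by rewrite divr_gt0. Qed.
Let q0q1 : q0 <= q1. Proof. by rewrite /q0 ler_pdivrMr// ler_peMr// ?ltW// ltr1n. Qed.
Let k0 : 0 < k. Proof. exact: powR_gt0. Qed.

Let low q : 0 <= q -> q <= q1 -> f q <= 0.
Proof.
move=> qq qq1; rewrite /f.
have [->|qn] := eqVneq q 0.
  rewrite !powR0 ?oppr_eq0 ?gt_eqF// mulr0 subrr sub0r oppr_le0; exact: ltW.
have qp : 0 < q by rewrite lt_neqAle eq_sym qn.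
suff h : q `^ (- al) <= dl * q `^ (- be).
  by rewrite -addrA -opprD subr_le0; apply: (le_trans h); rewrite lerDl ltW.
have -> : q `^ (- al) = q `^ (be - al) * q `^ (- be).
  by rewrite -(@gt0_powRD _ q (be - al) (- be) qp); congr (_ `^ _); ring.
rewrite ler_wpM2r ?powR_ge0//.
have -> : dl = q1 `^ (be - al).
  by rewrite /q1 -powRrM mulVf ?powRr1 ?gt_eqF// ltW.
by apply: ge0_ler_powR; rewrite ?nnegrE ?(ltW ba0) ?(ltW q10).
Qed.

Let high q : rho ^+ 2 <= q -> f q <= 0.
Proof.
move=> h; rewrite /f.
have r20 : 0 < rho ^+ 2 by rewrite exprn_gt0.
have h1 := powRN_antimono alN r20 h.
have e1 : (rho ^+ 2) `^ (- al) = rho `^ (- a).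
  by rewrite -(@powR_mulrn _ rho 2 (ltW rho0)) -powRrM; congr (_ `^ _); rewrite /al; field.
have h2 : rho `^ (- a) <= k.
  rewrite /k !powRN lef_pV2 ?posrE ?powR_gt0//.
  by apply: ger_powR; rewrite ?rho0 ?rho1// ltW.
have h3 : 0 <= dl * q `^ (- be) by rewrite mulr_ge0 ?powR_ge0 ?(ltW dl0).
rewrite e1 in h1; rewrite -addrA -opprD subr_le0; apply: (le_trans h1); apply: (le_trans h2).
by rewrite lerDr.
Qed.

Let Fz q : f q <= 0 -> F q = 0. Proof. exact: ramp_le0. Qed.
Let Dz q : f q <= 0 -> D q = 0. Proof. by move=> h; rewrite /D clamp_le0// mul0r. Qed.

Let Mb := q1 `^ (- al).
Let FMb q : 0 <= q -> `|F q| <= Mb.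
Proof.
move=> qq; rewrite ger0_norm ?ramp_ge0//.
case: (leP q q1) => h; first by rewrite Fz ?low// powR_ge0.
apply: (le_trans (ramp_le _)); rewrite ge_max powR_ge0 andbT.
have h1 := powRN_antimono alN q10 (ltW h).
have h3 : 0 <= dl * q `^ (- be) by rewrite mulr_ge0 ?powR_ge0 ?(ltW dl0).
by rewrite /f -addrA -opprD lerBlDr; apply: (le_trans h1); rewrite lerDl addr_ge0// ltW.
Qed.
Let Mb0 : 0 <= Mb. Proof. exact: powR_ge0. Qed.

Let K1 := al * q0 `^ (- al - 1) + dl * (be * q0 `^ (- be - 1)).
Let K10 : 0 <= K1.
Proof.
apply: addr_ge0; first exact: mulr_ge0 alN (powR_ge0 _ _).
exact: mulr_ge0 (ltW dl0) (mulr_ge0 beN (powR_ge0 _ _)).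
Qed.

Let dfK q : q0 <= q -> `|df q| <= K1.
Proof.
move=> h; rewrite /df; apply: (le_trans (ler_normB _ _)); apply: lerD.
  rewrite normrM normrN !ger0_norm ?powR_ge0// ler_wpM2l// -opprD.
  by apply: powRN_antimono => //; rewrite addr_ge0.
rewrite !normrM normrN !ger0_norm ?powR_ge0 ?(ltW dl0)// ler_wpM2l ?(ltW dl0)// ler_wpM2l// -opprD.
by apply: powRN_antimono => //; rewrite addr_ge0.
Qed.

Let DK q : 0 <= q -> `|D q| <= K1.
Proof.
move=> qq; case: (leP q q1) => h; first by rewrite Dz ?low// normr0.
rewrite normrM ger0_norm ?clamp_ge0//.
have h1 := dfK (le_trans q0q1 (ltW h)).
rewrite -[leRHS]mul1r; apply: ler_pM => //; [exact: clamp_ge0|exact: clamp_le1].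
Qed.

Let K2 := al * ((al + 1) * q0 `^ (- al - 2)) + dl * (be * ((be + 1) * q0 `^ (- be - 2))).
Let K20 : 0 <= K2.
Proof.
have h1 : 0 <= al + 1 by rewrite addr_ge0.
have h2 : 0 <= be + 1 by rewrite addr_ge0.
apply: addr_ge0; first exact: mulr_ge0 alN (mulr_ge0 h1 (powR_ge0 _ _)).
exact: mulr_ge0 (ltW dl0) (mulr_ge0 beN (mulr_ge0 h2 (powR_ge0 _ _))).
Qed.

Let f_taylor q q' : q0 <= q -> q0 <= q' ->
  `|f q' - f q - df q * (q' - q)| <= K2 * (q' - q) ^+ 2.
Proof.
move=> h h'; have h1 := powRN_taylor alN q00 h h'; have h2 := powRN_taylor beN q00 h h'.
have -> : f q' - f q - df q * (q' - q) =
  (q' `^ (- al) - q `^ (- al) - (- al * q `^ (- al - 1)) * (q' - q)) -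
  dl * (q' `^ (- be) - q `^ (- be) - (- be * q `^ (- be - 1)) * (q' - q)).
  by rewrite /f /df; ring.
apply: (le_trans (ler_normB _ _)); rewrite /K2 mulrDl; apply: lerD => //.
by rewrite normrM (ger0_norm (ltW dl0)) -[leRHS]mulrA ler_wpM2l ?(ltW dl0).
Qed.

Let f_lip q q' : q0 <= q -> q0 <= q' -> `|f q' - f q| <= K1 * `|q' - q|.
Proof.
move=> h h'; have h1 := powRN_lip alN q00 h h'; have h2 := powRN_lip beN q00 h h'.
have -> : f q' - f q = (q' `^ (- al) - q `^ (- al)) - dl * (q' `^ (- be) - q `^ (- be)).
  by rewrite /f; ring.
apply: (le_trans (ler_normB _ _)); rewrite /K1 mulrDl; apply: lerD => //.
by rewrite normrM (ger0_norm (ltW dl0)) -[leRHS]mulrA ler_wpM2l ?(ltW dl0).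
Qed.

Let C := K1 ^+ 2 / 2 + K2 + Mb / q0 ^+ 2 + K1 / q0 + K1.

Let C_bounds : [/\ K1 ^+ 2 / 2 + K2 <= C, Mb / q0 ^+ 2 <= C,
  Mb / q0 ^+ 2 + K1 / q0 <= C, K1 <= C & 0 <= C].
Proof.
have C1 : 0 <= K1 ^+ 2 / 2 by rewrite divr_ge0// sqr_ge0.
have C2 : 0 <= Mb / q0 ^+ 2 by rewrite divr_ge0// sqr_ge0.
have C3 : 0 <= K1 / q0 by rewrite divr_ge0// ltW.
rewrite /C; move: C1 K20 C2 C3 K10.
move: (K1 ^+ 2 / 2) K2 (Mb / _) (K1 / q0) K1 => c1 c2 c3 c4 c5 *.
by split; lra.
Qed.

Let q1E : q1 = q0 + q0. Proof. by rewrite /q0; field. Qed.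

Let far q q' : q0 <= `|q' - q| -> 1 <= `|q' - q| / q0 /\ 1 <= (q' - q) ^+ 2 / q0 ^+ 2.
Proof.
move=> h; have h1 : 1 <= `|q' - q| / q0 by rewrite ler_pdivlMr// mul1r.
split => //; rewrite -[(q' - q) ^+ 2]real_normK ?num_real// -expr_div_n.
by rewrite exprn_ege1.
Qed.

Let F_taylor q q' : 0 <= q -> 0 <= q' ->
  `|F q' - F q - D q * (q' - q)| <= C * (q' - q) ^+ 2.
Proof.
move=> qq qq'.
have W0 : 0 <= (q' - q) ^+ 2 by exact: sqr_ge0.
have [B1 B2 B3 B4 C0] := C_bounds.
have sq : (q' - q) ^+ 2 = `|q' - q| * `|q' - q| by rewrite -[LHS]real_normK ?num_real.
case: (leP q q0) => h.
  have fq := low qq (le_trans h q0q1).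
  rewrite (Fz fq) (Dz fq) subr0 mul0r subr0.
  case: (leP q' q1) => h'; first by rewrite (Fz (low qq' h')) normr0 mulr_ge0.
  have [_ h2] : 1 <= `|q' - q| / q0 /\ 1 <= (q' - q) ^+ 2 / q0 ^+ 2.
    by apply: far; rewrite ger0_norm; move: h' q00; rewrite q1E; lra.
  apply: (le_trans (FMb qq')).
  apply: (@le_trans _ _ (Mb / q0 ^+ 2 * (q' - q) ^+ 2)).
    by rewrite mulrAC -mulrA ler_peMr.
  by rewrite ler_wpM2r.
case: (leP q' q0) => h'.
  have fq' := low qq' (le_trans h' q0q1).
  rewrite (Fz fq') sub0r.
  case: (leP q q1) => hq.
    by rewrite (Fz (low qq hq)) (Dz (low qq hq)) oppr0 mul0r subr0 normr0 mulr_ge0.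
  have [h1 h2] : 1 <= `|q' - q| / q0 /\ 1 <= (q' - q) ^+ 2 / q0 ^+ 2.
    by apply: far; rewrite ler0_norm; move: hq q00; rewrite q1E; lra.
  apply: (le_trans (ler_normB _ _)); rewrite normrN normrM.
  apply: (@le_trans _ _ (Mb / q0 ^+ 2 * (q' - q) ^+ 2 + K1 / q0 * (q' - q) ^+ 2)).
    apply: lerD.
      by apply: (le_trans (FMb qq)); rewrite mulrAC -mulrA ler_peMr.
    apply: (@le_trans _ _ (K1 * `|q' - q|)); first by rewrite ler_wpM2r// DK.
    by rewrite sq mulrA ler_wpM2r// mulrAC -mulrA ler_peMr.
  by rewrite -mulrDl ler_wpM2r.
have hq := ltW h; have hq' := ltW h'.
have t1 := f_taylor hq hq'; have t2 := f_lip hq hq'.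
have -> : F q' - F q - D q * (q' - q) =
   (ramp (f q') - ramp (f q) - clamp (f q) * (f q' - f q)) +
   clamp (f q) * (f q' - f q - df q * (q' - q)).
  by rewrite /F /D; ring.
apply: (le_trans (ler_normD _ _)).
apply: (@le_trans _ _ (K1 ^+ 2 / 2 * (q' - q) ^+ 2 + K2 * (q' - q) ^+ 2)).
  apply: lerD.
    rewrite ger0_norm ?ramp_convex//; apply: (le_trans (ramp_taylor _ _)).
    have -> : K1 ^+ 2 / 2 * (q' - q) ^+ 2 = (K1 * (q' - q)) ^+ 2 / 2.
      by move: K1 (q' - q) => A B; rewrite exprMn mulrAC.
    rewrite -[(f q' - f q) ^+ 2]real_normK ?num_real//.
    rewrite -[(K1 * (q' - q)) ^+ 2]real_normK ?num_real// normrM (ger0_norm K10).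
    by rewrite ler_wpM2r// lerXn2r// nnegrE mulr_ge0.
  rewrite normrM ger0_norm ?clamp_ge0//; apply: le_trans t1.
  by rewrite ler_piMl// clamp_le1.
by rewrite -mulrDl ler_wpM2r.
Qed.

Let trunc_powerE x : trunc_power x = F (enorm x ^+ 2).
Proof.
rewrite /trunc_power /power_gap /F /f.
have e (c : R) : (enorm x ^+ 2) `^ (- (c / 2)) = enorm x `^ (- c).
  by rewrite -(@powR_mulrn _ (enorm x) 2 (enorm_ge0 x)) -powRrM mulrN mulrC divfK.
by rewrite /al /be !e.
Qed.

(** As a function of q = |x|^2 the truncated power is smooth composed with the
    ramp on a half-line [q0, +oo[, and vanishes below q1 = 2 q0; pairs with one
    point below q0 and the other above q1 are at distance at least q0. *)
Lemma trunc_power_bump : exists2 M, 0 <= M & [/\ forall x, `|trunc_power x| <= M,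
  forall x y, `|trunc_power x - trunc_power y| <= M * enorm (x - y) &
  forall x z, `|trunc_power (x + z) + trunc_power (x - z) - 2 * trunc_power x| <= M * enorm z ^+ 2].
Proof.
have -> : trunc_power = (fun x => F (enorm x ^+ 2)) by apply/funext => x; exact: trunc_powerE.
apply: (@radial_bump _ N F D rho Mb C rho0).
- exact: FMb.
- by move=> q /high /Fz.
- by move=> q /high /Dz.
- by move=> q qq; apply: (le_trans (DK qq)); have [_ _ _ ? _] := C_bounds.
- exact: F_taylor.
Qed.

Lemma measurable_trunc_power : measurable_fun setT trunc_power.
Proof.
have mp c : measurable_fun setT (fun y : 'rV[R]_N => enorm y `^ (- c)).
  by apply: measpow; apply: measurable_enorm; exact: measurable_id.
apply: measurable_ramp; apply: measB; last exact: measurable_cst.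
by apply: measB => //; apply: measM => //; exact: measurable_cst.
Qed.

Lemma trunc_power_far (x : 'rV[R]_N) : rho <= enorm x -> power_gap (enorm x) - rho `^ (- b) <= 0.
Proof.
move=> h.
have e (c : R) : (enorm x ^+ 2) `^ (- (c / 2)) = enorm x `^ (- c).
  by rewrite -(@powR_mulrn _ (enorm x) 2 (enorm_ge0 x)) -powRrM mulrN mulrC divfK.
have /high : rho ^+ 2 <= enorm x ^+ 2 by rewrite lerXn2r ?nnegrE ?enorm_ge0 ?(ltW rho0).
by rewrite /f /al /be !e.
Qed.

Lemma clamp_power_bounded : exists B : R, forall x : 'rV[R]_N,
  `|clamp (power_gap (enorm x) - rho `^ (- b)) * enorm x `^ (- a)| <= B.
Proof.
exists Mb => x.
have e (c : R) : (enorm x ^+ 2) `^ (- (c / 2)) = enorm x `^ (- c).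
  by rewrite -(@powR_mulrn _ (enorm x) 2 (enorm_ge0 x)) -powRrM mulrN mulrC divfK.
have -> : power_gap (enorm x) - rho `^ (- b) = f (enorm x ^+ 2).
  by rewrite /power_gap /f /al /be !e.
rewrite -e -/al; move: (sqr_ge0 (enorm x)); move: (enorm x ^+ 2) => q qq.
rewrite ger0_norm ?mulr_ge0 ?clamp_ge0 ?powR_ge0//.
case: (leP q q1) => h; first by rewrite clamp_le0 ?low// mul0r.
rewrite -[leRHS]mul1r; apply: ler_pM; rewrite ?clamp_ge0 ?clamp_le1 ?powR_ge0//.
exact: powRN_antimono alN q10 (ltW h).
Qed.

End truncated_power.

(** * Almost everywhere comparison and Fatou bounds *)

Section ae_tools.
Context d (T : measurableType d) (R : realType) (m : {measure set T -> \bar R}).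
Implicit Types (D : set T) (f g : T -> \bar R).

(** Valid in the extended reals: positive parts increase and negative parts
    decrease. *)
Lemma ae_le_integral D f g : measurable D -> measurable_fun D f -> measurable_fun D g ->
  {ae m, forall x, D x -> (f x <= g x)%E} ->
  (\int[m]_(x in D) f x <= \int[m]_(x in D) g x)%E.
Proof.
move=> mD mf mg fg; rewrite integralE [leRHS]integralE; apply: leeB.
  apply: ae_ge0_le_integral => //.
  - exact: measurable_funepos.
  - exact: measurable_funepos.
  - by apply: filterS fg => x h /h; rewrite !funeposE => fgx; rewrite ge_max !le_max fgx lexx orbT.
apply: ae_ge0_le_integral => //.
- exact: measurable_funeneg.
- exact: measurable_funeneg.
- apply: filterS fg => x h /h; rewrite !funenegE => fgx.
  by rewrite ge_max !le_max leeN2 fgx lexx orbT.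
Qed.

Lemma has_integral_bddM D (k f : T -> R) (I C : R) : measurable D -> measurable_fun D k ->
  (forall x, D x -> `|k x| <= C) -> has_integral m D f I ->
  has_integral m D (fun x => k x * f x) (\int[m]_(x in D) (k x * f x)).
Proof.
move=> mD mk kC hf; apply: has_integral_Rintegral => //.
have [i _] := has_integralZ C mD hf.
have mf : measurable_fun D f by have [/measurable_int/measurable_EFinP] := hf.
apply: (le_integrable mD _ _ i); first by apply: measEFin; exact: measM.
move=> x Dx; rewrite lee_fin /= !normrM ler_wpM2r//.
by apply: (le_trans (kC x Dx)); exact: ler_norm.
Qed.

Lemma has_integral_measurable D (f : T -> R) (J : R) : has_integral m D f J -> measurable_fun D f.
Proof. by move=> [/measurable_int/measurable_EFinP]. Qed.

Lemma ge0_le_int_is D (f h : T -> R) (J : R) : measurable D -> measurable_fun D f ->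
  (forall x, D x -> 0 <= f x) -> (forall x, D x -> f x <= h x) -> has_integral m D h J ->
  (\int[m]_(x in D) (f x)%:E <= J%:E)%E.
Proof.
move=> mD mf f0 fh [ih <-]; apply: ge0_le_integral; [exact: mD| |exact: measEFin| |].
- by move=> x Dx; rewrite lee_fin f0.
- exact: (measurable_int _ ih).
- by move=> x Dx; rewrite lee_fin fh.
Qed.

Lemma fatou_le D (f : nat -> T -> R) (h : T -> R) (B : R) : measurable D ->
  (forall n, measurable_fun D (f n)) -> (forall n x, D x -> 0 <= f n x) ->
  (forall x, D x -> f ^~ x @ \oo --> h x) ->
  (forall n, (\int[m]_(x in D) (f n x)%:E <= B%:E)%E) ->
  (\int[m]_(x in D) (h x)%:E <= B%:E)%E.
Proof.
move=> mD mf f0 fh fB.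
have := @fatou _ T R m D mD (fun n x => (f n x)%:E) _ _.
have -> : (\int[m]_(x in D) limn_einf (fun n => (f n x)%:E) = \int[m]_(x in D) (h x)%:E)%E.
  apply: eq_integral => x; rewrite inE => Dx.
  have c : (fun n => (f n x)%:E) @ \oo --> (h x)%:E by apply: cvg_EFin; [exact: nearW|exact: fh].
  by have [-> _] := cvg_limn_einf_sup c.
move=> /(_ (fun n => measEFin (mf n))) h1.
apply: (le_trans (h1 _)); first by move=> n x Dx; rewrite lee_fin f0.
rewrite limn_einf_lim; apply: lime_le; first exact: is_cvg_einfs.
apply: nearW => n; apply: le_trans (fB n).
by apply: ereal_inf_lbound; exists n => /=.
Qed.

End ae_tools.

(** * Limits of truncated powers, and absorption of the time derivative *)

Section limits.
Context {R : realType}.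
Implicit Types (q a k X p : R).

Lemma continuous_clamp : continuous (@clamp R).
Proof.
move=> q; apply: (@continuous_min R R (fun q => Num.max q 0) (cst 1) q); last exact: cvg_cst.
by apply: (@continuous_max R R id (cst 0) q); [exact: cvg_id|exact: cvg_cst].
Qed.

Lemma continuous_ramp : continuous (@ramp R).
Proof.
move=> q; apply: cvgB; first by apply: cvgM; [exact: continuous_clamp|exact: cvg_id].
by apply: cvgM; [apply: cvgM; exact: continuous_clamp|exact: cvg_cst].
Qed.

Lemma cvg_powR_exponent X (v : nat -> R) p : p != 0 -> (forall n, v n != 0) ->
  v @ \oo --> p -> (fun n => X `^ v n) @ \oo --> X `^ p.
Proof.
move=> p0 v0 vp; have [->|X0] := eqVneq X 0.
  rewrite powR0// (_ : (fun n => _) = cst 0); first exact: cvg_cst.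
  by apply/funext => n; rewrite powR0.
rewrite /powR (negPf X0).
apply: (@continuous_cvg _ _ _ _ _ (fun n => v n * ln X) _ _ _); first exact: continuous_expR.
by apply: cvgM => //; exact: cvg_cst.
Qed.

Lemma cvg_power_gap X (gam : R) (an dn : nat -> R) a : 0 < a -> 0 < gam -> (forall n, 0 < an n) ->
  an @ \oo --> a -> dn @ \oo --> (0 : R) ->
  (fun n => power_gap (an n) gam (dn n) X) @ \oo --> X `^ (- a).
Proof.
move=> a0 g0 an0 ha hd; rewrite /power_gap.
have -> : X `^ (- a) = X `^ (- a) - 0 * X `^ (- gam) by rewrite mul0r subr0.
apply: cvgB.
  apply: cvg_powR_exponent; first by rewrite oppr_eq0 gt_eqF.
    by move=> n; rewrite oppr_eq0 gt_eqF.
  exact: cvgN.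
by apply: cvgM => //; exact: cvg_cst.
Qed.

(** If X^(2s) is small compared with t, the left-hand side is absorbed by the
    first term; otherwise t^m is at most a multiple of X^(2sm), and the
    singularity of X^-a is compensated as soon as a <= 2s(m+1). *)
Lemma absorb_time_weight m a d Dm s : 0 < a -> 0 < d -> 0 < s -> 0 < Dm ->
  a <= 2 * s * m.+1%:R -> exists2 C, 0 <= C & forall X t c p : R,
    0 <= X <= Dm -> 0 <= t -> 0 <= c <= 1 -> 0 <= p <= c * X `^ (- a) ->
    m.+1%:R * t ^+ m * p * X `^ (2 * s) <= d / 2 * (t ^+ m.+1 * (c * X `^ (- a))) + C.
Proof.
move=> a0 d0 s0 Dm0 am.
pose ka := 2 * m.+1%:R / d.
have ka0 : 0 <= ka by rewrite divr_ge0 ?mulr_ge0// ltW.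
have ex0 : 0 <= 2 * s * m.+1%:R - a by rewrite subr_ge0.
exists (m.+1%:R * ka ^+ m * Dm `^ (2 * s * m.+1%:R - a)).
  by rewrite mulr_ge0 ?powR_ge0// mulr_ge0// exprn_ge0.
move=> X t c p /andP[X0 XD] t0 /andP[c0 c1] /andP[p0 pc].
have rhs1 : 0 <= d / 2 * (t ^+ m.+1 * (c * X `^ (- a))).
  by rewrite mulr_ge0 ?divr_ge0 ?(ltW d0)// mulr_ge0 ?exprn_ge0// mulr_ge0.
have rhs2 : 0 <= m.+1%:R * ka ^+ m * Dm `^ (2 * s * m.+1%:R - a).
  by rewrite mulr_ge0 ?powR_ge0// mulr_ge0// exprn_ge0.
have [XE|XN] := eqVneq X 0.
  rewrite {1}XE (@powR0 _ (2 * s)); last by rewrite gt_eqF// mulr_gt0.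
  by rewrite mulr0 addr_ge0.
have Xp : 0 < X by rewrite lt_neqAle eq_sym XN.
have Y0 : 0 <= c * X `^ (- a) by rewrite mulr_ge0.
apply: (@le_trans _ _ (m.+1%:R * t ^+ m * (c * X `^ (- a)) * X `^ (2 * s))).
  by rewrite ler_wpM2r// ler_wpM2l// mulr_ge0// exprn_ge0.
case: (leP (m.+1%:R * X `^ (2 * s)) (d / 2 * t)) => h.
  apply: (@le_trans _ _ (d / 2 * (t ^+ m.+1 * (c * X `^ (- a))))); last by rewrite lerDl.
  have := ler_wpM2l (mulr_ge0 (exprn_ge0 m t0) Y0) h.
  rewrite exprS; move: (t ^+ m) (c * X `^ (- a)) (X `^ (2 * s)) (d / 2) => A B C E; move/le_trans => hh.
  rewrite (_ : m.+1%:R * A * B * C = A * B * (m.+1%:R * C)); last by ring.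
  by apply: hh; rewrite le_eqVlt; apply/orP; left; apply/eqP; ring.
have tk : t <= ka * X `^ (2 * s).
  rewrite /ka -(ler_pM2l (_ : 0 < d / 2)) ?divr_gt0//; apply: (le_trans (ltW h)).
  by rewrite le_eqVlt; apply/orP; left; apply/eqP; field; rewrite gt_eqF.
have tm : t ^+ m <= ka ^+ m * X `^ (2 * s * m%:R).
  rewrite powRrM powR_mulrn ?powR_ge0// -exprMn lerXn2r// nnegrE.
  by rewrite mulr_ge0.
apply: (@le_trans _ _ (m.+1%:R * ka ^+ m * Dm `^ (2 * s * m.+1%:R - a))); last by rewrite lerDr.
apply: (@le_trans _ _ (m.+1%:R * (ka ^+ m * X `^ (2 * s * m%:R)) * (1 * X `^ (- a)) * X `^ (2 * s))).
  rewrite ler_wpM2r//; apply: ler_pM => //; first by rewrite mulr_ge0// exprn_ge0.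
    by rewrite ler_wpM2l.
  by rewrite ler_wpM2r.
have -> : m.+1%:R * (ka ^+ m * X `^ (2 * s * m%:R)) * (1 * X `^ (- a)) * X `^ (2 * s) =
  m.+1%:R * ka ^+ m * (X `^ (2 * s * m%:R) * X `^ (- a) * X `^ (2 * s)) by ring.
rewrite ler_wpM2l ?mulr_ge0 ?exprn_ge0//.
rewrite -(@gt0_powRD _ X (2 * s * m%:R) (- a) Xp).
rewrite -(@gt0_powRD _ X (2 * s * m%:R + - a) (2 * s) Xp).
rewrite (_ : 2 * s * m%:R + - a + 2 * s = 2 * s * m.+1%:R - a).
  by apply: ge0_ler_powR => //; rewrite nnegrE ltW.
by rewrite -[m.+1]addn1 natrD; ring.
Qed.

(** Where the clamp is below 1, X^-a is at most k + 1. *)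
Lemma powR_clamp_bound a gam s Dm k X : 0 < s -> 0 <= a + 2 * s - gam -> 0 <= k -> 0 <= X <= Dm ->
  X `^ (2 * s) * X `^ (- gam) <=
  Dm `^ (a + 2 * s - gam) * (clamp (X `^ (- a) - k) * X `^ (- a) + (k + 1)).
Proof.
move=> s0 p0 k0 /andP[X0 XD].
have cc := clamp_ge0 (X `^ (- a) - k).
have r0 : 0 <= clamp (X `^ (- a) - k) * X `^ (- a) + (k + 1) by rewrite addr_ge0 ?mulr_ge0// addr_ge0.
have [XE|XN] := eqVneq X 0.
  rewrite {1}XE (@powR0 _ (2 * s)); last by rewrite gt_eqF// mulr_gt0.
  by rewrite mul0r mulr_ge0.
have Xp : 0 < X by rewrite lt_neqAle eq_sym XN.
have -> : X `^ (2 * s) * X `^ (- gam) = X `^ (a + 2 * s - gam) * X `^ (- a).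
  rewrite -(@gt0_powRD _ X (2 * s) (- gam) Xp) -(@gt0_powRD _ X (a + 2 * s - gam) (- a) Xp).
  by congr (_ `^ _); ring.
apply: ler_pM => //.
  by apply: ge0_ler_powR => //; rewrite nnegrE// (le_trans X0).
move: (powR_ge0 X (- a)); move: (X `^ (- a)) => q q0.
by case: (clampP (q - k)) => *; nra.
Qed.

Lemma powR_exponent_bound a gam s Dm X : 0 < s -> 0 <= a -> a <= gam -> 1 <= Dm -> 0 <= X <= Dm ->
  X `^ (- a) * X `^ (2 * s) <= Dm `^ gam * (X `^ (2 * s) * X `^ (- gam)).
Proof.
move=> s0 a0 ag D1 /andP[X0 XD].
have [XE|XN] := eqVneq X 0.
  by rewrite XE (@powR0 _ (2 * s)) ?mulr0 ?mul0r ?mulr0// gt_eqF// mulr_gt0.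
have Xp : 0 < X by rewrite lt_neqAle eq_sym XN.
have -> : X `^ (- a) = X `^ (gam - a) * X `^ (- gam).
  by rewrite -(@gt0_powRD _ X (gam - a) (- gam) Xp); congr (_ `^ _); ring.
rewrite -mulrA (mulrC (X `^ (- gam))) ler_wpM2r ?mulr_ge0//.
apply: (@le_trans _ _ (Dm `^ (gam - a))).
  by apply: ge0_ler_powR; rewrite ?subr_ge0// nnegrE// (le_trans X0).
by apply: ler_powR => //; rewrite gerBl.
Qed.

End limits.

(** * The energy inequality and integrability at the origin *)

Section energy.
Context {R : realType} (N : nat).
Local Notation mu := (@lebesgue_measure R).
Local Notation L := (leb R N).
Local Notation P := (leb R N \x @lebesgue_measure R)%E.
Variables (s T lam gam rho Dm : R).
Variables (Omega : set 'rV[R]_N) (g : 'rV[R]_N -> R -> R) (u0 : 'rV[R]_N -> R)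
  (u : 'rV[R]_N -> R -> R).
Hypotheses (s01 : 0 < s < 1) (N0 : (0 < N)%N) (gam0 : 0 < gam) (gamN : gam < N%:R - 2 * s).
Hypotheses (lamE : lam = power_eigen s N gam) (lam0 : 0 < lam) (T0 : 0 < T).
Hypotheses (oOmega : open Omega) (OmegaD : forall x, Omega x -> enorm x < Dm).
Hypotheses (rho0 : 0 < rho) (rho1 : rho <= 1) (ballO : eball (0 : 'rV[R]_N) rho `<=` Omega).
Hypothesis hg : {ae P, forall z, Omega z.1 -> 0 < z.2 < T -> 0 <= g z.1 z.2}.
Hypothesis hu0 : L.-integrable Omega (EFin \o u0).
Hypothesis hu0_ge0 : {ae L, forall x, Omega x -> 0 <= u0 x}.
Hypothesis hu : weak_supersolution Omega s T
   (fun x t w => lam * (w / enorm x `^ (2 * s)) + g x t) u0 u.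
Hypothesis hu_gt0 : {ae P, forall z, Omega z.1 -> 0 < z.2 < T -> 0 < u z.1 z.2}.

(** u / |x|^2s, with the value 0 at the origin and where u is negative, so that
    it is nonnegative everywhere; it agrees with the quotient almost everywhere
    in the cylinder. *)
Definition hardy_quot (z : 'rV[R]_N * R) : R := Num.max (u z.1 z.2) 0 * enorm z.1 `^ (- (2 * s)).
Definition source_pos (z : 'rV[R]_N * R) : R := Num.max (g z.1 z.2) 0.
Definition init_pos (x : 'rV[R]_N) : R := Num.max (u0 x) 0.
Local Notation V := hardy_quot.
Local Notation W := source_pos.

Let I : set (measurableTypeR R) := `]0, T[%classic.
Let E : set ('rV[R]_N * measurableTypeR R) := Omega `*` I.

Let mO : measurable Omega. Proof. exact: open_rV_measurable. Qed.
Let mI : measurable I. Proof. exact: measurable_itv. Qed.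
Let mE : measurable E. Proof. exact: measurableX. Qed.
Let s0 : 0 < s. Proof. by case/andP: s01. Qed.

Lemma hardy_quot_ge0 z : 0 <= V z.
Proof. by rewrite mulr_ge0 ?powR_ge0// le_max lexx orbT. Qed.
Lemma source_pos_ge0 z : 0 <= W z.
Proof. by rewrite le_max lexx orbT. Qed.
Lemma init_pos_ge0 x : 0 <= init_pos x.
Proof. by rewrite le_max lexx orbT. Qed.

#[local] Instance ae_prod_filter : Filter (nbhs (almost_everywhere P)).
Proof. exact: (@ae_filter_ringOfSetsType _ _ R P). Qed.

Let ItT t : I t -> 0 < t < T. Proof. by rewrite /I /= in_itv. Qed.

Let mu_slab : measurable_fun (setT `*` I : set ('rV[R]_N * measurableTypeR R)) (fun z => u z.1 z.2).
Proof.
case: hu => h _; apply: measurable_funS h.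
  by apply: measurableX; [exact: measurableT|exact: measurable_itv].
by move=> [x t] [_ /ItT /andP[h1 h2]]; split => //=; rewrite in_itv/= (ltW h1) h2.
Qed.

Let mu_E : measurable_fun E (fun z => u z.1 z.2).
Proof.
apply: measurable_funS mu_slab; first exact: measurableX.
by move=> [x t] [_ h]; split.
Qed.

Let men (D : set ('rV[R]_N * measurableTypeR R)) : measurable_fun D (fun z => enorm z.1).
Proof. by apply: measurable_enorm; apply: measurable_funTS; exact: measurable_fst. Qed.

Let mt (D : set ('rV[R]_N * measurableTypeR R)) : measurable_fun D (fun z : 'rV[R]_N * measurableTypeR R => z.2 : R).
Proof. by apply: measurable_funTS; exact: measurable_snd. Qed.

Let mV : measurable_fun E V.
Proof.
apply: measM; first by apply: measurable_maxr => //; exact: measurable_cst.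
by apply: measpow; exact: men.
Qed.

Let F (z : 'rV[R]_N * R) := lam * (u z.1 z.2 / enorm z.1 `^ (2 * s)) + g z.1 z.2.

Let iF : P.-integrable E (EFin \o F).
Proof.
case: hu => _ [_ h _ _ _]; apply: (integrableS _ mE _ h).
  by apply: measurableX => //; exact: measurable_itv.
by move=> [x t] [Ox /ItT /andP[h1 h2]]; split => //=; rewrite in_itv/= (ltW h1) h2.
Qed.

Let mF : measurable_fun E F.
Proof. by have /measurable_int/measurable_EFinP := iF. Qed.

Let mquot : measurable_fun E (fun z => u z.1 z.2 / enorm z.1 `^ (2 * s)).
Proof.
rewrite (_ : (fun z => _) = (fun z => u z.1 z.2 * enorm z.1 `^ (- (2 * s)))).
  by apply: measM => //; apply: measpow; exact: men.
by apply/funext => z; rewrite powRN.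
Qed.

Let mg : measurable_fun E (fun z => g z.1 z.2).
Proof.
rewrite (_ : (fun z => _) = (fun z => F z - lam * (u z.1 z.2 / enorm z.1 `^ (2 * s)))).
  by apply: measB => //; apply: measM => //; exact: measurable_cst.
by apply/funext => z; rewrite /F addrAC subrr add0r.
Qed.

Let mW : measurable_fun E W.
Proof. by apply: measurable_maxr => //; exact: measurable_cst. Qed.

Let measurable_rV_zero : measurable [set (0 : 'rV[R]_N)].
Proof.
rewrite (_ : [set 0] = (fun x => enorm x) @^-1` [set 0]).
  rewrite -[X in measurable X]setTI; apply: measurable_enorm => //.
by apply/seteqP; split => [x ->|x /enorm_eq0]; rewrite //= enorm0.
Qed.

Lemma ae_neq0 : {ae P, forall z, z.1 != 0}.
Proof.
exists ([set 0] `*` setT); split.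
- by apply: measurableX => //; exact: measurable_rV_zero.
- rewrite product_measure1E; [|exact: measurable_rV_zero|exact: measurableT].
  apply/eqP; rewrite mule_eq0; apply/orP; left; apply/eqP; exact: leb_point.
- by move=> [x t] /=; move/negP; rewrite negbK => /eqP ->.
Qed.

Let aeu : {ae P, forall z, E z -> [/\ z.1 != 0, u z.1 z.2 = V z * enorm z.1 `^ (2 * s),
   u z.1 z.2 / enorm z.1 `^ (2 * s) = V z & g z.1 z.2 = W z]}.
Proof.
apply: filterS3 hg hu_gt0 ae_neq0 => z g0 up z0 [Oz /ItT tz].
have uz := up Oz tz; have gz := g0 Oz tz.
have nz : 0 < enorm z.1 `^ (2 * s) by rewrite powR_gt0// enorm_gt0.
have eV : V z = u z.1 z.2 / enorm z.1 `^ (2 * s).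
  by rewrite /hardy_quot powRN; congr (_ * _); apply/max_idPl; exact: ltW.
split => //.
- by rewrite eV divfK// gt_eqF.
- by rewrite /source_pos; apply/esym/max_idPl.
Qed.

Let FE : {ae P, forall z, E z -> F z = lam * V z + W z}.
Proof. by apply: filterS aeu => z h /h [_ _ e1 e2]; rewrite /F e1 e2. Qed.

Let absF_lty : (\int[P]_(z in E) (`|F z|)%:E < +oo)%E.
Proof. by have /integrableP[_] := iF. Qed.

Let int_V : has_integral P E V (\int[P]_(z in E) V z).
Proof.
apply: ge0_int_is => //.
- by move=> z _; exact: hardy_quot_ge0.
- apply: (@le_lt_trans _ _ (lam^-1%:E * \int[P]_(z in E) (`|F z|)%:E)%E); last first.
    by apply: lte_mul_pinfty => //; rewrite lee_fin invr_ge0 ltW.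
  rewrite -ge0_integralZl_real ?invr_ge0 ?(ltW lam0)//; last exact: measnorm.
  apply: ae_le_integral => //; [exact: measEFin| |].
    by apply: measEFin; apply: measM; [exact: measurable_cst|exact: measnorm].
  apply: filterS FE => z h /h ->; rewrite lee_fin ler_pdivlMl//.
  by rewrite ger0_norm ?lerDl ?source_pos_ge0// addr_ge0 ?source_pos_ge0// mulr_ge0 ?hardy_quot_ge0// ltW.
Qed.

Let int_W : has_integral P E W (\int[P]_(z in E) W z).
Proof.
apply: ge0_int_is => //.
- by move=> z _; exact: source_pos_ge0.
- apply: le_lt_trans absF_lty; apply: ae_le_integral => //; [exact: measEFin| |].
    by apply: measEFin; exact: measnorm.
  apply: filterS FE => z h /h ->; rewrite lee_fin.
  by rewrite ger0_norm ?lerDr ?addr_ge0 ?source_pos_ge0// mulr_ge0 ?hardy_quot_ge0// ltW.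
Qed.

Let mu0 : measurable_fun Omega u0.
Proof. by have /measurable_int/measurable_EFinP := hu0. Qed.

Let mU0 : measurable_fun Omega init_pos.
Proof. by apply: measurable_maxr => //; exact: measurable_cst. Qed.

Let int_U0 : has_integral L Omega init_pos (\int[L]_(x in Omega) init_pos x).
Proof.
apply: ge0_int_is => //.
- by move=> z _; exact: init_pos_ge0.
- have /integrableP[_] := hu0; apply: le_lt_trans.
  apply: ge0_le_integral => //.
  + by move=> x _; rewrite lee_fin init_pos_ge0.
  + exact: measEFin.
  + by apply: measEFin; exact: measnorm.
  + by move=> x _; rewrite lee_fin /init_pos ge_max ler_norm normr_ge0.
Qed.

Let mfst (f : 'rV[R]_N -> R) (D : set ('rV[R]_N * measurableTypeR R)) :
  measurable_fun setT f -> measurable_fun D (fun z => f z.1).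
Proof. by move=> mf; apply: measurable_funTS; exact: (measurableT_comp mf measurable_fst). Qed.

Section energy_inequality.
Variables (m : nat) (a dl : R).
Hypotheses (a0 : 0 < a) (agam : a < gam) (dl0 : 0 < dl).
Let k := rho `^ (- gam).
Let psi : 'rV[R]_N -> R := trunc_power a gam dl rho.
Let c (x : 'rV[R]_N) := clamp (power_gap a gam dl (enorm x) - k).
Let eta t : R := (T - t) ^+ m.+1.

Let psi_ge0 x : 0 <= psi x. Proof. exact: ramp_ge0. Qed.

Let psi0 x : rho <= enorm x -> psi x = 0.
Proof.
move=> h; rewrite /psi /trunc_power; apply: ramp_le0.
exact: (trunc_power_far a0 agam dl0 rho0 rho1 h).
Qed.

Let mpsi : measurable_fun setT psi. Proof. exact: measurable_trunc_power. Qed.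

Let eta_bound t : I t -> 0 <= eta t <= T ^+ m.+1.
Proof.
move=> /ItT /andP[t0 tT]; have tT0 : 0 <= T - t by rewrite subr_ge0 ltW.
by rewrite exprn_ge0//= lerXn2r// ?nnegrE ?(ltW T0)// lerBlDr lerDl ltW.
Qed.

Let c_w x : c x * power_gap a gam dl (enorm x) <= psi x + 1 + k.
Proof.
have k0 : 0 <= k by exact: powR_ge0.
rewrite /psi /trunc_power /ramp -/k /c.
have := clamp_ge0 (power_gap a gam dl (enorm x) - k).
have := clamp_le1 (power_gap a gam dl (enorm x) - k).
by move: (power_gap _ _ _ _) => w; move: (clamp _) => q q0 q1; nra.
Qed.

Let fraclap_bound x : x != 0 -> fraclap s psi x <=
  c x * (power_eigen s N a * enorm x `^ (- a - 2 * s) - dl * lam * enorm x `^ (- gam - 2 * s)).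
Proof.
move=> x0; have [M M0 [psiM _ psi2]] := trunc_power_bump N a0 agam dl0 rho0 rho1.
rewrite lamE; apply: (fraclap_le_power s01 N0 x0 M0 mpsi psiM psi2 a0 _ gam0 gamN).
  exact: lt_trans gamN.
move=> y; have := ramp_convex (power_gap a gam dl (enorm x) - k) (power_gap a gam dl (enorm y) - k).
rewrite /psi /trunc_power -/k /c /power_gap.
move=> h; rewrite -subr_ge0; move: h; congr (0 <= _).
move: (enorm y `^ (- a)) (enorm y `^ (- gam)) (enorm x `^ (- a)) (enorm x `^ (- gam)) k => y1 y2 x1 x2 K.
by move: (ramp _) (clamp _) => A C; move: (ramp _) => B; ring.
Qed.

Let pointwise x t v : x != 0 -> I t -> 0 <= v ->
  v * enorm x `^ (2 * s) * (eta t * fraclap s psi x) <=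
  lam * (eta t * psi x * v) + lam * (k + 1) * (T ^+ m.+1 * v) -
  (lam - power_eigen s N a) * (eta t * (c x * enorm x `^ (- a)) * v).
Proof.
move=> x0 It v0; have /andP[e0 eT] := eta_bound It.
have xp := enorm_gt0 x0.
have h := ler_wpM2l (mulr_ge0 (mulr_ge0 v0 (powR_ge0 (enorm x) (2 * s))) e0) (fraclap_bound x0).
rewrite (mulrA (v * _) (eta t)); apply: (le_trans h).
have e1 p : enorm x `^ (2 * s) * enorm x `^ (- p - 2 * s) = enorm x `^ (- p).
  by rewrite -(@gt0_powRD _ (enorm x) (2 * s) (- p - 2 * s) xp); congr (_ `^ _); ring.
have -> : v * enorm x `^ (2 * s) * eta t * (c x * (power_eigen s N a * enorm x `^ (- a - 2 * s) - dl * lam * enorm x `^ (- gam - 2 * s))) =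
  v * eta t * (c x * (power_eigen s N a * enorm x `^ (- a) - dl * lam * enorm x `^ (- gam))).
  by rewrite -(e1 a) -(e1 gam); ring.
have -> : v * eta t * (c x * (power_eigen s N a * enorm x `^ (- a) - dl * lam * enorm x `^ (- gam))) =
  lam * (v * eta t * (c x * power_gap a gam dl (enorm x))) - (lam - power_eigen s N a) * (eta t * (c x * enorm x `^ (- a)) * v).
  by rewrite /power_gap; ring.
rewrite lerD2r.
have k1 : 0 <= k + 1 by rewrite addr_ge0 ?powR_ge0.
have h1 := ler_wpM2l (mulr_ge0 v0 e0) (c_w x).
have h2 := ler_wpM2l k1 (ler_wpM2r v0 eT).
rewrite -(mulrA lam (k + 1)) -mulrDr ler_wpM2l ?(ltW lam0)//.
apply: (le_trans h1); move: h2; move: (eta t) (T ^+ _) (psi x) => e1' e2 p h2.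
by rewrite -subr_ge0; rewrite -subr_ge0 in h2; apply: (le_trans h2); rewrite le_eqVlt; apply/orP; left; apply/eqP; ring.
Qed.

Let meta (D : set ('rV[R]_N * measurableTypeR R)) : measurable_fun D (fun z : 'rV[R]_N * measurableTypeR R => eta z.2).
Proof. by apply: measX; apply: measB; [exact: measurable_cst|exact: mt]. Qed.

Let mc : measurable_fun setT c.
Proof.
have mp p : measurable_fun setT (fun y : 'rV[R]_N => enorm y `^ p).
  by apply: measpow; apply: measurable_enorm; exact: measurable_id.
apply: measurable_clamp; apply: measB; last exact: measurable_cst.
by apply: measB => //; apply: measM => //; exact: measurable_cst.
Qed.

(** The weight produced by the time derivative of the test function. *)
Definition time_weight (z : 'rV[R]_N * R) : R := m.+1%:R * (T - z.2) ^+ m * psi z.1 * enorm z.1 `^ (2 * s).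
Definition test_weight (z : 'rV[R]_N * R) : R := eta z.2 * psi z.1.
(** The weight multiplied by lambda - c_a in the gain term. *)
Definition gain_weight (z : 'rV[R]_N * R) : R := eta z.2 * (c z.1 * enorm z.1 `^ (- a)).

Lemma int_time_weight : has_integral P E (fun z => time_weight z * V z) (\int[P]_(z in E) (time_weight z * V z)).
Proof.
have [M M0 [psiM _ _]] := trunc_power_bump N a0 agam dl0 rho0 rho1.
apply: (has_integral_bddM (C := m.+1%:R * T ^+ m * M * Dm `^ (2 * s))) int_V => //.
  apply: measM; last by apply: measpow; exact: men.
  apply: measM; last exact: mfst.
  by apply: measM; [exact: measurable_cst|apply: measX; apply: measB; [exact: measurable_cst|exact: mt]].
move=> [x t] [Ox /ItT /andP[t0 tT]]; rewrite /time_weight /=.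
have tT0 : 0 <= T - t by rewrite subr_ge0 ltW.
rewrite normrM (ger0_norm (powR_ge0 _ _)); apply: ler_pM => //.
  rewrite normrM; apply: ler_pM => //; rewrite ger0_norm ?mulr_ge0 ?exprn_ge0//.
  by rewrite ler_wpM2l// lerXn2r// ?nnegrE ?(ltW T0)// lerBlDr lerDl ltW.
have hx := ltW (OmegaD Ox).
by apply: ge0_ler_powR; rewrite ?nnegrE ?mulr_ge0 ?(ltW s0) ?enorm_ge0// (le_trans _ hx) ?enorm_ge0.
Qed.

Let bddB : exists C, forall z, E z -> `|test_weight z| <= C.
Proof.
have [M M0 [psiM _ _]] := trunc_power_bump N a0 agam dl0 rho0 rho1.
exists (T ^+ m.+1 * M) => -[x t] [Ox /eta_bound /andP[e0 eT]]; rewrite /test_weight /= normrM.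
by apply: ler_pM => //; rewrite ger0_norm.
Qed.

Let measurable_test_weight : measurable_fun E test_weight. Proof. by apply: measM; [exact: meta|exact: mfst]. Qed.

Let int_BV : has_integral P E (fun z => test_weight z * V z) (\int[P]_(z in E) (test_weight z * V z)).
Proof. by have [C hC] := bddB; exact: (has_integral_bddM mE measurable_test_weight hC int_V). Qed.

Lemma int_test_source : has_integral P E (fun z => test_weight z * W z) (\int[P]_(z in E) (test_weight z * W z)).
Proof. by have [C hC] := bddB; exact: (has_integral_bddM mE measurable_test_weight hC int_W). Qed.

Lemma int_gain_weight : has_integral P E (fun z => gain_weight z * V z) (\int[P]_(z in E) (gain_weight z * V z)).
Proof.
have [B hB] := clamp_power_bounded N a0 agam dl0 rho0.
apply: (has_integral_bddM (C := T ^+ m.+1 * B)) int_V => //.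
  apply: measM; first exact: meta.
  by apply: measM; [exact: mfst|apply: measpow; exact: men].
move=> [x t] [Ox /eta_bound /andP[e0 eT]]; rewrite /gain_weight /= normrM.
by apply: ler_pM => //; [rewrite ger0_norm|exact: hB].
Qed.

Lemma int_test_init : has_integral L Omega (fun x => T ^+ m.+1 * psi x * init_pos x) (\int[L]_(x in Omega) (T ^+ m.+1 * psi x * init_pos x)).
Proof.
have [M M0 [psiM _ _]] := trunc_power_bump N a0 agam dl0 rho0 rho1.
have h1 : measurable_fun Omega (fun x => T ^+ m.+1 * psi x).
  by apply: measM; [exact: measurable_cst|exact: measurable_funTS].
have h2 x : Omega x -> `|T ^+ m.+1 * psi x| <= T ^+ m.+1 * M.
  by move=> _; rewrite normrM; apply: ler_pM => //; rewrite ger0_norm// exprn_ge0// ltW.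
exact: (has_integral_bddM mO h1 h2 int_U0).
Qed.

Let phi := test_fun psi T m.

Let bump : exists2 M, 0 <= M & [/\ forall x, `|psi x| <= M,
  forall x y, `|psi x - psi y| <= M * enorm (x - y) &
  forall x z, `|psi (x + z) + psi (x - z) - 2 * psi x| <= M * enorm z ^+ 2].
Proof. exact: (trunc_power_bump N a0 agam dl0 rho0 rho1). Qed.

Let phi_test : test_class Omega s T phi.
Proof.
have [M M0 [psiM psiL psi2]] := bump.
exact: (test_class_bump s01 M0 mpsi psiM psiL psi2 rho0 psi0 m oOmega OmegaD ballO T0).
Qed.

Let fraclap_phi x t : fraclap s (phi^~ t) x = eta t * fraclap s psi x.
Proof.
have [M M0 [psiM psiL psi2]] := bump.
exact: (fraclap_scaled s01 M0 mpsi psiM psi2 (eta t) x).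
Qed.

Let derive_phi x t : - derive1 (phi x) t = m.+1%:R * (T - t) ^+ m * psi x.
Proof.
have hd := is_derive_tpowZ T m (psi x) t.
rewrite derive1E (_ : 'D_1 (phi x) t = - (m.+1%:R * (T - t) ^+ m) * psi x).
  by rewrite mulNr opprK.
exact: derive_val.
Qed.

Let mfrac : measurable_fun setT (fraclap s psi).
Proof.
have [M M0 [psiM psiL psi2]] := bump.
exact: (measurable_fraclap_bump s01 M0 mpsi psiM psi2).
Qed.

Let phi_ge0 x t : 0 <= t <= T -> 0 <= phi x t.
Proof. by move=> /andP[_ tT]; rewrite mulr_ge0// exprn_ge0// subr_ge0. Qed.

Let bound_time : (\int[P]_(z in E) (- derive1 (phi z.1) z.2 * u z.1 z.2)%:E <=
  (\int[P]_(z in E) (time_weight z * V z))%:E)%E.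
Proof.
have [_ <-] := int_time_weight.
have -> : (\int[P]_(z in E) (- derive1 (phi z.1) z.2 * u z.1 z.2)%:E =
   \int[P]_(z in E) (m.+1%:R * (T - z.2) ^+ m * psi z.1 * u z.1 z.2)%:E)%E.
  by apply: eq_integral => z _; rewrite derive_phi.
apply: ae_le_integral; [exact: mE| | |].
- apply: measEFin; apply: measM; last exact: mu_E.
  apply: measM; last exact: mfst.
  by apply: measM; [exact: measurable_cst|apply: measX; apply: measB; [exact: measurable_cst|exact: mt]].
- by have [/measurable_int] := int_time_weight.
- apply: filterS aeu => z h /h [_ -> _ _].
  rewrite lee_fin le_eqVlt; apply/orP; left; apply/eqP.
  by rewrite /time_weight; move: (V z) (psi _) (enorm _ `^ _) => v p e; ring.
Qed.

Let bound_frac : (\int[P]_(z in setT `*` I) (u z.1 z.2 * fraclap s (phi^~ z.2) z.1)%:E <=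
  (lam * \int[P]_(z in E) (test_weight z * V z) +
   lam * (k + 1) * (T ^+ m.+1 * \int[P]_(z in E) V z) -
   (lam - power_eigen s N a) * \int[P]_(z in E) (gain_weight z * V z))%:E)%E.
Proof.
have h := has_integralB mE (has_integralD mE (has_integralZ lam mE int_BV)
  (has_integralZ (lam * (k + 1)) mE (has_integralZ (T ^+ m.+1) mE int_V)))
  (has_integralZ (lam - power_eigen s N a) mE int_gain_weight).
have [ih <-] := h.
have mS : measurable (setT `*` I : set ('rV[R]_N * measurableTypeR R)).
  by apply: measurableX; [exact: measurableT|exact: mI].
have EE : E = (setT `*` I) `&` E.
  by apply/seteqP; split => [[x t] [Ox It]|[x t] []].
have key (f : 'rV[R]_N * measurableTypeR R -> \bar R) :
    (\int[P]_(z in E) f z = \int[P]_(z in setT `*` I) (f \_ E) z)%E.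
  by rewrite -integral_mkcondr -EE.
rewrite [leRHS]key.
have -> : (\int[P]_(z in setT `*` I) (u z.1 z.2 * fraclap s (phi^~ z.2) z.1)%:E =
   \int[P]_(z in setT `*` I) (u z.1 z.2 * (eta z.2 * fraclap s psi z.1))%:E)%E.
  by apply: eq_integral => z _; rewrite fraclap_phi.
apply: ae_le_integral; [exact: mS| | |].
- apply: measEFin; apply: measM; first exact: mu_slab.
  by apply: measM; [exact: meta|exact: mfst].
- apply: measurable_funTS; apply/(measurable_restrictT _ mE).
  exact: (measurable_int _ ih).
- case: hu => _ [_ _ out _ _].
  apply: filterS3 aeu out ae_neq0 => -[x t] hE hout x0 [_ It].
  rewrite patchE; case: ifPn => [|nE].
    rewrite inE => Ez; have [_ e _ _] := hE Ez.
    rewrite lee_fin /= in e *; rewrite e.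
    exact: (pointwise x0 It (hardy_quot_ge0 _)).
  have nO : ~ Omega x by move=> Ox; move/negP: nE; apply; rewrite inE.
  have rx : rho <= enorm x.
    by rewrite leNgt; apply/negP => hx; apply: nO; apply: ballO; rewrite /eball/= subr0.
  have c0 : c x = 0 by apply: clamp_le0; exact: (trunc_power_far a0 agam dl0 rho0 rho1 rx).
  have f0 : fraclap s psi x <= 0 by apply: (le_trans (fraclap_bound x0)); rewrite c0 mul0r.
  have /andP[e0 _] := eta_bound It.
  have /andP[t0 tT] := ItT It.
  have u0' : 0 <= u x t by apply: hout => //=; rewrite (ltW t0) tT.
  by rewrite lee_fin /= mulr_ge0_le0// mulr_ge0_le0.
Qed.

Let bound_source : ((lam * \int[P]_(z in E) (test_weight z * V z) +
  \int[P]_(z in E) (test_weight z * W z))%:E <=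
  \int[P]_(z in E) (F z * phi z.1 z.2)%:E)%E.
Proof.
have [ih <-] := has_integralD mE (has_integralZ lam mE int_BV) int_test_source.
apply: ae_le_integral; [exact: mE|exact: (measurable_int _ ih)| |].
- apply: measEFin; apply: measM; first exact: mF.
  exact: measurable_test_weight.
- apply: filterS FE => z hz /hz ->.
  rewrite lee_fin le_eqVlt; apply/orP; left; apply/eqP.
  by rewrite /test_weight /phi /test_fun -/(eta _); move: (V z) (W z) (psi _) (eta _) => v w p e; ring.
Qed.

Let bound_init : ((\int[L]_(x in Omega) (T ^+ m.+1 * psi x * init_pos x))%:E <=
  \int[L]_(x in Omega) (u0 x * phi x 0)%:E)%E.
Proof.
have [ih <-] := int_test_init.
apply: ae_le_integral; [exact: mO|exact: (measurable_int _ ih)| |].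
- apply: measEFin; apply: measM; first exact: mu0.
  by apply: measM; [exact: measurable_cst|exact: measurable_funTS].
- apply: filterS hu0_ge0 => x hx /hx ux.
  rewrite lee_fin le_eqVlt; apply/orP; left; apply/eqP.
  by rewrite /init_pos (max_idPl ux) /phi /test_fun subr0 mulrC.
Qed.

(** Let w be the power gap and H the ramp.  The Hardy term lambda u psi /
    |x|^2s cancels against the main part of the fractional Laplacian, because w
    H'(w - k) exceeds psi = H(w - k) by at most k + 1.  Outside Omega, psi = 0
    is a minimum, so that (-Delta)^s psi <= 0 while u >= 0, and that part of
    the integral can be dropped. *)
Lemma energy_inequality :
  \int[P]_(z in E) (test_weight z * W z) +
  \int[L]_(x in Omega) (T ^+ m.+1 * psi x * init_pos x) +
  (lam - power_eigen s N a) * \int[P]_(z in E) (gain_weight z * V z) <=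
  \int[P]_(z in E) (time_weight z * V z) +
  lam * (k + 1) * (T ^+ m.+1 * \int[P]_(z in E) V z).
Proof.
case: hu => _ [_ _ _ _ /(_ _ phi_test phi_ge0)] ineq.
have h1 := leeD bound_time bound_frac.
have h2 := leeD bound_source bound_init.
have := le_trans h2 (le_trans ineq h1).
rewrite -!EFinD lee_fin.
move: (Rintegral _ _ _) (lam - power_eigen s N a) (lam * (k + 1)) => A1 d1 d2.
lra.
Qed.

End energy_inequality.

Hypotheses (gamH : gam <= (N%:R - 2 * s) / 2) (Dm1 : 1 <= Dm).
Let k := rho `^ (- gam).
Let k0 : 0 <= k. Proof. exact: powR_ge0. Qed.
Let v := \int[P]_(z in E) V z.
Let v0 : 0 <= v. Proof. by apply: Rintegral_ge0 => z _; exact: hardy_quot_ge0. Qed.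
Let dn (n : nat) : R := n.+1%:R^-1.
Let dn0 n : 0 < dn n. Proof. by rewrite invr_gt0. Qed.
Let cvg_dn : dn @ \oo --> (0 : R). Proof. exact: cvg_harmonic. Qed.

Let XD z : E z -> 0 <= enorm z.1 <= Dm.
Proof. by move=> [/OmegaD/ltW h _]; rewrite enorm_ge0. Qed.

Let tau0 z : E z -> 0 <= T - z.2.
Proof. by move=> [_ /ItT /andP[_ /ltW h]]; rewrite subr_ge0. Qed.

Let trunc_le a dl (x : 'rV[R]_N) : 0 < dl -> trunc_power a gam dl rho x <=
  clamp (power_gap a gam dl (enorm x) - k) * enorm x `^ (- a).
Proof.
move=> dl0; apply: (le_trans (ramp_le_clamp _)); rewrite ler_wpM2l ?clamp_ge0//.
by rewrite /power_gap -addrA -opprD gerBl addr_ge0// mulr_ge0// ltW.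
Qed.

Let K m := lam * (k + 1) * (T ^+ m.+1 * v).
Let K0 m : 0 <= K m.
Proof. by rewrite /K mulr_ge0 ?mulr_ge0 ?exprn_ge0 ?(ltW lam0) ?addr_ge0 ?(ltW T0). Qed.

(** Written with |x|^(2s) and |x|^-gamma as separate factors so that it
    vanishes at the origin. *)
Definition critical_weight m (z : 'rV[R]_N * R) : R :=
  (T - z.2) ^+ m.+1 * (enorm z.1 `^ (2 * s) * enorm z.1 `^ (- gam)).

Let menp (D : set ('rV[R]_N * measurableTypeR R)) p : measurable_fun D (fun z => enorm z.1 `^ p).
Proof. by apply: measpow; exact: men. Qed.

Let mtau (D : set ('rV[R]_N * measurableTypeR R)) m :
  measurable_fun D (fun z : 'rV[R]_N * measurableTypeR R => (T - z.2) ^+ m).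
Proof. by apply: measX; apply: measB; [exact: measurable_cst|exact: mt]. Qed.

Let gain_bounded a m : 0 < a -> a < gam -> a <= 2 * s * m.+1%:R ->
  exists B : R, forall n, (\int[P]_(z in E) (gain_weight m a (dn n) z * V z)%:E <= B%:E)%E.
Proof.
move=> a0 agam am.
have d0 : 0 < lam - power_eigen s N a.
  by rewrite lamE subr_gt0; exact: (power_eigen_lt s01 a0 agam gamH).
have [C C0 hC] := absorb_time_weight a0 d0 s0 (lt_le_trans ltr01 Dm1) am.
move: d0 hC; set d := lam - power_eigen s N a => d0 hC.
exists (2 / d * (C * v + K m)) => n.
have iA := int_time_weight m a0 agam (dn0 n).
have iG := int_gain_weight m a0 agam (dn0 n).
have en := energy_inequality m a0 agam (dn0 n).
have [_ ->] := iG; rewrite lee_fin.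
have le1 : \int[P]_(z in E) (time_weight m a (dn n) z * V z) <=
    d / 2 * \int[P]_(z in E) (gain_weight m a (dn n) z * V z) + C * v.
  apply: (has_integral_le mE iA (has_integralD mE (has_integralZ (d / 2) mE iG) (has_integralZ C mE int_V))) => z Ez.
  rewrite mulrA -mulrDl ler_wpM2r ?hardy_quot_ge0//.
  apply: (hC (enorm z.1) (T - z.2)); [exact: XD|exact: tau0|by rewrite clamp_ge0 clamp_le1|].
  by rewrite ramp_ge0 trunc_le.
have p1 : 0 <= \int[P]_(z in E) (test_weight m a (dn n) z * W z).
  apply: Rintegral_ge0 => z Ez; rewrite mulr_ge0 ?source_pos_ge0// mulr_ge0 ?ramp_ge0//.
  by rewrite exprn_ge0 ?tau0.
have p2 : 0 <= \int[L]_(x in Omega) (T ^+ m.+1 * trunc_power a gam (dn n) rho x * init_pos x).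
  apply: Rintegral_ge0 => x _; rewrite mulr_ge0 ?init_pos_ge0// mulr_ge0 ?ramp_ge0//.
  by rewrite exprn_ge0 ?(ltW T0).
have e2 : d * (2 / d * (C * v + K m)) = 2 * (C * v + K m) by field; rewrite gt_eqF.
rewrite -(ler_pM2l d0) e2 /K.
move: en le1 p1 p2; rewrite -/k -/v -/d.
move: (Rintegral _ _ _) (Rintegral _ _ _) (Rintegral _ _ _) (Rintegral _ _ _) => g1 g2 g3 g4.
move: (lam * (k + 1) * _) (C * v) => KK CC.
lra.
Qed.

Let mramp (D : set 'rV[R]_N) (f : R -> R) : measurable_fun setT f ->
  measurable_fun D (fun x => f (enorm x `^ (- gam) - k)).
Proof.
move=> mf; apply: measurable_funTS; apply: (measurableT_comp mf).
apply: measB; last exact: measurable_cst.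
by apply: measpow; apply: measurable_enorm; exact: measurable_id.
Qed.

(** First use of the energy inequality: the exponent a = max(gamma - 2s, gamma
    / 2) is strictly below gamma, so that the gain term has a positive
    coefficient, and is at least gamma - 2s, so that one gain of 2s already
    reaches the exponent gamma. *)
Lemma int_critical : exists m,
  has_integral P E (fun z => critical_weight m z * V z) (\int[P]_(z in E) (critical_weight m z * V z)).
Proof.
pose a := Num.max (gam - 2 * s) (gam / 2).
have a0 : 0 < a by rewrite lt_max divr_gt0// orbT.
have agam : a < gam by rewrite gt_max; apply/andP; split; move: s0 gam0; lra.
have ap : 0 <= a + 2 * s - gam by rewrite subr_ge0 -lerBlDr le_max lexx.
pose m := Num.bound (a / (2 * s)).
have am : a <= 2 * s * m.+1%:R.
  have s2 : 0 < 2 * s by rewrite mulr_gt0.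
  rewrite mulrC -ler_pdivrMr//.
  have := Num.Theory.archi_boundP (divr_ge0 (ltW a0) (ltW s2)).
  by move/ltW/le_trans; apply; rewrite ler_nat.
have [B hB] := gain_bounded a0 agam am.
exists m.
pose h (z : 'rV[R]_N * R) := (T - z.2) ^+ m.+1 * (clamp (enorm z.1 `^ (- a) - k) * enorm z.1 `^ (- a)) * V z.
have hlim : (\int[P]_(z in E) (h z)%:E <= B%:E)%E.
  apply: (fatou_le mE _ _ _ hB) => [n|n z Ez|z Ez].
  - exact: has_integral_measurable (int_gain_weight m a0 agam (dn0 n)).
  - rewrite mulr_ge0 ?hardy_quot_ge0// mulr_ge0 ?exprn_ge0 ?tau0// mulr_ge0 ?clamp_ge0//.
  - rewrite /gain_weight /h; apply: cvgM; last exact: cvg_cst.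
    apply: cvgM; first exact: cvg_cst.
    apply: cvgM; last exact: cvg_cst.
    apply: (@continuous_cvg _ _ _ _ _ (fun n => power_gap a gam (dn n) (enorm z.1) - k)); first exact: continuous_clamp.
    apply: cvgB; last exact: cvg_cst.
    exact: (@cvg_power_gap _ _ _ (fun=> a) dn a a0 gam0 (fun=> a0) (cvg_cst _) cvg_dn).
have mh : measurable_fun E h.
  apply: measM; last exact: mV.
  apply: measM; first exact: mtau.
  apply: measM; last exact: menp.
  by apply: measurable_clamp; apply: measB; [exact: menp|exact: measurable_cst].
have h0 z : E z -> 0 <= h z.
  by move=> Ez; rewrite mulr_ge0 ?hardy_quot_ge0// mulr_ge0 ?exprn_ge0 ?tau0// mulr_ge0 ?clamp_ge0.
have ih := ge0_int_is mE mh h0 (le_lt_trans hlim (ltry B)).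
have mcr : measurable_fun E (fun z => critical_weight m z * V z).
  apply: measM; last exact: mV.
  apply: measM; first exact: mtau.
  by apply: measM; exact: menp.
have cr0 z : E z -> 0 <= critical_weight m z * V z.
  by move=> Ez; rewrite mulr_ge0 ?hardy_quot_ge0// mulr_ge0 ?exprn_ge0 ?tau0// mulr_ge0.
apply: has_integral_Rintegral; first exact: mE.
have tm z : E z -> `|(T - z.2) ^+ m.+1| <= T ^+ m.+1.
  move=> Ez; have t0 := tau0 Ez; rewrite ger0_norm ?exprn_ge0//.
  rewrite lerXn2r ?nnegrE ?(ltW T0)// lerBlDr lerDl.
  by case: Ez => _ /ItT /andP[/ltW].
have iV2 := has_integral_bddM mE (mtau m.+1) tm int_V.
have j := has_integralZ (Dm `^ (a + 2 * s - gam)) mE (has_integralD mE ih (has_integralZ (k + 1) mE iV2)).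
have foo := ge0_le_int_is mE mcr cr0 _ j.
have [] := ge0_int_is mE mcr cr0 (le_lt_trans (foo _) (ltry _)); last by [].
move=> z Ez; rewrite /critical_weight /h.
have := powR_clamp_bound s0 ap k0 (XD Ez).
have q0 : 0 <= (T - z.2) ^+ m.+1 * V z by rewrite mulr_ge0 ?exprn_ge0 ?tau0 ?hardy_quot_ge0.
move/(ler_wpM2l q0).
move: ((T - z.2) ^+ m.+1) (V z) (clamp _) (Dm `^ _) (k + 1) => A1 A2 A3 A4 A5.
rewrite [A1 * _ * A2]mulrAC.
by move/le_trans; apply; rewrite le_eqVlt; apply/orP; left; apply/eqP; ring.
Qed.

Let an (n : nat) : R := gam - gam / 2 * dn n.

Let dn1 n : dn n <= 1.
Proof. by rewrite invf_le1// ler1n. Qed.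

Let an0 n : 0 < an n.
Proof.
have := ler_wpM2l (ltW (divr_gt0 gam0 (ltr0n R 2))) (dn1 n).
by rewrite /an mulr1; move: (_ * dn n) gam0 => q; lra.
Qed.

Let angam n : an n < gam.
Proof. by rewrite /an gtrBl mulr_gt0// divr_gt0. Qed.

Let cvg_an : an @ \oo --> gam.
Proof.
have -> : gam = gam - gam / 2 * 0 by rewrite mulr0 subr0.
apply: cvgB; first exact: cvg_cst.
by apply: cvgM => //; exact: cvg_cst.
Qed.

Let cvg_trunc (x : 'rV[R]_N) : (fun n => trunc_power (an n) gam (dn n) rho x) @ \oo --> ramp (enorm x `^ (- gam) - k).
Proof.
apply: (@continuous_cvg _ _ _ _ _ (fun n => power_gap (an n) gam (dn n) (enorm x) - k)); first exact: continuous_ramp.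
apply: cvgB; last exact: cvg_cst.
exact: (@cvg_power_gap R (enorm x) gam an dn gam gam0 gam0 an0 cvg_an cvg_dn).
Qed.

(** Second use of the energy inequality, along exponents increasing to gamma;
    the gain term is now only nonnegative, but the time derivative is
    controlled by [int_critical]. *)
Lemma ramp_bounds : exists j (B : R),
  (\int[P]_(z in E) ((T - z.2) ^+ j * ramp (enorm z.1 `^ (- gam) - k) * W z)%:E <= B%:E)%E /\
  (\int[L]_(x in Omega) (T ^+ j * ramp (enorm x `^ (- gam) - k) * init_pos x)%:E <= B%:E)%E.
Proof.
have [m iC] := int_critical.
move: iC; set IC := (X in has_integral _ _ _ X) => iC.
pose B := m.+2%:R * Dm `^ gam * IC + K m.+1.
have bound n : \int[P]_(z in E) (test_weight m.+1 (an n) (dn n) z * W z) <= B /\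
  \int[L]_(x in Omega) (T ^+ m.+2 * trunc_power (an n) gam (dn n) rho x * init_pos x) <= B.
  have iA := int_time_weight m.+1 (an0 n) (angam n) (dn0 n).
  have en := energy_inequality m.+1 (an0 n) (angam n) (dn0 n).
  have d0 : 0 <= lam - power_eigen s N (an n).
    by rewrite lamE subr_ge0 ltW//; exact: (power_eigen_lt s01 (an0 n) (angam n) gamH).
  have le1 : \int[P]_(z in E) (time_weight m.+1 (an n) (dn n) z * V z) <= m.+2%:R * Dm `^ gam * IC.
    apply: (has_integral_le mE iA (has_integralZ (m.+2%:R * Dm `^ gam) mE iC)) => z Ez.
    rewrite mulrA ler_wpM2r ?hardy_quot_ge0// /time_weight /critical_weight.
    have h1 := powR_exponent_bound s0 (ltW (an0 n)) (ltW (angam n)) Dm1 (XD Ez).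
    have h2 : trunc_power (an n) gam (dn n) rho z.1 <= enorm z.1 `^ (- an n).
      by apply: (le_trans (trunc_le _ _ (dn0 n))); rewrite ler_piMl ?clamp_le1.
    have q0 : 0 <= m.+2%:R * (T - z.2) ^+ m.+1 by rewrite mulr_ge0 ?exprn_ge0 ?tau0.
    have := ler_wpM2l q0 (le_trans (ler_wpM2r (powR_ge0 (enorm z.1) (2 * s)) h2) h1).
    move: (_ ^+ m.+1) (Dm `^ _) (trunc_power _ _ _ _ _) (_ * _ `^ (- gam)) => A1 A2 A3 A4.
    rewrite mulrA; move/le_trans; apply; rewrite le_eqVlt; apply/orP; left; apply/eqP; ring.
  have p1 : 0 <= \int[P]_(z in E) (test_weight m.+1 (an n) (dn n) z * W z).
    apply: Rintegral_ge0 => z Ez; rewrite mulr_ge0 ?source_pos_ge0// mulr_ge0 ?ramp_ge0//.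
    by rewrite exprn_ge0 ?tau0.
  have p2 : 0 <= \int[L]_(x in Omega) (T ^+ m.+2 * trunc_power (an n) gam (dn n) rho x * init_pos x).
    apply: Rintegral_ge0 => x _; rewrite mulr_ge0 ?init_pos_ge0// mulr_ge0 ?ramp_ge0//.
    by rewrite exprn_ge0 ?(ltW T0).
  have p3 : 0 <= \int[P]_(z in E) (gain_weight m.+1 (an n) (dn n) z * V z).
    apply: Rintegral_ge0 => z Ez; rewrite mulr_ge0 ?hardy_quot_ge0// mulr_ge0 ?exprn_ge0 ?tau0//.
    by rewrite mulr_ge0 ?clamp_ge0.
  have p4 := mulr_ge0 d0 p3.
  move: en le1 p1 p2 p4; rewrite /B /K -/k -/v.
  move: (_ * Rintegral _ _ _) => g0.
  move: (Rintegral _ _ _) (Rintegral _ _ _) (Rintegral _ _ _) => g1 g2 g3.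
  move: (lam * (k + 1) * _) (_ * IC) => KK CC.
  by move=> *; split; lra.
exists m.+2, B; split.
- refine (@fatou_le _ _ R P E (fun n z => test_weight m.+1 (an n) (dn n) z * W z)
    (fun z => (T - z.2) ^+ m.+2 * ramp (enorm z.1 `^ (- gam) - k) * W z) B mE _ _ _ _) => [n|n z Ez|z Ez|n].
  + exact: has_integral_measurable (int_test_source m.+1 (an0 n) (angam n) (dn0 n)).
  + by rewrite mulr_ge0 ?source_pos_ge0// mulr_ge0 ?ramp_ge0// exprn_ge0 ?tau0.
  + apply: cvgM; last exact: cvg_cst.
    by apply: cvgM; [exact: cvg_cst|exact: cvg_trunc].
  + have [_ ->] := int_test_source m.+1 (an0 n) (angam n) (dn0 n).
    by rewrite lee_fin; case: (bound n).
- refine (@fatou_le _ _ R L Omega (fun n x => T ^+ m.+2 * trunc_power (an n) gam (dn n) rho x * init_pos x)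
    (fun x => T ^+ m.+2 * ramp (enorm x `^ (- gam) - k) * init_pos x) B mO _ _ _ _) => [n|n x Ox|x Ox|n].
  + exact: has_integral_measurable (int_test_init m.+1 (an0 n) (angam n) (dn0 n)).
  + by rewrite mulr_ge0 ?init_pos_ge0// mulr_ge0 ?ramp_ge0// exprn_ge0 ?(ltW T0).
  + apply: cvgM; last exact: cvg_cst.
    by apply: cvgM; [exact: cvg_cst|exact: cvg_trunc].
  + have [_ ->] := int_test_init m.+1 (an0 n) (angam n) (dn0 n).
    by rewrite lee_fin; case: (bound n).
Qed.

Let power_le_ramp (x : 'rV[R]_N) : enorm x `^ (- gam) <= ramp (enorm x `^ (- gam) - k) + (k + 1).
Proof. by have := le_ramp (enorm x `^ (- gam) - k); move: (enorm x `^ _) => b; move: (ramp _) => a; lra. Qed.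

(** |x|^-gamma exceeds the ramp by at most k + 1, and T - t is bounded below
    for t < t2. *)
Lemma local_integrability r t1 t2 : eball (0 : 'rV[R]_N) r `<=` Omega -> 0 <= t1 -> t2 < T ->
  (\int[P]_(z in eball 0%R r `*` `]t1, t2[) (enorm z.1 `^ (- gam) * g z.1 z.2)%:E < +oo)%E /\
  (\int[L]_(x in eball 0%R r) (enorm x `^ (- gam) * u0 x)%:E < +oo)%E.
Proof.
move=> rO t10 t2T; have [j [B [hW hU]]] := ramp_bounds.
have mrm : measurable_fun setT (fun x : 'rV[R]_N => ramp (enorm x `^ (- gam) - k)).
  by apply: (@mramp setT ramp); apply: measurable_ramp; exact: measurable_id.
split.
- pose D : set ('rV[R]_N * measurableTypeR R) := eball (0 : 'rV[R]_N) r `*` `]t1, t2[%classic.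
  have mD : measurable D by apply: measurableX; [exact: measurable_eball|exact: measurable_itv].
  have DE : D `<=` E.
    move=> [x t] [xr]; rewrite /= in_itv/= => /andP[h1 h2]; split; first exact: rO.
    by rewrite /I/= in_itv/= (le_lt_trans t10 h1) (lt_trans h2 t2T).
  have t0 : 0 < T - t2 by rewrite subr_gt0.
  have mfW : measurable_fun E (fun z => (T - z.2) ^+ j * ramp (enorm z.1 `^ (- gam) - k) * W z).
    apply: measM; last exact: mW.
    by apply: measM; [exact: mtau|exact: (@mfst (fun x => ramp (enorm x `^ (- gam) - k)) E mrm)].
  have fW0 z : E z -> 0 <= (T - z.2) ^+ j * ramp (enorm z.1 `^ (- gam) - k) * W z.
    by move=> Ez; rewrite mulr_ge0 ?source_pos_ge0// mulr_ge0 ?ramp_ge0// exprn_ge0 ?tau0.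
  have iW := ge0_int_is mE mfW fW0 (le_lt_trans hW (ltry B)).
  have h := has_integralD mE (has_integralZ ((T - t2) ^- j) mE iW) (has_integralZ (k + 1) mE int_W).
  have mh := has_integral_measurable h.
  have k1 : 0 <= k + 1 by rewrite addr_ge0.
  apply: (@le_lt_trans _ _ (\int[P]_(z in D) ((T - t2) ^- j * ((T - z.2) ^+ j * ramp (enorm z.1 `^ (- gam) - k) * W z) + (k + 1) * W z)%:E)%E).
    apply: ae_le_integral; [exact: mD| | |].
    + apply: measEFin; apply: measM; first exact: menp.
      exact: (measurable_funS mE DE mg).
    + by apply: measEFin; exact: (measurable_funS mE DE mh).
    + apply: aeW => z Dz; rewrite lee_fin.
      have gW : g z.1 z.2 <= W z by rewrite /source_pos le_max lexx.
      apply: (le_trans (ler_wpM2l (powR_ge0 _ _) gW)).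
      apply: (le_trans (ler_wpM2r (source_pos_ge0 z) (power_le_ramp z.1))).
      rewrite mulrDl lerD2r 2!mulrA ler_wpM2r ?source_pos_ge0//.
      rewrite ler_peMl ?ramp_ge0//.
      rewrite mulrC ler_pdivlMr ?exprn_gt0// mul1r lerXn2r ?nnegrE ?(ltW t0) ?(tau0 (DE _ Dz))//.
      by case: Dz => _ /=; rewrite in_itv/= => /andP[_ /ltW h2]; rewrite lerD2l lerN2.
  have [_ hv] := h.
  apply: le_lt_trans (eq_ind_r (fun e => (e < +oo)%E) (ltry _) hv).
  apply: ge0_subset_integral; [exact: mD|exact: mE|by apply: measEFin| |exact: DE].
  move=> z Ez; rewrite lee_fin; apply: addr_ge0; last exact: mulr_ge0 k1 (source_pos_ge0 z).
  by apply: mulr_ge0 (fW0 z Ez); rewrite invr_ge0 exprn_ge0 ?(ltW t0).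
- have mD := measurable_eball (N := N) r.
  have mfU : measurable_fun Omega (fun x => T ^+ j * ramp (enorm x `^ (- gam) - k) * init_pos x).
    apply: measM; last exact: mU0.
    by apply: measM; [exact: measurable_cst|exact: measurable_funTS].
  have fU0 x : Omega x -> 0 <= T ^+ j * ramp (enorm x `^ (- gam) - k) * init_pos x.
    by move=> _; rewrite mulr_ge0 ?init_pos_ge0// mulr_ge0 ?ramp_ge0// exprn_ge0 ?(ltW T0).
  have iU := ge0_int_is mO mfU fU0 (le_lt_trans hU (ltry B)).
  have h := has_integralD mO (has_integralZ (T ^- j) mO iU) (has_integralZ (k + 1) mO int_U0).
  have mh := has_integral_measurable h.
  have k1 : 0 <= k + 1 by rewrite addr_ge0.
  have Tj : 0 < T ^+ j by rewrite exprn_gt0.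
  apply: (@le_lt_trans _ _ (\int[L]_(x in eball 0%R r) (T ^- j * (T ^+ j * ramp (enorm x `^ (- gam) - k) * init_pos x) + (k + 1) * init_pos x)%:E)%E).
    apply: ae_le_integral; [exact: mD| | |].
    + apply: measEFin; apply: measM; last exact: (measurable_funS mO rO mu0).
      by apply: measpow; apply: measurable_enorm; apply: measurable_funTS; exact: measurable_id.
    + by apply: measEFin; exact: (measurable_funS mO rO mh).
    + apply: aeW => x Dx; rewrite lee_fin.
      have gW : u0 x <= init_pos x by rewrite /init_pos le_max lexx.
      apply: (le_trans (ler_wpM2l (powR_ge0 _ _) gW)).
      apply: (le_trans (ler_wpM2r (init_pos_ge0 x) (power_le_ramp x))).
      by rewrite mulrDl lerD2r 2!mulrA mulVf ?gt_eqF// mul1r.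
  have [_ hv] := h.
  apply: le_lt_trans (eq_ind_r (fun e => (e < +oo)%E) (ltry _) hv).
  apply: ge0_subset_integral; [exact: mD|exact: mO|by apply: measEFin| |exact: rO].
  move=> x Ox; rewrite lee_fin; apply: addr_ge0; last exact: mulr_ge0 k1 (init_pos_ge0 x).
  by apply: mulr_ge0 (fU0 x Ox); rewrite invr_ge0 ltW.
Qed.

End energy.

(** * Geometry of the domain, and the theorem *)

Section domain.
Context {R : realType} (N : nat).
Variable Omega : set 'rV[R]_N.

(** The ambient boundedness refers to the sup norm. *)
Lemma bounded_enorm : bounded_set Omega ->
  exists2 D : R, 1 <= D & forall x, Omega x -> enorm x < D.
Proof.
move=> [M [_ hM]].
have h x : Omega x -> `|x| <= Num.max M 0 + 1.
  by move=> Ox; apply: hM => //; rewrite (@le_lt_trans _ _ (Num.max M 0)) ?le_max ?lexx// ltrDl.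
pose D := N%:R * (Num.max M 0 + 1) + 1.
have D0 : 0 <= Num.max M 0 + 1 by rewrite addr_ge0// le_max lexx orbT.
exists D; first by rewrite lerDr mulr_ge0.
move=> x /h hx; rewrite /D.
apply: (@le_lt_trans _ _ (N%:R * `|x|)); first exact: ler_enorm_norm.
by rewrite (@le_lt_trans _ _ (N%:R * (Num.max M 0 + 1))) ?ler_wpM2l// ltrDl.
Qed.

Lemma eball_subset_open : open Omega -> Omega 0 ->
  exists rho : R, [/\ 0 < rho, rho <= 1 & eball (0 : 'rV[R]_N) rho `<=` Omega].
Proof.
move=> oO O0.
have /nbhs_ballP[e /= e0 eO] : nbhs (0 : 'rV[R]_N) Omega by move: oO; rewrite openE => /(_ _ O0).
exists (Num.min e 1); split; [by rewrite lt_min e0 ltr01|by rewrite ge_min lexx orbT|].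
move=> x; rewrite /eball /= subr0 lt_min => /andP[xe _].
apply: eO; split => // i j; rewrite ord1 /ball /= mxE sub0r normrN.
exact: le_lt_trans (ler_coord_enorm x j) xe.
Qed.

(** The end points t1 and t2 are limits of times in the cylinder, so that the
    closure contains (0, t1) and (0, t2). *)
Lemma compactly_contained_cylinder (T r t1 t2 : R) : 0 < r -> t1 < t2 ->
  compactly_contained (eball (0 : 'rV[R]_N) r `*` `]t1, t2[) (Omega `*` `]0, T[) ->
  [/\ eball (0 : 'rV[R]_N) r `<=` Omega, 0 <= t1 & t2 < T].
Proof.
move=> r0 t12 [_ hsub].
have sub z : (eball (0 : 'rV[R]_N) r `*` `]t1, t2[) z -> (Omega `*` `]0, T[) z.
  by move=> h; apply: hsub; exact: subset_closure.
pose tm := (t1 + t2) / 2.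
have b0 : eball (0 : 'rV[R]_N) r 0 by rewrite /eball/= subrr enorm0.
have endpoint t : (forall e, 0 < e -> exists2 t', t1 < t' < t2 & `|t - t'| < e) ->
    (Omega `*` `]0, T[) (0 : 'rV[R]_N, t).
  move=> ht; suff : closure (eball (0 : 'rV[R]_N) r `*` `]t1, t2[) (0 : 'rV[R]_N, t) by exact: hsub.
  move=> B nB.
  have [[P Q] /= [nP nQ] PQB] := nB.
  have /nbhs_ballP[e /= e0 eQ] := nQ.
  have [t' tt' te] := ht _ e0.
  exists (0, t'); split; last by apply: PQB; split; [exact: nbhs_singleton|exact: eQ].
  by split => //=; rewrite in_itv/=.
split.
- move=> x xr; have [] // := sub (x, tm) _.
  by split => //=; rewrite in_itv/= /tm; apply/andP; split; lra.
- have [|_] := endpoint t1; last by rewrite /= in_itv/= => /andP[/ltW].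
  move=> e e0; exists (t1 + Num.min (e / 2) ((t2 - t1) / 2)).
    rewrite ltrDl lt_min !divr_gt0 ?subr_gt0//=.
    have : Num.min (e / 2) ((t2 - t1) / 2) <= (t2 - t1) / 2 by rewrite ge_min lexx orbT.
    by move: (Num.min _ _) => q; move: t12; lra.
  rewrite opprD addrA subrr sub0r normrN ger0_norm.
    have : Num.min (e / 2) ((t2 - t1) / 2) <= e / 2 by rewrite ge_min lexx.
    by move: (Num.min _ _) => q; move: e0; lra.
  by rewrite le_min !divr_ge0 ?subr_ge0 ?(ltW e0) ?(ltW t12).
- have [|_] := endpoint t2; last by rewrite /= in_itv/= => /andP[].
  move=> e e0; exists (t2 - Num.min (e / 2) ((t2 - t1) / 2)).
    rewrite gtrDl oppr_lt0 lt_min !divr_gt0 ?subr_gt0//= andbT.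
    have : Num.min (e / 2) ((t2 - t1) / 2) <= (t2 - t1) / 2 by rewrite ge_min lexx orbT.
    by move: (Num.min _ _) => q; move: t12; lra.
  rewrite opprB addrC subrK ger0_norm.
    have : Num.min (e / 2) ((t2 - t1) / 2) <= e / 2 by rewrite ge_min lexx.
    by move: (Num.min _ _) => q; move: e0; lra.
  by rewrite le_min !divr_ge0 ?subr_ge0 ?(ltW e0) ?(ltW t12).
Qed.

End domain.

Theorem theorem5p1 (R : realType) (N : nat) (s T lambda alpha : R)
    (Omega : set 'rV[R]_N) (g : 'rV[R]_N -> R -> R) (u0 : 'rV[R]_N -> R)
    (u : 'rV[R]_N -> R -> R)
    (hs : 0 < s < 1) (hN : 2 * s < N%:R)
    (hOmega : bounded_C11_domain Omega) (hOmega0 : Omega 0) (hT : 0 < T)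
    (hlambda : 0 < lambda <= hardy_const N s)
    (halpha : 0 <= alpha < (N%:R - 2 * s) / 2)
    (hlambda_alpha : lambda = lambda_of_alpha N s alpha)
    (hg : {ae (leb R N \x @lebesgue_measure R)%E,
             forall z, Omega z.1 -> 0 < z.2 < T -> 0 <= g z.1 z.2})
    (hu0 : (leb R N).-integrable Omega (EFin \o u0))
    (hu0_ge0 : {ae leb R N, forall x, Omega x -> 0 <= u0 x})
    (hu0_neq0 : ~ {ae leb R N, forall x, Omega x -> u0 x = 0})
    (hu : weak_supersolution Omega s T
            (fun x t w => lambda * (w / enorm x `^ (2 * s)) + g x t) u0 u)
    (hu_gt0 : {ae (leb R N \x @lebesgue_measure R)%E,
                 forall z, Omega z.1 -> 0 < z.2 < T -> 0 < u z.1 z.2}) :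
  let gamma := (N%:R - 2 * s) / 2 - alpha in
  forall r t1 t2 : R, 0 < r -> t1 < t2 ->
    compactly_contained (eball 0 r `*` `]t1, t2[) (Omega `*` `]0, T[) ->
    (\int[leb R N \x @lebesgue_measure R]_(z in eball 0%R r `*` `]t1, t2[)
       (enorm z.1 `^ (- gamma) * g z.1 z.2)%:E < +oo)%E /\
    (\int[leb R N]_(x in eball 0%R r) (enorm x `^ (- gamma) * u0 x)%:E < +oo)%E.
Proof.
move=> gamma r t1 t2 r0 t12 hcyl.
have /andP[s0 s1] := hs; have /andP[al0 al1] := halpha; have /andP[lam0 _] := hlambda.
have N0 : (0 < N)%N by rewrite -(ltr0n R); apply: lt_trans hN; rewrite mulr_gt0.
have gam0 : 0 < gamma by rewrite subr_gt0.
have gamH : gamma <= (N%:R - 2 * s) / 2 by rewrite gerBl.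
have gamN : gamma < N%:R - 2 * s.
  by apply: (le_lt_trans gamH); rewrite ltr_pdivrMr// ltr_pMr ?ltr1n// subr_gt0.
have lamE : lambda = power_eigen s N gamma.
  by rewrite hlambda_alpha (lambda_of_alphaE hs halpha).
have [oO _ bO _] := hOmega.
have [D D1 OD] := bounded_enorm bO.
have [rho [rho0 rho1 bO']] := eball_subset_open oO hOmega0.
have [rO t10 t2T] := compactly_contained_cylinder r0 t12 hcyl.
exact: (local_integrability hs N0 gam0 gamN lamE lam0 hT oO OD rho0 rho1 bO'
  hg hu0 hu0_ge0 hu hu_gt0 gamH D1 rO t10 t2T).
Qed.
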